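(* Let $r\ge2$ and let $\boldsymbol G_{4r-2}(\tau)=(g_1(\tau),\ldots,g_{2r-1}(\tau),g_1^\vee(\tau),\ldots,g_{2r-1}^\vee(\tau))^T$, with $g_j,g_j^\vee$ as defined in the context. Then $\boldsymbol G_{4r-2}(\tau)$ is a vector-valued automorphic form (of weight $0$) of some multiplier for the group generated by $\begin{pmatrix}1&2\\0&1\end{pmatrix}$ and $\begin{pmatrix}1&0\\4&1\end{pmatrix}$. In particular, for odd $r\ge3$, $\boldsymbol G_{4r-2}(\tau)$ is a vector-valued modular function (of weight $0$) of some multiplier with respect to the congruence subgroup $\Gamma_0(2)$.
   Context: Notation: $\tau\in\mathbb{H}$ (upper half-plane), $q=e^{2\pi i\tau}$, $q^x=e^{2\pi ix\tau}$ for rational $x$; $(a;p)_\infty=\prod_{n\ge0}(1-ap^n)$, $(a_1,\ldots,a_k;p)_\infty=\prod_i(a_i;p)_\infty$ for $|p|<1$. For $1\le j\le 2r-1$, the functions $g_j,g_j^\vee$ on $\mathbb{H}$ are defined by $$g_j(\tau)=q^{\frac{(4r-4j+1)^2}{32r-8}}\left(q^{\frac{2j-r-1}2}\frac{(q^{8r-4j},q^{8r+4j-4},q^{16r-4};q^{16r-4})_\infty}{(q,q^3,q^4;q^4)_\infty}+\frac{(-q^{2j-1},q^{4r-2j},-q^{4r-1};-q^{4r-1})_\infty}{(q^2,q^2,q^4;q^4)_\infty}\right),$$ $$g_j^\vee(2\tau)=\frac12q^{\frac{2j^2-2j-2r+1}{16r-4}}\left(\frac{(q^{2r-j},q^{2r+j-1},q^{4r-1};q^{4r-1})_\infty}{(q,q^3,q^4;q^4)_\infty}+(-1)^{\frac{j(j-1)}2}\frac{((-q)^{2r-j},(-q)^{2r+j-1},-q^{4r-1};-q^{4r-1})_\infty}{(-q,-q^3,q^4;q^4)_\infty}\right).$$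 Let $\Gamma'$ be a discrete subgroup of $PSL_2(\mathbb{R})$ acting on $\mathbb{H}$ by $\gamma\tau=\frac{a\tau+b}{c\tau+d}$, and $\rho:\Gamma'\to GL_n(\mathbb{C})$ a representation. A column vector $\boldsymbol F=(f_1,\ldots,f_n)^T$ of meromorphic functions on $\mathbb{H}$ is a vector-valued automorphic form of multiplier $\rho$ (and weight $0$) for $\Gamma'$ if $\boldsymbol F(\gamma\tau)=\rho(\gamma)\boldsymbol F(\tau)$ for all $\gamma\in\Gamma'$. If moreover $\Gamma'$ is a finite-index subgroup of the full modular group $\Gamma$ and for every $\gamma\in\Gamma$ and every $i$ there is a positive integer $N_{\gamma,i}$ with $f_i(\gamma\tau)=\sum_na_ne^{2\pi in\tau/N_{\gamma,i}}$, $a_n=0$ for $n\ll0$, then $\boldsymbol F$ is a vector-valued modular function of multiplier $\rho$ (weight $0$) for $\Gamma'$. ''Of some multiplier'' means that such a $\rho$ exists. $\Gamma_0(2)$ is the group of matrices in the full modular group whose lower-left entry is even (viewed through its action on $\mathbb{H}$). *)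

(* Defs.v *)
From HB Require Import structures.
From mathcomp Require Import all_boot all_order all_algebra.
From mathcomp Require Import complex.
From mathcomp Require Import all_classical all_reals all_analysis.

Set Implicit Arguments.
Unset Strict Implicit.
Unset Printing Implicit Defensive.

Import Order.TTheory GRing.Theory Num.Theory.
Import numFieldNormedType.Exports.

Local Open Scope classical_set_scope.
Local Open Scope ring_scope.
Local Open Scope complex_scope.

(* [R[i]] repackaged as a [numClosedFieldType]: the topology and the norm that
   the analysis library puts on every [numFieldType] are found for [CC R], but
   not for the bare [R[i]]. *)
Definition CC (R : realType) : numClosedFieldType := R[i].

Definition ofR (R : realType) (x : R) : CC R := x%:C.

Definition imag (R : realType) (z : CC R) : R := complex.Im z.

Definition upper_half_plane (R : realType) : set (CC R) :=
  [set t | 0 < imag t].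
Arguments upper_half_plane {R}.

Definition cexp (R : realType) (z : CC R) : CC R :=
  ofR (expR (complex.Re z)) * (cos (complex.Im z) +i* sin (complex.Im z)).

(* [qpow x t] is $q^x = e^{2\pi i x\tau}$. *)
Definition qpow (R : realType) (x : rat) (t : CC R) : CC R :=
  cexp (2 * ofR pi * (0 +i* 1) * ratr x * t).

(* $(a;p)_\infty$ and $(a_1,\ldots,a_k;p)_\infty$; only used for $|p|<1$, where
   the limit exists. *)
Definition qpoch (R : realType) (a p : CC R) : CC R :=
  limn (fun N : nat => \prod_(0 <= n < N) (1 - a * p ^+ n)).

Definition qpochs (R : realType) (s : seq (CC R)) (p : CC R) : CC R :=
  \prod_(a <- s) qpoch a p.

(* In the three functions below $1 \le j \le 2r-1$, so that the subtractions of
   natural numbers in the exponents are not truncated. *)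
Definition g (R : realType) (r j : nat) (t : CC R) : CC R :=
  let q := qpow 1 t in
  qpow ((4 * r%:R - 4 * j%:R + 1) ^+ 2 / (32 * r%:R - 8)) t *
  (qpow ((2 * j%:R - r%:R - 1) / 2) t *
     (qpochs [:: q ^+ (8 * r - 4 * j); q ^+ (8 * r + 4 * j - 4);
                 q ^+ (16 * r - 4)] (q ^+ (16 * r - 4)) /
      qpochs [:: q; q ^+ 3; q ^+ 4] (q ^+ 4)) +
   qpochs [:: - q ^+ (2 * j - 1); q ^+ (4 * r - 2 * j); - q ^+ (4 * r - 1)]
     (- q ^+ (4 * r - 1)) /
   qpochs [:: q ^+ 2; q ^+ 2; q ^+ 4] (q ^+ 4)).

(* $\tau \mapsto g_j^\vee(2\tau)$ *)
Definition gdual_double (R : realType) (r j : nat) (t : CC R) : CC R :=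
  let q := qpow 1 t in
  2^-1 *
  qpow ((2 * j%:R ^+ 2 - 2 * j%:R - 2 * r%:R + 1) / (16 * r%:R - 4)) t *
  (qpochs [:: q ^+ (2 * r - j); q ^+ (2 * r + j - 1); q ^+ (4 * r - 1)]
     (q ^+ (4 * r - 1)) /
   qpochs [:: q; q ^+ 3; q ^+ 4] (q ^+ 4) +
   (-1) ^+ ((j * (j - 1)) %/ 2) *
   (qpochs [:: (- q) ^+ (2 * r - j); (- q) ^+ (2 * r + j - 1);
               - q ^+ (4 * r - 1)] (- q ^+ (4 * r - 1)) /
    qpochs [:: - q; - q ^+ 3; q ^+ 4] (q ^+ 4))).

Definition gdual (R : realType) (r j : nat) (t : CC R) : CC R :=
  gdual_double r j (t / 2).

(* $\boldsymbol G_{4r-2}$, with $4r-2 = (2r-1)+(2r-1)$ *)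
Definition Gvec (R : realType) (r : nat) (t : CC R) :
    'cV[CC R]_((2 * r - 1) + (2 * r - 1)) :=
  col_mx (\col_i g r i.+1 t) (\col_i gdual r i.+1 t).

Definition holomorphic_at (R : realType) (f : CC R -> CC R) (z0 : CC R) : Prop :=
  \forall z \near z0, derivable f z 1.

(* The value of [f] at the pole itself is irrelevant. *)
Definition pole (R : realType) (f : CC R -> CC R) (z0 : CC R) : Prop :=
  exists (m : nat) (h : CC R -> CC R),
    [/\ (0 < m)%N, holomorphic_at h z0, h z0 != 0 &
        \forall z \near z0^', f z = h z / (z - z0) ^+ m].

Definition meromorphic_on (R : realType) (U : set (CC R)) (f : CC R -> CC R) :
    Prop :=
  forall z, U z -> holomorphic_at f z \/ pole f z.

Definition mobius (R : realType) (A : 'M[R]_2) (t : CC R) : CC R :=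
  (ofR (A 0 0) * t + ofR (A 0 1)) / (ofR (A 1 0) * t + ofR (A 1 1)).

(* Subsets of $PSL_2(\mathbb{R})$ are represented by their preimages in
   $SL_2(\mathbb{R})$, i.e. by sets of matrices stable under [A |-> - A];
   functions on them are functions of [A] that are invariant under
   [A |-> - A]. *)
Definition PSL2_subgroup (R : realType) (H : set 'M[R]_2) : Prop :=
  [/\ forall A, H A -> \det A = 1,
      H 1%:M,
      forall A, H A -> H (- A),
      forall A B, H A -> H B -> H (A *m B) &
      forall A, H A -> H (invmx A)].

(* $SL_2(\mathbb{R}) \to PSL_2(\mathbb{R})$ has finite fibres, so discreteness
   can be tested on the preimage. *)
Definition discrete_PSL2_subgroup (R : realType) (H : set 'M[R]_2) : Prop :=
  PSL2_subgroup H /\ (forall A, H A -> isolated H A).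

Definition PSL2_generated (R : realType) (S : set 'M[R]_2) : set 'M[R]_2 :=
  smallest (@PSL2_subgroup R) S.

Definition PSL2_representation (R : realType) (n : nat) (H : set 'M[R]_2)
    (rho : 'M[R]_2 -> 'M[CC R]_n) : Prop :=
  [/\ forall A, H A -> rho A \in unitmx,
      forall A, H A -> rho (- A) = rho A &
      forall A B, H A -> H B -> rho (A *m B) = rho A *m rho B].

Definition modular_group (R : realType) : set 'M[R]_2 :=
  [set map_mx intr B | B in [set B : 'M[int]_2 | \det B = 1]].
Arguments modular_group {R}.

Definition Gamma0_2 (R : realType) : set 'M[R]_2 :=
  [set map_mx intr B | B in
     [set B : 'M[int]_2 | \det B = 1 /\ (2 %| B 1%R 0%R)%Z]].
Arguments Gamma0_2 {R}.

Definition finite_index (R : realType) (H K : set 'M[R]_2) : Prop :=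
  H `<=` K /\ finite_set [set [set A *m B | A in H] | B in K].

(* [F (g t) = rho g F t] is an identity between meromorphic functions, hence
   the restriction to those [t] for which no entry of either side has a pole. *)
Definition vv_automorphic_form (R : realType) (n : nat) (H : set 'M[R]_2)
    (rho : 'M[R]_2 -> 'M[CC R]_n) (F : CC R -> 'cV[CC R]_n) : Prop :=
  [/\ discrete_PSL2_subgroup H,
      PSL2_representation H rho,
      forall i, meromorphic_on upper_half_plane (fun t => F t i 0) &
      forall A t, H A -> upper_half_plane t ->
        (forall i, ~ pole (fun z => F z i 0) t /\
                   ~ pole (fun z => F z i 0) (mobius A t)) ->
        F (mobius A t) = rho A *m F t].

(* The expansion [f t = \sum_n a_n e^(2 pi i n t / N)], with [a_n = 0] for
   [n << 0].  Since [f] may have poles in the upper half-plane, it is required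
   on the largest half-plane [Im t > c], [c >= 0], without poles of [f] (which
   has to exist); this is the whole upper half-plane if [f] has no pole. *)
Definition has_Laurent_qexpansion (R : realType) (f : CC R -> CC R) : Prop :=
  (exists c : R, forall t, upper_half_plane t -> c < imag t -> ~ pole f t) /\
  exists (N : nat) (a : int -> CC R) (m : int),
    [/\ (0 < N)%N, forall n, n < m -> a n = 0 &
        forall t, upper_half_plane t ->
          (forall t', imag t <= imag t' -> ~ pole f t') ->
          series (fun k : nat =>
            a (m + k%:Z) * qpow ((m + k%:Z)%:~R / N%:R) t) @ \oo --> f t].

Definition vv_modular_function (R : realType) (n : nat) (H : set 'M[R]_2)
    (rho : 'M[R]_2 -> 'M[CC R]_n) (F : CC R -> 'cV[CC R]_n) : Prop :=
  [/\ vv_automorphic_form H rho F,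
      finite_index H modular_group &
      forall A, modular_group A ->
        forall i, has_Laurent_qexpansion (fun t => F (mobius A t) i 0)].

Definition mx22 (R : realType) (a b c d : R) : 'M[R]_2 :=
  \matrix_(i, j) if i == 0 then (if j == 0 then a else b)
                 else (if j == 0 then c else d).

(* Main.v *)
Require Import Defs.
From HB Require Import structures.
From mathcomp Require Import all_boot all_order all_algebra complex.
From mathcomp Require Import all_classical all_reals all_analysis.
From mathcomp Require Import ring lra zify.

Set Implicit Arguments.
Unset Strict Implicit.
Unset Printing Implicit Defensive.

Import Order.TTheory GRing.Theory Num.Theory.
Import numFieldNormedType.Exports.

Local Open Scope classical_set_scope.
Local Open Scope ring_scope.

(* Write N = 4r - 1, e(x) = exp(2 pi i x) and W tau = -1/(2 tau).  By the Jacobi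
   triple product, g_j = A_j / D_1 + B_j / D_2, and g_j^\vee(2 tau) combines the
   values of C_j / D_1 at tau and tau + 1/2, where A_j, B_j, C_j, D_1, D_2 are
   theta series in tau.  The inversion formula sends the theta series of tau to
   c(tau) times one of -1/tau; sorting the odd integers by their class up to sign
   modulo 2N turns it into
     g_j^\vee(W tau) = const * \sum_k 2 cos(pi (2j-1)(2k-1) / 2N) g_k(tau),
   with a matrix whose square is N, so that W acts linearly on G.  Translations
   act diagonally, and tau |-> tau / (2 k tau + 1) is W T^(-k) W.
   The factor c(tau) is not computed: the heat equation for theta yields that
   c(x tau) / c(tau) does not depend on tau, which is all that is needed.
   No linear independence of the entries of G is needed for the multiplier: it is
   enough to prescribe the matrices on the span of the values of G and to extend
   them by the identity on a complement.
   All entries are Laurent series in a root of q, converging for |q| < 1; this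
   gives holomorphy and, through the cosets of Gamma_0(2), the expansions at all
   cusps. *)

(** The inversion formula is proved without integrals. [gsum] has period 1 in its argument, so it is
    recovered from [L] equidistant samples by a finite Fourier transform, and its quasi-period
    [1 / tau] makes each coefficient a theta term of [- 1 / tau] times a sample mean. As [L] grows
    the means lose their dependence on the base point, which gives proportionality with a factor
    common to all arguments, but not the value of that factor. A quotient of two theta functions
    involves the factor only at two points of constant ratio [N / 4]; comparing the coefficients of
    [z ^ 2] in the proportionality shows that its logarithmic derivative is [- 1 / (2 tau)], which
    makes the ratio of its values constant. The matrix closes on [2 r - 1] functions because the odd
    integers have [2 r - 1] classes up to sign besides the odd multiples of [N], and these
    contribute zero. Of the two values of [C_j / D_1] in [g_j^\vee], inversion sends the first to
    the [A_k / D_1] and the half-shifted one to the [B_k / D_2]; the sign and the power of [q] in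
    the definition of [g_j^\vee] give both the same matrix. *)

Section ComplexModulus.
Context {R : realType}.
Implicit Types (x y : R) (z w : CC R).

(** The norm of [CC R] takes values in [CC R] itself; a modulus in [R] makes the total order and
    real arithmetic available. *)
Definition cmod (z : CC R) : R := complex.Re `|z|.

Lemma cmodE z : `|z| = ofR (cmod z).
Proof. by rewrite /cmod normc_def. Qed.

Lemma ofR_inj : injective (@ofR R).
Proof. by move=> x y []. Qed.

Lemma ofRD x y : ofR (x + y) = ofR x + ofR y.
Proof. exact: (rmorphD (real_complex R)). Qed.
Lemma ofRM x y : ofR (x * y) = ofR x * ofR y.
Proof. exact: (rmorphM (real_complex R)). Qed.
Lemma ofRN x : ofR (- x) = - ofR x.
Proof. exact: (rmorphN (real_complex R)). Qed.
Lemma ofRB x y : ofR (x - y) = ofR x - ofR y.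
Proof. exact: (rmorphB (real_complex R)). Qed.
Lemma ofR1 : ofR (1 : R) = 1.
Proof. by []. Qed.
Lemma ofR0 : ofR (0 : R) = 0.
Proof. by []. Qed.
Lemma ofRV x : ofR x^-1 = (ofR x)^-1.
Proof. exact: (fmorphV (real_complex R)). Qed.
Lemma ofRX x n : ofR (x ^+ n) = ofR x ^+ n.
Proof. exact: (rmorphXn (real_complex R)). Qed.
Lemma ofR_nat n : ofR (n%:R : R) = n%:R.
Proof. exact: (rmorph_nat (real_complex R)). Qed.
Lemma ofR_int (n : int) : ofR (n%:~R : R) = n%:~R.
Proof. exact: (rmorph_int (real_complex R)). Qed.

Lemma ler_ofR x y : (ofR x <= ofR y) = (x <= y).
Proof. exact: lecR. Qed.
Lemma ltr_ofR x y : (ofR x < ofR y) = (x < y).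
Proof. exact: ltcR. Qed.

Lemma cmod_sqrt z : cmod z = Num.sqrt (complex.Re z ^+ 2 + complex.Im z ^+ 2).
Proof. by rewrite /cmod normc_def. Qed.

Lemma cmod_ge0 z : 0 <= cmod z.
Proof. by rewrite cmod_sqrt sqrtr_ge0. Qed.
Lemma cmod0 : cmod 0 = 0.
Proof. by rewrite /cmod normr0. Qed.
Lemma cmod1 : cmod 1 = 1.
Proof. by rewrite /cmod normr1. Qed.
Lemma cmod_eq0 z : (cmod z == 0) = (z == 0).
Proof.
rewrite -[RHS]normr_eq0 cmodE; apply/eqP/eqP => [->//|H].
exact: ofR_inj.
Qed.
Lemma cmod_gt0 z : (0 < cmod z) = (z != 0).
Proof. by rewrite lt0r cmod_eq0 cmod_ge0 andbT. Qed.
Lemma cmodM z w : cmod (z * w) = cmod z * cmod w.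
Proof. by apply: ofR_inj; rewrite ofRM -!cmodE normrM. Qed.
Lemma cmodD z w : cmod (z + w) <= cmod z + cmod w.
Proof. by rewrite -ler_ofR ofRD -!cmodE ler_normD. Qed.
Lemma cmodN z : cmod (- z) = cmod z.
Proof. by apply: ofR_inj; rewrite -!cmodE normrN. Qed.
Lemma cmodB z w : cmod (z - w) <= cmod z + cmod w.
Proof. by rewrite (le_trans (cmodD _ _))// cmodN. Qed.
Lemma cmodV z : cmod z^-1 = (cmod z)^-1.
Proof. by apply: ofR_inj; rewrite ofRV -!cmodE normfV. Qed.
Lemma cmodX z n : cmod (z ^+ n) = cmod z ^+ n.
Proof. by apply: ofR_inj; rewrite ofRX -!cmodE normrX. Qed.
Lemma cmod_ofR x : cmod (ofR x) = `|x|.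
Proof. by rewrite cmod_sqrt /= expr0n addr0 sqrtr_sqr. Qed.
Lemma cmod_nat n : cmod n%:R = n%:R.
Proof. by rewrite -ofR_nat cmod_ofR ger0_norm. Qed.
Lemma cmod_sum (I : Type) (s : seq I) (P : pred I) (F : I -> CC R) :
  cmod (\sum_(i <- s | P i) F i) <= \sum_(i <- s | P i) cmod (F i).
Proof.
elim/big_rec2: _ => [|i a b _ H]; first by rewrite cmod0.
by rewrite (le_trans (cmodD _ _))// lerD2l.
Qed.
Lemma Re_le_cmod z : `|complex.Re z| <= cmod z.
Proof. by rewrite cmod_sqrt -sqrtr_sqr ler_wsqrtr// lerDl sqr_ge0. Qed.
Lemma Im_le_cmod z : `|complex.Im z| <= cmod z.
Proof. by rewrite cmod_sqrt -sqrtr_sqr ler_wsqrtr// lerDr sqr_ge0. Qed.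
Lemma cmod_le_ReIm z : cmod z <= `|complex.Re z| + `|complex.Im z|.
Proof.
case: z => a b; have -> : (a +i* b)%C = ofR a + ofR b * (0 +i* 1)%C :> CC R.
  by apply/eqP; rewrite eq_complex /=; apply/andP; split; apply/eqP; ring.
apply: (le_trans (cmodD _ _)); rewrite cmodM !cmod_ofR.
have -> : cmod (0 +i* 1)%C = 1.
  by rewrite cmod_sqrt /= expr0n add0r expr1n sqrtr1.
by rewrite mulr1 /= !mul0r !mulr0 !subr0 !mulr1 !addr0 add0r.
Qed.

(** The radii in the topology of [CC R] are positive elements of [CC R]; such elements are real, so
    real radii suffice. *)
Lemma cvgC_cmod (T : Type) (F : set_system T) {FF : Filter F} (f : T -> CC R)
    (l : CC R) :
  f x @[x --> F] --> l <-> (forall e : R, 0 < e -> \forall x \near F, cmod (l - f x) < e).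
Proof.
split => [/cvgrPdist_lt H e e0|H].
  have := H (ofR e); rewrite -[0]ofR0 ltr_ofR => /(_ e0).
  by apply: filterS => x; rewrite cmodE ltr_ofR.
apply/cvgrPdist_lt => e e0.
have e_eq : e = ofR (complex.Re e).
  by move: e0; rewrite ltcE => /andP[/eqP /= + _]; case: e => a b /= ->.
move: e0; rewrite e_eq -[0]ofR0 ltr_ofR => e0.
by apply: filterS (H _ e0) => x; rewrite cmodE ltr_ofR.
Qed.

End ComplexModulus.

(** * Estimates for the complex exponential, and [ee z = exp (2 pi i z)] *)

Section ComplexExponential.
Context {R : realType}.
Implicit Types (x y : R) (z w : CC R).

Lemma sin_le_norm y : `|sin y| <= `|y|.
Proof.
wlog y0 : y / 0 < y.
  move=> H; case: (ltgtP y 0) => [y0|/H//|->]; last by rewrite sin0.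
  by rewrite -normrN -sinN -[leRHS]normrN; apply: H; rewrite oppr_gt0.
have [|c _] := @MVT R sin cos 0 y y0 (fun x _ => is_derive_sin x).
  by apply: continuous_subspaceT => x; exact: continuous_sin.
rewrite sin0 !subr0 => ->; rewrite normrM ler_piMl// ler_norml.
by rewrite cos_geN1 cos_le1.
Qed.

(** Mean value theorem and [|sin c| <= |c|]. Here and in the next estimates only the order of the
    remainder matters, so the constants are not sharp. *)
Lemma cos_sub1_le y : `|cos y - 1| <= y ^+ 2.
Proof.
wlog y0 : y / 0 < y.
  move=> H; case: (ltgtP y 0) => [y0|/H//|->].
    by rewrite -cosN -sqrrN; apply: H; rewrite oppr_gt0.
  by rewrite cos0 subrr normr0 sqr_ge0.
have [|c] := @MVT R cos (fun x => - sin x) 0 y y0 (fun x _ => is_derive_cos x).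
  by apply: continuous_subspaceT => x; exact: continuous_cos.
rewrite in_itv /= => /andP[c0 cy]; rewrite cos0 subr0 => ->.
rewrite normrM normrN expr2 [ `|y|]gtr0_norm// ler_wpM2r ?(ltW y0)//.
by rewrite (le_trans (sin_le_norm _))// gtr0_norm// ltW.
Qed.

Lemma sin_sub_le y : `|sin y - y| <= 2 * y ^+ 2.
Proof.
wlog y0 : y / 0 < y.
  move=> H; case: (ltgtP y 0) => [y0|/H//|->].
    have -> : sin y - y = - (sin (- y) - - y) by rewrite sinN; ring.
    by rewrite normrN -[y ^+ 2]sqrrN; apply: H; rewrite oppr_gt0.
  by rewrite sin0 subrr normr0 expr0n mulr0.
case: (leP y 1) => y1; last first.
  have := sin_le_norm y; rewrite (gtr0_norm y0) => H.
  by rewrite (le_trans (ler_normB _ _))// [ `|y|]gtr0_norm//; nra.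
have [|c] := @MVT R sin cos 0 y y0 (fun x _ => is_derive_sin x).
  by apply: continuous_subspaceT => x; exact: continuous_sin.
rewrite in_itv /= => /andP[c0 cy]; rewrite sin0 !subr0 => ->.
rewrite -[X in _ - X]mul1r -mulrBl normrM [ `|y|]gtr0_norm//.
have := cos_sub1_le c; have : `|cos c - 1| >= 0 by []; nra.
Qed.

Lemma expR_sub1_le x : `|expR x - 1| <= `|x| * expR `|x|.
Proof.
have H := expR_ge1Dx x; have HN := expR_ge1Dx (- x).
case: (leP 0 x) => x0.
  rewrite !ger0_norm//; last by rewrite subr_ge0; lra.
  have : expR x * (1 - x) <= expR x * expR (- x) by rewrite ler_pM2l ?expR_gt0.
  rewrite -expRD subrr expR0; lra.
have H1 : expR x <= 1 by rewrite expR_le1 ltW.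
rewrite (ltr0_norm x0) ler0_norm; last by lra.
have : 1 <= expR (- x) by rewrite -expR0 ler_expR; lra.
nra.
Qed.

Lemma expR_sub1x_le x : `|expR x - 1 - x| <= x ^+ 2 * expR `|x|.
Proof.
have H := expR_ge1Dx x; have HN := expR_ge1Dx (- x).
rewrite ger0_norm; last by lra.
case: (leP 0 x) => x0.
  have := expR_sub1_le x; rewrite !ger0_norm//; last by lra.
  nra.
rewrite ltr0_norm//.
have E : expR x * expR (- x) = 1 by rewrite -expRD subrr expR0.
have P := expR_gt0 x.
have P' : 1 <= expR (- x) by rewrite -expR0 ler_expR; lra.
have : expR x * (1 - x) <= 1 by rewrite -[leRHS]E ler_pM2l.
have := sqr_ge0 x; nra.
Qed.

Lemma cexpD z w : cexp (z + w) = cexp z * cexp w.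
Proof.
rewrite /cexp; case: z => a b; case: w => c d /=.
rewrite expRD cosD sinD; apply/eqP; rewrite eq_complex /=.
by apply/andP; split; apply/eqP; ring.
Qed.

Lemma cexp0 : cexp (0 : CC R) = 1.
Proof.
by apply/eqP; rewrite /cexp eq_complex /= expR0 cos0 sin0; apply/andP; split; apply/eqP; ring.
Qed.

Lemma cmod_cexp z : cmod (cexp z) = expR (complex.Re z).
Proof.
rewrite /cexp cmodM cmod_ofR ger0_norm ?expR_ge0// cmod_sqrt /=.
by rewrite cos2Dsin2 sqrtr1 mulr1.
Qed.

Lemma cexp_neq0 z : cexp z != 0.
Proof. by rewrite -cmod_gt0 cmod_cexp expR_gt0. Qed.

Lemma cexpN z : cexp (- z) = (cexp z)^-1.
Proof.
by apply: (mulfI (cexp_neq0 z)); rewrite -cexpD subrr cexp0 divff ?cexp_neq0.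
Qed.

Lemma cexpX z n : cexp z ^+ n = cexp (n%:R * z).
Proof.
elim: n => [|n IH]; first by rewrite mul0r cexp0.
by rewrite exprS IH -cexpD -natr1 mulrDl mul1r addrC.
Qed.

(** For [u = x + i y] the remainder splits into [exp x * (exp (i y) - 1 - i y)], [(exp x - 1) * i y]
    and [exp x - 1 - x]; these contribute 3, 1 and 1 to the constant 5. *)
Lemma cexp_sub1x_le u : cmod (cexp u - 1 - u) <= 5 * cmod u ^+ 2 * expR (cmod u : R).
Proof.
have Hx := Re_le_cmod u; have Hy := Im_le_cmod u; have P := cmod_ge0 u.
set c := cmod u in Hx Hy P *.
case: u @c Hx Hy P => x y; set c := cmod _ => /= Hx Hy P.
pose v : CC R := (cos y +i* sin y)%C.
have -> : cexp ((x +i* y)%C : CC R) - 1 - ((x +i* y)%C : CC R) =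
  ofR (expR x) * (v - 1 - (0 +i* y)%C) + ofR (expR x - 1) * (0 +i* y)%C + ofR (expR x - 1 - x).
  by apply/eqP; rewrite /cexp eq_complex /=; apply/andP; split; apply/eqP; ring.
have Hv : cmod (v - 1 - (0 +i* y)%C) <= 3 * y ^+ 2.
  apply: (le_trans (cmod_le_ReIm _)) => /=.
  have := sin_sub_le y; have := cos_sub1_le y.
  rewrite !subr0 => H1 H2; lra.
have Hiy : cmod ((0 +i* y)%C : CC R) = `|y|.
  by rewrite cmod_sqrt /= expr0n add0r sqrtr_sqr.
apply: (le_trans (cmodD _ _)); rewrite cmod_ofR.
have e1 : expR x <= expR c by rewrite ler_expR; move: Hx; rewrite ler_norml => /andP[].
have e2 : expR `|x| <= expR c by rewrite ler_expR.
have e3 := expR_gt0 x; have e4 := expR_gt0 c; have e5 := expR_gt0 `|x|.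
have x2 : x ^+ 2 <= c ^+ 2 by rewrite -real_normK ?num_real// lerXn2r ?nnegrE.
have y2 : y ^+ 2 <= c ^+ 2 by rewrite -[y ^+ 2]real_normK ?num_real// lerXn2r ?nnegrE.
have A3 : `|expR x - 1 - x| <= c ^+ 2 * expR c.
  by rewrite (le_trans (expR_sub1x_le _))// ler_pM ?sqr_ge0 ?expR_ge0.
have A2 : cmod (ofR (expR x - 1) * (0 +i* y)%C) <= c ^+ 2 * expR c.
  rewrite cmodM cmod_ofR Hiy expr2 -mulrA [c * expR c]mulrC mulrA.
  by rewrite ler_pM// (le_trans (expR_sub1_le _))// ler_pM ?expR_ge0.
have A1 : cmod (ofR (expR x) * (v - 1 - (0 +i* y)%C)) <= 3 * c ^+ 2 * expR c.
  rewrite cmodM cmod_ofR ger0_norm ?expR_ge0// mulrC ler_pM ?cmod_ge0//.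
  by rewrite (le_trans Hv)// ler_pM2l.
have := cmodD (ofR (expR x) * (v - 1 - (0 +i* y)%C)) (ofR (expR x - 1) * (0 +i* y)%C).
lra.
Qed.

Definition ee (z : CC R) : CC R := cexp (2 * ofR pi * (0 +i* 1)%C * z).

Lemma qpowE (x : rat) z : qpow x z = ee (ratr x * z).
Proof. by rewrite /qpow /ee; congr cexp; rewrite -!mulrA mulrA. Qed.

Lemma eeD z w : ee (z + w) = ee z * ee w.
Proof. by rewrite /ee mulrDr cexpD. Qed.
Lemma ee0 : ee 0 = 1.
Proof. by rewrite /ee mulr0 cexp0. Qed.
Lemma eeN z : ee (- z) = (ee z)^-1.
Proof. by rewrite /ee mulrN cexpN. Qed.
Lemma eeB z w : ee (z - w) = ee z / ee w.
Proof. by rewrite eeD eeN. Qed.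
Lemma ee_neq0 z : ee z != 0.
Proof. exact: cexp_neq0. Qed.
Lemma eeX z n : ee z ^+ n = ee (n%:R * z).
Proof. by rewrite /ee cexpX; congr cexp; ring. Qed.

Lemma ee_half : ee (1 / 2) = -1.
Proof.
rewrite /ee; have -> : 2 * ofR pi * (0 +i* 1)%C * (1 / 2) = (0 +i* pi)%C :> CC R.
  have -> : 2 * ofR pi * (0 +i* 1)%C * (1 / 2) = ofR pi * (0 +i* 1)%C :> CC R by field.
  by apply/eqP; rewrite eq_complex /=; apply/andP; split; apply/eqP; ring.
rewrite /cexp /= cospi sinpi expR0.
by apply/eqP; rewrite eq_complex /=; apply/andP; split; apply/eqP; ring.
Qed.

Lemma ee_nat n : ee n%:R = 1.
Proof.
have -> : (n%:R : CC R) = (n * 2)%:R * (1 / 2) by rewrite natrM; field.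
by rewrite -eeX ee_half mulnC exprM sqrrN expr1n expr1n.
Qed.

Lemma ee_int (n : int) : ee n%:~R = 1.
Proof.
case: n => n; first exact: ee_nat.
by rewrite NegzE mulrNz eeN ee_nat invr1.
Qed.

Lemma cmod_ee z : cmod (ee z) = expR (- (2 * pi * complex.Im z)).
Proof.
rewrite /ee cmod_cexp; congr expR; case: z => a b /=; ring.
Qed.

Lemma cmod_ee_ofR x : cmod (ee (ofR x)) = 1.
Proof. by rewrite cmod_ee /= mulr0 oppr0 expR0. Qed.

Lemma ee_ofR (x : R) : ee (ofR x) = (cos (2 * pi * x) +i* sin (2 * pi * x))%C.
Proof.
rewrite /ee; have -> : 2 * ofR pi * (0 +i* 1)%C * ofR x = (0 +i* (2 * pi * x))%C :> CC R.
  rewrite -[2]ofR_nat -ofRM; apply/eqP; rewrite eq_complex /=.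
  by apply/andP; split; apply/eqP; ring.
by rewrite /cexp /= expR0 mul1r.
Qed.

Lemma eeE z : ee z = cexp (2 * ofR pi * (0 +i* 1)%C * z).
Proof. by []. Qed.

End ComplexExponential.

Opaque cexp ee.

(** * Convergence of complex series and dominated convergence *)

Section Series.
Context {R : realType}.
Implicit Types (u : nat -> CC R) (v : nat -> R) (f : int -> CC R).

Lemma cvg_bigsum (K : numFieldType) (V : normedModType K) (T : Type)
    (F : set_system T) {FF : Filter F} (I : Type) (s : seq I) (h : I -> T -> V)
    (l : I -> V) :
  (forall i, h i x @[x --> F] --> l i) ->
  (\sum_(i <- s) h i x) @[x --> F] --> \sum_(i <- s) l i.
Proof.
move=> H; elim: s => [|i s IH].
  by under eq_fun do rewrite big_nil; rewrite big_nil; exact: cvg_cst.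
by under eq_fun do rewrite big_cons; rewrite big_cons; apply: cvgD.
Qed.

Lemma cvgCD (T : Type) (F : set_system T) {FF : Filter F} (f g : T -> CC R) (a b : CC R) :
  f x @[x --> F] --> a -> g x @[x --> F] --> b -> (f x + g x) @[x --> F] --> a + b.
Proof. by move=> A B; exact: (@cvgD (CC R) (CC R) T F FF f g a b A B). Qed.
Lemma cvgCB (T : Type) (F : set_system T) {FF : Filter F} (f g : T -> CC R) (a b : CC R) :
  f x @[x --> F] --> a -> g x @[x --> F] --> b -> (f x - g x) @[x --> F] --> a - b.
Proof. by move=> A B; exact: (@cvgB (CC R) (CC R) T F FF f g a b A B). Qed.
Lemma cvgCM (T : Type) (F : set_system T) {FF : Filter F} (f g : T -> CC R) (a b : CC R) :
  f x @[x --> F] --> a -> g x @[x --> F] --> b -> (f x * g x) @[x --> F] --> a * b.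
Proof. by move=> A B; exact: (@cvgM (CC R) T F FF f g a b A B). Qed.
Lemma cvgC_cst (T : Type) (F : set_system T) {FF : Filter F} (a : CC R) :
  (fun=> a) x @[x --> F] --> a.
Proof. exact: (@cvg_cst (CC R)). Qed.

Lemma cvgC_unique (T : Type) (F : set_system T) {FF : ProperFilter F} (f : T -> CC R) (a b : CC R) :
  f x @[x --> F] --> a -> f x @[x --> F] --> b -> a = b.
Proof. by move=> A B; apply: (cvg_unique _ A B); exact: norm_hausdorff. Qed.

Lemma cvgCV (T : Type) (F : set_system T) {FF : Filter F} (f : T -> CC R) (a : CC R) :
  f x @[x --> F] --> a -> a != 0 -> (f x)^-1 @[x --> F] --> a^-1.
Proof. by move=> A a0; exact: (@cvgV (CC R) T F FF f a a0 A). Qed.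

Lemma cvgC_squeeze (T : Type) (F : set_system T) {FF : Filter F} (h : T -> CC R)
    (l : CC R) (b : T -> R) :
  (forall x, cmod (l - h x) <= b x) -> b x @[x --> F] --> 0 -> h x @[x --> F] --> l.
Proof.
move=> H /cvgrPdist_lt B; apply/cvgC_cmod => e e0.
apply: filterS (B e e0) => x; rewrite sub0r normrN => Hx.
by rewrite (le_lt_trans (H x))// (le_lt_trans (ler_norm _)).
Qed.

Lemma cvgC_ReIm (T : Type) (F : set_system T) {FF : Filter F} (h : T -> CC R) (a b : R) :
  complex.Re (h x) @[x --> F] --> a -> complex.Im (h x) @[x --> F] --> b ->
  h x @[x --> F] --> ((a +i* b)%C : CC R).
Proof.
move=> /cvgrPdist_lt A /cvgrPdist_lt B; apply/cvgC_cmod => e e0.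
have e2 : 0 < e / 2 by rewrite divr_gt0.
near=> x.
apply: (le_lt_trans (cmod_le_ReIm _)).
have -> : e = e / 2 + e / 2 by field.
apply: ltrD.
- suff -> : complex.Re (((a +i* b)%C : CC R) - h x) = a - complex.Re (h x) by near: x; exact: A.
  by case: (h x).
- suff -> : complex.Im (((a +i* b)%C : CC R) - h x) = b - complex.Im (h x) by near: x; exact: B.
  by case: (h x).
Unshelve. all: by end_near. Qed.

Lemma Re_sum (I : Type) (s : seq I) (P : pred I) (F : I -> CC R) :
  complex.Re (\sum_(i <- s | P i) F i) = \sum_(i <- s | P i) complex.Re (F i).
Proof. by elim/big_rec2: _ => // i a b _ <-; case: (F i) b => [? ?] [? ?]. Qed.
Lemma Im_sum (I : Type) (s : seq I) (P : pred I) (F : I -> CC R) :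
  complex.Im (\sum_(i <- s | P i) F i) = \sum_(i <- s | P i) complex.Im (F i).
Proof. by elim/big_rec2: _ => // i a b _ <-; case: (F i) b => [? ?] [? ?]. Qed.

Lemma series_cvgC u v : (forall n, cmod (u n) <= v n) -> cvgn (series v) ->
  cvgn (series u).
Proof.
move=> H cv.
have rcv (w : nat -> R) : (forall n, `|w n| <= cmod (u n)) -> cvgn (series w).
  move=> Hw; apply: normed_cvg; apply: series_le_cvg cv => // n.
  - by rewrite /=.
  - exact: le_trans (cmod_ge0 _) (H n).
  - exact: le_trans (Hw n) (H n).
have /cvg_ex[a Ha] := rcv (fun n => complex.Re (u n)) (fun n => Re_le_cmod (u n)).
have /cvg_ex[b Hb] := rcv (fun n => complex.Im (u n)) (fun n => Im_le_cmod (u n)).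
apply/cvg_ex; exists (a +i* b)%C; apply: cvgC_ReIm.
- by under eq_fun do rewrite /series /= Re_sum.
- by under eq_fun do rewrite /series /= Im_sum.
Qed.

Lemma cvgC_cmod_le (h : nat -> CC R) (l : CC R) (b : R) :
  h @ \oo --> l -> (forall n, cmod (h n) <= b) -> cmod l <= b.
Proof.
move=> /cvgC_cmod H Hb; apply/ler_addgt0Pr => e e0.
have [n _ Hn] := H e e0.
have {}Hn := Hn n (leqnn n); rewrite -[l](subrK (h n)) addrC.
by rewrite (le_trans (cmodD _ _))// lerD// ltW.
Qed.

Lemma cvgC_bounded u (l : CC R) : u @ \oo --> l ->
  exists2 B : R, 0 <= B & forall n, cmod (u n) <= B.
Proof.
move=> /cvgC_cmod/(_ _ ltr01)[N _ HN].
exists (cmod l + 1 + \sum_(0 <= n < N) cmod (u n)).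
  by rewrite addr_ge0 ?sumr_ge0 ?addr_ge0 ?cmod_ge0// => n _; exact: cmod_ge0.
move=> n; have [nN|Nn] := ltnP n N.
  rewrite (bigD1_seq n) ?mem_index_iota ?iota_uniq//= addrCA lerDl.
  by rewrite addr_ge0 ?sumr_ge0 ?addr_ge0 ?cmod_ge0// => i _; exact: cmod_ge0.
have := HN n Nn => /ltW h; rewrite -[u n](subKr l).
rewrite (le_trans (cmodB _ _))// -addrA lerD2l (le_trans h)// lerDl.
by rewrite sumr_ge0// => i _; exact: cmod_ge0.
Qed.

(** Dominated convergence for sums whose length varies with [m]: beyond some [K] the tail of the
    majorant is small uniformly in [m], and the finitely many terms before [K] tend to zero one by
    one. *)
Lemma tannery (u : nat -> nat -> R) v (N : nat -> nat) :
  (forall m n, (n < N m)%N -> 0 <= u m n <= v n) -> (forall n, 0 <= v n) ->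
  cvgn (series v) ->
  (forall n, u m n @[m --> \oo] --> 0) ->
  (\sum_(0 <= n < N m) u m n) @[m --> \oo] --> 0.
Proof.
move=> Hu v0 cv Hc; apply/cvgrPdist_lt => e e0.
have e2 : 0 < e / 2 by rewrite divr_gt0.
have /cvgrPdist_lt/(_ _ e2)[K _ HK] := cv.
have {}HK m : \sum_(K <= n < m) v n <= e / 2.
  case: (leqP K m) => Km; last by rewrite big_geq ?(ltnW Km)// ltW.
  have := HK K (leqnn K); rewrite /= => H.
  have le_lim : series v m <= limn (series v).
    by apply: nondecreasing_cvgn_le => //; apply: nondecreasing_series => ? _ _.
  have : series v m = series v K + \sum_(K <= n < m) v n.
    by rewrite /series /= -big_cat_nat.
  have := ler_norm (limn (series v) - series v K); lra.
have : (\sum_(0 <= n < K) `|u m n|) @[m --> \oo] --> 0.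
  rewrite [X in _ --> X](_ : 0 = \sum_(0 <= n < K) (0:R)); last by rewrite big1.
  apply: (cvg_bigsum (V := R)) => n; rewrite -[X in _ --> X](@normr0 _ R).
  by apply: (cvg_norm (V := R)); exact: Hc.
move=> /cvgrPdist_lt/(_ _ e2) H.
near=> m.
rewrite sub0r normrN ger0_norm; last first.
  by rewrite big_nat sumr_ge0// => i /Hu /andP[].
have : \sum_(0 <= n < K) `|u m n| < e / 2.
  rewrite -[ltLHS]ger0_norm; last by rewrite sumr_ge0.
  by rewrite -normrN -sub0r; near: m.
rewrite [X in _ -> _ < X](_ : e = e / 2 + e / 2); last by field.
case: (leqP (N m) K) => NK H1.
  apply: (@le_lt_trans _ _ (\sum_(0 <= n < K) `|u m n|)); last by lra.
  rewrite [leRHS](@big_cat_nat _ _ _ (N m))//=.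
  apply: (@le_trans _ _ (\sum_(0 <= n < N m) `|u m n|)).
    by apply: ler_sum => i _; exact: ler_norm.
  by rewrite lerDl sumr_ge0.
rewrite (@big_cat_nat _ _ _ K 0 (N m))//=; last exact: ltnW.
apply: ltr_leD.
  by apply: le_lt_trans H1; apply: ler_sum => i _; exact: ler_norm.
apply: le_trans (HK (N m)); rewrite !big_nat; apply: ler_sum => i /andP[_ /Hu].
by case/andP.
Unshelve. all: by end_near. Qed.

End Series.

(** * Sums over all integers *)

Section BilateralSeries.
Context {R : realType}.
Implicit Types (f g : int -> CC R) (C : R).

(** Pairing [n] with [- n - 1] makes the window [- K <= n < K], of even length [2 K]: it splits
    exactly into residue classes ([Zsum_split]) and is a complete residue system modulo [2 K]
    ([dft_inversion]). *)
Definition Zsum f (K : nat) : CC R :=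
  \sum_(0 <= n < K) (f n%:Z + f (- n.+1%:Z)).
Definition zsum f : CC R := limn (Zsum f).
(** Theta series decay faster than any geometric sequence, so one fixed base serves for all of them;
    the explicit [C] allows bounds that are uniform in parameters. *)
Definition zbound C f := forall n : int, cmod (f n) <= C / 2 ^+ absz n.
Definition zgeo f := exists C, zbound C f.

Lemma Zsum0 f : Zsum f 0 = 0.
Proof. by rewrite /Zsum big_nil. Qed.
Lemma ZsumS f K : Zsum f K.+1 = Zsum f K + (f K%:Z + f (- K.+1%:Z)).
Proof. by rewrite /Zsum big_nat_recr. Qed.

Lemma zbound_ge0 C f : zbound C f -> 0 <= C.
Proof. by move/(_ 0); rewrite expr0 divr1; apply: le_trans; exact: cmod_ge0. Qed.

Lemma cvg_half_series C : cvgn (series (fun n => 2 * C / 2 ^+ n)).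
Proof.
have -> : (fun n => 2 * C / 2 ^+ n) = geometric (2 * C) (2^-1 : R).
  by apply/funext => n; rewrite /geometric /= exprVn.
apply: is_cvg_geometric_series; rewrite ger0_norm ?invr_ge0//.
by rewrite invf_lt1// ltr1n.
Qed.

Lemma zbound_pair C f n : zbound C f ->
  cmod (f n%:Z + f (- n.+1%:Z)) <= 2 * C / 2 ^+ n.
Proof.
move=> H; have C0 := zbound_ge0 H; apply: (le_trans (cmodD _ _)).
rewrite -mulrA mulr_natl mulr2n lerD ?H//.
apply: (le_trans (H _)); rewrite abszN ler_wpM2l//.
by rewrite lef_pV2 ?posrE ?exprn_gt0// ler_weXn2l// ler1n.
Qed.

Lemma cvg_Zsum f : zgeo f -> Zsum f @ \oo --> zsum f.
Proof.
move=> [C H]; apply: (@series_cvgC _ _ (fun n => 2 * C / 2 ^+ n)).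
  by move=> n; exact: zbound_pair.
exact: cvg_half_series.
Qed.

Lemma zsum_unique f s : Zsum f @ \oo --> s -> zsum f = s.
Proof. by move=> H; apply: cvg_lim => //; exact: norm_hausdorff. Qed.

Lemma zsum_le C f : zbound C f -> cmod (zsum f) <= 4 * C.
Proof.
move=> H; have C0 := zbound_ge0 H.
apply: (cvgC_cmod_le (cvg_Zsum (ex_intro _ C H))) => K.
apply: (le_trans (cmod_sum _ _ _)).
apply: (@le_trans _ _ (\sum_(0 <= n < K) (2 * C / 2 ^+ n))).
  by apply: ler_sum => n _; exact: zbound_pair.
have -> : \sum_(0 <= n < K) (2 * C / 2 ^+ n) = 4 * C - 4 * C / 2 ^+ K.
  elim: K => [|K IH]; first by rewrite big_nil expr0; field.
  by rewrite big_nat_recr//= IH exprS; field; rewrite expf_neq0.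
by rewrite gerBl divr_ge0 ?exprn_ge0// mulr_ge0.
Qed.

Lemma zboundD C D f g : zbound C f -> zbound D g -> zbound (C + D) (fun n => f n + g n).
Proof. by move=> H H' n; rewrite (le_trans (cmodD _ _))// mulrDl lerD. Qed.
Lemma zgeoD f g : zgeo f -> zgeo g -> zgeo (fun n => f n + g n).
Proof. by move=> [C H] [D H']; exists (C + D); exact: zboundD. Qed.
Lemma zboundM C f (c : CC R) : zbound C f -> zbound (cmod c * C) (fun n => c * f n).
Proof. by move=> H n; rewrite cmodM -mulrA ler_wpM2l// cmod_ge0. Qed.
Lemma zgeoM f (c : CC R) : zgeo f -> zgeo (fun n => c * f n).
Proof. by move=> [C H]; exists (cmod c * C); exact: zboundM. Qed.

Lemma zsumD f g : zgeo f -> zgeo g -> zsum (fun n => f n + g n) = zsum f + zsum g.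
Proof.
move=> /cvg_Zsum Hf /cvg_Zsum Hg; apply: zsum_unique.
have -> : Zsum (fun n => f n + g n) = (fun K => Zsum f K + Zsum g K).
  apply/funext => K; rewrite /Zsum -big_split; apply: eq_bigr => n _ /=; ring.
exact: (cvgCD Hf Hg).
Qed.

Lemma zsumM f (c : CC R) : zgeo f -> zsum (fun n => c * f n) = c * zsum f.
Proof.
move=> /cvg_Zsum Hf; apply: zsum_unique.
have -> : Zsum (fun n => c * f n) = (fun K => c * Zsum f K).
  by apply/funext => K; rewrite /Zsum mulr_sumr; apply: eq_bigr => n _ /=; ring.
exact: (cvgCM (@cvgC_cst R nat \oo _ c) Hf).
Qed.

Lemma zgeoB f g : zgeo f -> zgeo g -> zgeo (fun n => f n - g n).
Proof.
move=> Hf Hg; have := zgeoD Hf (zgeoM (-1) Hg).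
by congr zgeo; apply/funext => n; rewrite mulN1r.
Qed.
Lemma zsumB f g : zgeo f -> zgeo g -> zsum (fun n => f n - g n) = zsum f - zsum g.
Proof.
move=> Hf Hg; rewrite -[- zsum g]mulN1r -zsumM// -zsumD//; last exact: zgeoM.
by congr zsum; apply/funext => n; rewrite mulN1r.
Qed.

Lemma zgeo_cvg0 f (s : bool) : zgeo f -> f ((-1) ^+ s * K%:Z) @[K --> \oo] --> (0 : CC R).
Proof.
move=> [C H]; apply: (@cvgC_squeeze _ _ _ _ _ _ (fun K => C / 2 ^+ K)).
  by move=> K; rewrite sub0r cmodN (le_trans (H _))// abszMsign.
have -> : (fun n => C / 2 ^+ n) = geometric C (2^-1 : R).
  by apply/funext => n; rewrite /geometric /= exprVn.
apply: cvg_geometric; rewrite ger0_norm ?invr_ge0//.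
by rewrite invf_lt1// ltr1n.
Qed.

Lemma zgeoS f : zgeo f -> zgeo (fun n => f (n + 1)).
Proof.
move=> [C H]; have C0 := zbound_ge0 H; exists (2 * C) => n; apply: (le_trans (H _)).
rewrite -mulrA mulrCA ler_wpM2l// -ler_pdivrMl// -invfM -exprS.
by rewrite lef_pV2 ?posrE ?exprn_gt0// ler_weXn2l// ?ler1n//; lia.
Qed.

Lemma zsumS f : zgeo f -> zsum (fun n => f (n + 1)) = zsum f.
Proof.
move=> Hf; apply: zsum_unique.
(* Shifting the window by one changes the partial sum by two boundary terms, which vanish in the
   limit. *)
have -> : Zsum (fun n => f (n + 1)) = (fun K => Zsum f K + (f ((-1) ^+ false * K%:Z) - f ((-1) ^+ true * K%:Z))).
  apply/funext; elim => [|K IH].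
    by rewrite !Zsum0 mulr0 mulr0 subrr addr0.
  rewrite !ZsumS IH.
  have -> : (K%:Z + 1 = K.+1)%R by lia.
  have -> : (- K.+1%:Z + 1 = - K%:Z)%R by lia.
  by rewrite !expr0 !expr1 !mul1r !mulN1r; ring.
rewrite -[X in _ --> X]addr0 -[X in _ --> _ + X](subr0 0).
by apply: cvgCD; [exact: cvg_Zsum | apply: cvgCB; exact: zgeo_cvg0].
Qed.

Lemma zgeoN f : zgeo f -> zgeo (fun n => f (- n)).
Proof. by move=> [C H]; exists C => n; rewrite (le_trans (H _))// abszN. Qed.

Lemma zsumN f : zgeo f -> zsum (fun n => f (- n)) = zsum f.
Proof.
move=> Hf; apply: zsum_unique.
have -> : Zsum (fun n => f (- n)) = (fun K => Zsum f K + (f ((-1) ^+ false * K%:Z) - f ((-1) ^+ true * K%:Z))).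
  apply/funext; elim => [|K IH].
    by rewrite !Zsum0 mulr0 mulr0 subrr addr0.
  by rewrite !ZsumS IH !expr0 !expr1 !mul1r !mulN1r opprK; ring.
rewrite -[X in _ --> X]addr0 -[X in _ --> _ + X](subr0 0).
by apply: cvgCD; [exact: cvg_Zsum | apply: cvgCB; exact: zgeo_cvg0].
Qed.

Lemma Zsum_add f m P : Zsum f (m + P) =
  Zsum f m + \sum_(i < P) (f (m + i)%:Z + f (- (m + i).+1%:Z)).
Proof.
rewrite /Zsum (@big_cat_nat _ _ _ m)//= ?leq_addr//; congr (_ + _).
rewrite -{1}[m]add0n big_addn addKn big_mkord.
by apply: eq_bigr => i _; rewrite addnC.
Qed.

Lemma Zsum_split f P K : Zsum f (K * P) =
  \sum_(i < P) Zsum (fun n => f (n * P%:Z + i%:Z)) K.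
Proof.
elim: K => [|K IH].
  by rewrite mul0n Zsum0 big1// => i _; rewrite Zsum0.
rewrite mulSn addnC Zsum_add IH.
under [in RHS]eq_bigr do rewrite ZsumS.
rewrite [RHS]big_split/=; congr (_ + _); rewrite !big_split/=; congr (_ + _).
(* [- (K P + i + 1) = - (K + 1) P + (P - 1 - i)]: the negative terms run through the residue classes
   in reverse order. *)
rewrite (reindex_inj rev_ord_inj) /=; apply: eq_bigr => i _; congr f.
have := ltn_ord i; nia.
Qed.

Lemma zgeo_split f P i : (0 < P)%N -> zgeo f -> zgeo (fun n => f (n * P%:Z + i%:Z)).
Proof.
move=> P0 [C H]; have C0 := zbound_ge0 H; exists (2 ^+ i * C) => n.
apply: (le_trans (H _)).
rewrite -mulrA mulrCA ler_wpM2l// ler_pdivlMr ?exprn_gt0// mulrC ler_pdivrMr ?exprn_gt0//.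
rewrite -exprD ler_weXn2l// ?ler1n//; nia.
Qed.

Lemma zsum_split f P : (0 < P)%N -> zgeo f ->
  zsum f = \sum_(i < P) zsum (fun n => f (n * P%:Z + i%:Z)).
Proof.
move=> P0 Hf.
have H1 : Zsum f (K * P) @[K --> \oo] --> zsum f.
  apply: (@cvg_comp _ _ _ (fun K => (K * P)%N) (Zsum f) _ _ _ _ (cvg_Zsum Hf)).
  move=> A [N _ HN]; exists N => // K /= NK; apply: HN => /=.
  by rewrite (leq_trans NK)// leq_pmulr.
have H2 : Zsum f (K * P) @[K --> \oo] --> \sum_(i < P) zsum (fun n => f (n * P%:Z + i%:Z)).
  under eq_fun do rewrite Zsum_split.
  by apply: cvg_bigsum => i; apply: cvg_Zsum; exact: zgeo_split.
by apply: (cvg_unique _ H1 H2); exact: norm_hausdorff.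
Qed.

End BilateralSeries.

(** * Gaussian sums as functions of a complex argument *)

Section GaussianSeries.
Context {R : realType}.
Implicit Types (tau w z d : CC R) (n k : int).

Lemma expR_nat_ge2 (n : nat) : 2 ^+ n <= expR (n%:R : R).
Proof.
rewrite -[n%:R]mulr1 mulrC expRM_natr lerXn2r// ?nnegrE ?expR_ge0//.
by have := expR_ge1Dx (1 : R); lra.
Qed.

Lemma gauss_geo (s c : R) : 0 < s -> exists C, forall n,
  expR (- s * n%:~R ^+ 2 + c * `|n%:~R|) <= C / 2 ^+ absz n.
Proof.
(* [(c + 1) ^ 2 / (4 s)] is the maximum of [- s m ^ 2 + (c + 1) m]; the additional [m] pays for
   [2 ^ m <= exp m]. *)
move=> s0; exists (expR ((c + 1) ^+ 2 / (4 * s))) => n.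
rewrite ler_pdivlMr ?exprn_gt0//.
have -> : n%:~R ^+ 2 = `|n%:~R| ^+ 2 :> R by rewrite real_normK ?num_real.
have -> : `|n%:~R| = (absz n)%:R :> R by rewrite -intr_norm -abszE.
set m := (absz n)%:R.
apply: (@le_trans _ _ (expR (- s * m ^+ 2 + c * m) * expR m)).
  by rewrite ler_wpM2l ?expR_ge0// expR_nat_ge2.
rewrite -expRD ler_expR ler_pdivlMr; last by rewrite mulr_gt0.
have := sqr_ge0 (2 * s * m - (c + 1)); nra.
Qed.

(** The Gaussian [exp (pi i tau (n + w) ^ 2)]; its sum over [n] is a theta function normalized to
    have period 1 in [w]. The function [dgw] is its derivative in [w]. *)
Definition gw tau w n : CC R := ee (tau / 2 * (n%:~R + w) ^+ 2).
Definition dgw tau w n : CC R := 2 * ofR pi * (0 +i* 1)%C * tau * (n%:~R + w) * gw tau w n.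

Lemma cmod_intr n : cmod (n%:~R : CC R) = `|n%:~R|.
Proof. by rewrite -ofR_int cmod_ofR. Qed.

Lemma cmod_i : cmod ((0 +i* 1)%C : CC R) = 1.
Proof. by rewrite cmod_sqrt /= expr0n add0r expr1n sqrtr1. Qed.

Lemma ImD z w : complex.Im (z + w) = complex.Im z + complex.Im w.
Proof. by case: z w => [? ?] [? ?]. Qed.

Lemma Im_ofRM (x : R) z : complex.Im (ofR x * z) = x * complex.Im z.
Proof. by case: z => ? ? /=; rewrite mul0r addr0. Qed.

Lemma ImN z : complex.Im (- z) = - complex.Im z.
Proof. by case: z. Qed.

(** The bound is uniform for [w] in a disc, and the room [exp (c |n|)] later absorbs polynomial
    factors and the exponentials of remainder terms. *)
Lemma gw_bound tau (Y c : R) : 0 < imag tau -> exists C, forall w n, cmod w <= Y ->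
  cmod (gw tau w n) * expR (c * `|n%:~R|) <= C / 2 ^+ absz n.
Proof.
move=> t0; have s0 : 0 < pi * imag tau by rewrite mulr_gt0 ?pi_gt0.
have [C HC] := gauss_geo (2 * pi * cmod tau * Y + c) s0.
exists (expR (pi * cmod tau * Y ^+ 2) * C) => w n wY.
have Y0 : 0 <= Y by apply: le_trans wY; exact: cmod_ge0.
rewrite -[leRHS]mulrA; apply: le_trans (ler_wpM2l (expR_ge0 _) (HC n)).
rewrite cmod_ee -!expRD ler_expR.
have -> : tau / 2 * (n%:~R + w) ^+ 2 = ofR (n%:~R ^+ 2 / 2) * tau + ofR n%:~R * (tau * w) + tau * w ^+ 2 / 2.
  by rewrite ofRM ofRX ofRV ofR_nat ofR_int; field.
rewrite !ImD !Im_ofRM -/(imag tau).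
have A := Im_le_cmod (tau * w); have B := Im_le_cmod (tau * w ^+ 2 / 2).
rewrite cmodM in A; rewrite 2!cmodM cmodV cmodX cmod_nat in B.
have p0 := pi_gt0 R.
have A2 : `|complex.Im (tau * w)| <= cmod tau * Y.
  by rewrite (le_trans A)// ler_wpM2l ?cmod_ge0.
have B2 : `|complex.Im (tau * w ^+ 2 / 2)| <= cmod tau * Y ^+ 2 / 2.
  rewrite (le_trans B)// ler_wpM2r// ler_wpM2l ?cmod_ge0// lerXn2r// nnegrE ?cmod_ge0//.
have A3 : - (n%:~R * complex.Im (tau * w)) <= cmod tau * Y * `|n%:~R|.
  rewrite -mulNr (le_trans (ler_norm _))// normrM normrN mulrC.
  by rewrite ler_wpM2r.
have B3 : - complex.Im (tau * w ^+ 2 / 2) <= cmod tau * Y ^+ 2 / 2.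
  by rewrite (le_trans (ler_norm _))// normrN.
have := ler_wpM2l (ltW p0) A3; have := ler_wpM2l (ltW p0) B3; lra.
Qed.

Lemma gw_zgeo tau w : 0 < imag tau -> zgeo (gw tau w).
Proof.
move=> t0; have [C HC] := gw_bound (cmod w) 0 t0; exists C => n.
by have := HC w n (lexx _); rewrite mul0r expR0 mulr1.
Qed.

Lemma ler_sqr_expR (x : R) : 0 <= x -> x ^+ 2 <= expR (2 * x).
Proof.
move=> x0; have H := expR_ge1Dx x.
rewrite mulrC expRM_natr lerXn2r ?nnegrE ?expR_ge0//; lra.
Qed.

Lemma gw_taylor tau (Y : R) : 0 < imag tau -> exists C, forall w d n,
  cmod w <= Y -> cmod d <= 1 ->
  cmod (gw tau (w + d) n - gw tau w n - d * dgw tau w n) <= C * cmod d ^+ 2 / 2 ^+ absz n.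
Proof.
move=> t0; pose B := 2 * pi * cmod tau.
have B0 : 0 <= B by rewrite !mulr_ge0 ?pi_ge0 ?cmod_ge0.
have [C HC] := gw_bound Y (3 * B) t0.
exists (6 * expR (3 * B * (Y + 1)) * C) => w d n wY d1.
have Y0 : 0 <= Y by apply: le_trans wY; exact: cmod_ge0.
(* [tau (n + w + d / 2) d] is the increment of [tau / 2 (n + w) ^ 2]. Its part [tau d ^ 2 / 2] does
   not belong to the linear term and is compensated in the next identity. *)
pose v : CC R := 2 * ofR pi * (0 +i* 1)%C * (tau * ((n%:~R + w + d / 2) * d)).
have -> : gw tau (w + d) n = gw tau w n * cexp v.
  by rewrite /gw /v -eeE -eeD; congr ee; field.
have -> : gw tau w n * cexp v - gw tau w n - d * dgw tau w n =
    gw tau w n * (cexp v - 1 - v + 2 * ofR pi * (0 +i* 1)%C * (tau * d ^+ 2 / 2)).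
  by rewrite /dgw /v; field.
pose A := B * (`|n%:~R| + Y + 1).
have A0 : 0 <= A by rewrite mulr_ge0// !addr_ge0.
have P0 : cmod (2 * ofR pi * (0 +i* 1)%C : CC R) = 2 * pi.
  by rewrite !cmodM cmod_nat cmod_ofR cmod_i mulr1 ger0_norm ?pi_ge0.
have hv : cmod v <= A * cmod d.
  rewrite /v cmodM P0 /A /B -!mulrA ler_wpM2l// ler_wpM2l ?pi_ge0//.
  rewrite !cmodM ler_wpM2l ?cmod_ge0// ler_wpM2r ?cmod_ge0//.
  apply: (le_trans (cmodD _ _)); rewrite cmodM cmodV cmod_nat.
  apply: lerD; last by lra.
  by apply: (le_trans (cmodD _ _)); rewrite cmod_intr lerD2l.
have hvA : cmod v <= A by rewrite (le_trans hv)// ler_piMr.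
have e1 : expR (2 * A) * expR A = expR (3 * B * (Y + 1)) * expR (3 * B * `|n%:~R|).
  by rewrite -!expRD; congr expR; rewrite /A; ring.
have H1 : cmod (cexp v - 1 - v) <= 5 * (cmod d ^+ 2 * (expR (2 * A) * expR A)).
  apply: (le_trans (cexp_sub1x_le _)); rewrite -mulrA ler_pM2l// [leRHS]mulrA.
  apply: ler_pM; rewrite ?sqr_ge0 ?expR_ge0 ?ler_expR//.
  apply: (@le_trans _ _ ((A * cmod d) ^+ 2)).
    by rewrite lerXn2r ?nnegrE ?cmod_ge0// mulr_ge0 ?cmod_ge0.
  by rewrite exprMn mulrC ler_wpM2l ?sqr_ge0// ler_sqr_expR.
have H2 : cmod (2 * ofR pi * (0 +i* 1)%C * (tau * d ^+ 2 / 2) : CC R) <= cmod d ^+ 2 * (expR (2 * A) * expR A).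
  rewrite cmodM P0 2!cmodM cmodX cmodV cmod_nat.
  have BA : B <= A by rewrite /A ler_peMr// lerDr addr_ge0.
  have : A <= expR (2 * A) * expR A.
    rewrite -expRD; have := expR_ge1Dx (2 * A + A); lra.
  have := sqr_ge0 (cmod d); rewrite /B in BA B0 *; nra.
rewrite cmodM; apply: (@le_trans _ _ (cmod (gw tau w n) * (6 * (cmod d ^+ 2 * (expR (2 * A) * expR A))))).
  rewrite ler_wpM2l ?cmod_ge0// (le_trans (cmodD _ _))//; lra.
rewrite e1; have := HC w n wY => H.
have := ler_wpM2l (mulr_ge0 (expR_ge0 (3 * B * (Y + 1))) (sqr_ge0 (cmod d))) H.
set X := expR _; set X' := expR _; set I := (2 ^+ _)^-1; lra.
Qed.

Lemma dgw_zgeo tau w : 0 < imag tau -> zgeo (dgw tau w).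
Proof.
move=> t0; have [C HC] := gw_bound (cmod w) 1 t0.
pose D := cmod (2 * ofR pi * (0 +i* 1)%C * tau) * (1 + cmod w).
exists (D * C) => n; rewrite /dgw cmodM -[leRHS]mulrA.
apply: le_trans (ler_wpM2l _ (HC w n (lexx _))); last first.
  by rewrite mulr_ge0 ?cmod_ge0// addr_ge0 ?cmod_ge0.
rewrite [leRHS]mulrCA mulrC ler_wpM2l ?cmod_ge0// cmodM /D -[leRHS]mulrA ler_wpM2l ?cmod_ge0//.
apply: (le_trans (cmodD _ _)); rewrite cmod_intr mul1r.
have := expR_ge1Dx (`|n%:~R| : R); have := cmod_ge0 w; have : 0 <= `|n%:~R : R| by [].
nra.
Qed.

Definition gsum tau w := zsum (gw tau w).

Lemma gsum_taylor tau (Y : R) : 0 < imag tau -> exists2 C, 0 <= C & forall w d,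
  cmod w <= Y -> cmod d <= 1 ->
  cmod (gsum tau (w + d) - gsum tau w - d * zsum (dgw tau w)) <= C * cmod d ^+ 2.
Proof.
move=> t0; have [C HC] := gw_taylor Y t0; exists (4 * `|C|); first by rewrite mulr_ge0.
move=> w d wY d1.
have gz w' := gw_zgeo w' t0; have dz := dgw_zgeo w t0.
rewrite /gsum -zsumM// -!zsumB//; [|exact: zgeoB|exact: zgeoM].
rewrite -mulrA; apply: zsum_le => n; apply: (le_trans (HC _ _ n wY d1)).
by rewrite ler_wpM2r ?invr_ge0 ?exprn_ge0// ler_wpM2r ?sqr_ge0// ler_norm.
Qed.

Lemma gsumS tau w : 0 < imag tau -> gsum tau (w + 1) = gsum tau w.
Proof.
move=> t0; rewrite /gsum -[RHS]zsumS; last exact: gw_zgeo.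
by congr zsum; apply/funext => n; rewrite /gw; congr ee; rewrite intrD; ring.
Qed.

Lemma imag_neq0 tau : 0 < imag tau -> tau != 0.
Proof. by move=> t0; apply/eqP => tE; rewrite tE /imag ltxx in t0. Qed.

(** Quasi-periodicity: in the expanded square the cross term is the integer [- n k], which [ee] does
    not see. *)
Lemma gsum_shift tau w k : 0 < imag tau ->
  gsum tau (w - k%:~R / tau) = ee (- k%:~R * w + k%:~R ^+ 2 / (2 * tau)) * gsum tau w.
Proof.
move=> t0; have tn0 := imag_neq0 t0.
rewrite /gsum -zsumM; last exact: gw_zgeo.
congr zsum; apply/funext => n; rewrite /gw -eeD.
have -> : tau / 2 * (n%:~R + (w - k%:~R / tau)) ^+ 2 =
  - (n * k)%:~R + (- k%:~R * w + k%:~R ^+ 2 / (2 * tau) + tau / 2 * (n%:~R + w) ^+ 2).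
  by rewrite intrM; field.
by rewrite [LHS]eeD eeN ee_int invr1 mul1r.
Qed.

End GaussianSeries.

(** * The finite Fourier transform of equidistant samples *)

Section SampledFourier.
Context {R : realType}.
Implicit Types (tau w z d : CC R) (n k : int).

(** With [u = pi x] the mean value theorem gives [sin u = u cos c]. Either [cos c >= 1 / pi] and the
    claim is immediate, or [cos u <= cos c < 1 / 2] forces [sin u >= 1 / 2 >= x]. *)
Lemma sin_pi_ge (x : R) : 0 <= x <= 1 / 2 -> x <= sin (pi * x).
Proof.
move=> /andP[x0 x12].
have [->|xn0] := eqVneq x 0; first by rewrite mulr0 sin0.
have {}x0 : 0 < x by rewrite lt0r xn0.
have p2 := pi_ge2 R; have p4 : pi <= 4 :> R by have := pihalf_lt2 R; lra.
set u := pi * x; have u0 : 0 < u by rewrite mulr_gt0//; lra.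
have up : u <= pi / 2 by rewrite /u; nra.
have [|c] := @MVT R sin cos 0 u u0 (fun x _ => is_derive_sin x).
  by apply: continuous_subspaceT => y; exact: continuous_sin.
rewrite in_itv /= sin0 !subr0 => /andP[c0 cu] E.
have s0 : 0 <= sin u by apply: sin_ge0_pi; apply/andP; split; lra.
case: (leP (1 / pi) (cos c)) => [h|h].
  rewrite E /u mulrA ler_peMl ?(ltW x0)//.
  by move: h; rewrite ler_pdivrMr//; lra.
have cuc : cos u <= cos c.
  by apply: ltW; rewrite ltr_cos// in_itv /= ?(ltW c0) ?(ltW u0)/=; lra.
have cu0 : 0 <= cos u.
  by apply: cos_ge0_pihalf; lra.
have : 1 / pi <= 1 / 2 :> R by rewrite !div1r lef_pV2 ?posrE; lra.
have := cos2Dsin2 u; nra.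
Qed.

Lemma cmod_sqr z : cmod z ^+ 2 = complex.Re z ^+ 2 + complex.Im z ^+ 2.
Proof. by rewrite cmod_sqrt sqr_sqrtr// addr_ge0 ?sqr_ge0. Qed.

(** [|1 - exp (2 pi i x)| = 2 |sin (pi x)|]. *)
Lemma one_sub_ee_ge (x : R) : `|x| <= 1 / 2 -> 2 * `|x| <= cmod (1 - ee (ofR x)).
Proof.
move=> x12; rewrite -(@ler_pXn2r _ 2)// ?nnegrE ?cmod_ge0 ?mulr_ge0//.
rewrite cmod_sqr ee_ofR /=.
have -> : 2 * pi * x = (pi * x) + (pi * x) by ring.
rewrite cosD sinD.
have H : x ^+ 2 <= sin (pi * x) ^+ 2.
  have := @sin_pi_ge `|x|; rewrite x12 normr_ge0 => /(_ isT) H.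
  have -> : sin (pi * x) ^+ 2 = sin (pi * `|x|) ^+ 2.
    by case: (ger0P x) => // _; rewrite mulrN sinN sqrrN.
  by rewrite -real_normK ?num_real// lerXn2r ?nnegrE// (le_trans _ H).
have := cos2Dsin2 (pi * x); rewrite exprMn real_normK ?num_real//.
set c := cos _; set s := sin _ in H * => E.
have -> : (1 - (c * c - s * s)) ^+ 2 + (0 - (s * c + c * s)) ^+ 2 = 4 * s ^+ 2; last by lra.
have -> : c * c = 1 - s ^+ 2 by lra.
rewrite sub0r sqrrN; have -> : (s * c + c * s) ^+ 2 = 4 * s ^+ 2 * c ^+ 2 by ring.
have -> : c ^+ 2 = 1 - s ^+ 2 by lra.
ring.
Qed.

Lemma cyclic_sum_shift (h : nat -> CC R) L : h L = h 0%N ->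
  \sum_(0 <= j < L) h j.+1 = \sum_(0 <= j < L) h j.
Proof.
move=> hL; apply: (addIr (h 0%N)).
by rewrite -{2}hL -[RHS]big_nat_recr// big_nat_recl// addrC.
Qed.

(** The Fourier coefficient of frequency [k] of [w |-> gsum tau (z + w)], from [L] samples. As the
    samples start at [z], summing over a complete set of frequencies returns the value at [z]. *)
Definition dft tau (L : nat) k z : CC R :=
  L%:R^-1 * \sum_(0 <= j < L) gsum tau (z + j%:R / L%:R) * ee (- k%:~R * (j%:R / L%:R)).

Lemma gsum_bounded tau (Y : R) : 0 < imag tau -> exists2 B, 0 <= B & forall w,
  cmod w <= Y -> cmod (gsum tau w) <= B.
Proof.
move=> t0; have [C HC] := gw_bound Y 0 t0; exists (4 * `|C|); first by rewrite mulr_ge0.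
move=> w wY; apply: zsum_le => n.
have := HC w n wY; rewrite mul0r expR0 mulr1 => /le_trans; apply.
by rewrite ler_wpM2r ?invr_ge0 ?exprn_ge0// ler_norm.
Qed.

Lemma cmod_frac j L : (j <= L)%N -> cmod (j%:R / L%:R : CC R) <= 1.
Proof.
case: L => [|L]; first by rewrite invr0 mulr0 cmod0.
by move=> jL; rewrite cmodM cmodV !cmod_nat ler_pdivrMr// mul1r ler_nat.
Qed.

Lemma gsum_period tau z L : 0 < imag tau -> (0 < L)%N ->
  gsum tau (z + L%:R / L%:R) = gsum tau z.
Proof. by move=> t0 L0; rewrite divff ?gsumS// pnatr_eq0 -lt0n. Qed.

Lemma cmod_ee_int_frac k j L : cmod (ee (- k%:~R * (j%:R / L%:R)) : CC R) = 1.
Proof.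
by rewrite -ofR_int -!ofR_nat -ofRV -ofRM -ofRN -ofRM cmod_ee_ofR.
Qed.

(** Summation by parts twice, with a constant independent of [L]: multiplication by [(1 - zt) ^ 2]
    turns the samples into second differences, which are [O(L ^ -2)] by Taylor expansion, while
    [|1 - zt| >= 2 |k| / L] as long as [2 |k| <= L]. *)
Lemma dft_decay tau z : 0 < imag tau -> exists2 C, 0 <= C & forall L k,
  (0 < L)%N -> (2 * absz k <= L)%N -> cmod (dft tau L k z) * (1 + `|k%:~R| ^+ 2) <= C.
Proof.
move=> t0; have [B B0 HB] := gsum_bounded (cmod z + 2) t0.
have [C C0 HC] := gsum_taylor (cmod z + 2) t0.
exists (B + C) => [|L k L0 kL]; first exact: addr_ge0.
have Lr : 0 < L%:R :> R by rewrite ltr0n.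
have Ln0 : L%:R != 0 :> CC R by rewrite pnatr_eq0 -lt0n.
rewrite mulrDr mulr1 lerD//.
  rewrite /dft cmodM cmodV cmod_nat ler_pdivrMl//.
  apply: (le_trans (cmod_sum _ _ _)).
  apply: (@le_trans _ _ (\sum_(0 <= j < L) B)); last first.
    by rewrite sumr_const_nat subn0 mulr_natl.
  apply: ler_sum_nat => j jL; rewrite cmodM cmod_ee_int_frac mulr1 HB// (le_trans (cmodD _ _))// lerD2l.
  by rewrite (le_trans (cmod_frac _)) ?(ltnW jL)//; lra.
pose x : R := - k%:~R / L%:R; pose zt : CC R := ee (ofR x).
have eej j : ee (- k%:~R * (j%:R / L%:R)) = zt ^+ j :> CC R.
  rewrite eeX; congr ee; rewrite /x ofRM ofRN ofRV ofR_nat ofR_int; field; exact: Ln0.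
have ztL : zt ^+ L = 1.
  by rewrite -eej divff// mulr1 -intrN ee_int.
have zn0 : zt != 0 by exact: ee_neq0.
pose h j := gsum tau (z + j%:R / L%:R).
have hL j : h (j + L)%N = h j.
  by rewrite /h natrD mulrDl addrA gsum_period.
pose S := \sum_(0 <= j < L) h j * zt ^+ j.
have dE : dft tau L k z = L%:R^-1 * S.
  by congr (_ * _); apply: eq_bigr => j _; rewrite eej.
have c1 : \sum_(0 <= j < L) h j.+1 * zt ^+ j.+1 = S.
  apply: (@cyclic_sum_shift (fun j => h j * zt ^+ j)).
  by rewrite ztL -(hL 0%N).
have c2 : \sum_(0 <= j < L) h j.+2 * zt ^+ j.+2 = S.
  rewrite -c1; apply: (@cyclic_sum_shift (fun j => h j.+1 * zt ^+ j.+1)).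
  by rewrite exprS ztL -(hL 1%N) add1n expr1 mulr1.
have key : (1 - zt) ^+ 2 * S = \sum_(0 <= j < L) (h j.+2 - 2 * h j.+1 + h j) * zt ^+ j.+2.
  transitivity (S - 2 * zt * S + zt ^+ 2 * S); first by ring.
  rewrite -{1}c2 -{1}c1 /S !mulr_sumr -sumrB -big_split/=.
  by apply: eq_bigr => j _; rewrite !exprS; ring.
have ztn j : cmod (zt ^+ j) = 1 by rewrite cmodX cmod_ee_ofR expr1n.
have key2 : cmod (1 - zt) ^+ 2 * cmod S <= L%:R * (2 * C / L%:R ^+ 2).
  rewrite -cmodX -cmodM key (le_trans (cmod_sum _ _ _))//.
  apply: (@le_trans _ _ (\sum_(0 <= j < L) (2 * C / L%:R ^+ 2))); last first.
    by rewrite sumr_const_nat subn0 [leRHS]mulr_natl.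
  apply: ler_sum_nat => j jL; rewrite cmodM ztn mulr1.
  pose w := z + j.+1%:R / L%:R; pose d : CC R := L%:R^-1.
  have -> : h j.+2 - 2 * h j.+1 + h j = (gsum tau (w + d) - gsum tau w - d * zsum (dgw tau w)) +
     (gsum tau (w + (- d)) - gsum tau w - (- d) * zsum (dgw tau w)).
    have -> : gsum tau (w + d) = h j.+2.
      by rewrite /h /w /d; congr gsum; rewrite -[in RHS]natr1; field; exact: Ln0.
    have -> : gsum tau (w + - d) = h j.
      by rewrite /h /w /d; congr gsum; rewrite -[in LHS]natr1; field; exact: Ln0.
    by rewrite -/(h j.+1); ring.
  have wY : cmod w <= cmod z + 2.
    by rewrite (le_trans (cmodD _ _))// lerD2l (le_trans (cmod_frac _))//; lra.
  have dd : cmod d = L%:R^-1 by rewrite cmodV cmod_nat.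
  have d1 : cmod d <= 1 by rewrite dd invf_le1// ler1n.
  have := HC w d wY d1; have := HC w (- d) wY.
  rewrite cmodN => /(_ d1); rewrite dd exprVn.
  have := cmodD (gsum tau (w + d) - gsum tau w - d * zsum (dgw tau w)) (gsum tau (w + - d) - gsum tau w - - d * zsum (dgw tau w)).
  lra.
have x12 : `|x| <= 1 / 2.
  rewrite /x normrM normrN normfV [ `|L%:R|]ger0_norm// ler_pdivrMr//.
  by rewrite mulrC mulrA mulr1 ler_pdivlMr// -intr_norm -abszE -natrM ler_nat mulnC.
have := one_sub_ee_ge x12; rewrite -/zt => H1.
have xE : `|x| = `|k%:~R| / L%:R by rewrite /x normrM normrN normfV [ `|L%:R|]ger0_norm.
rewrite dE cmodM cmodV cmod_nat.
have H2 : (2 * `|x|) ^+ 2 <= cmod (1 - zt) ^+ 2 by rewrite lerXn2r ?nnegrE ?cmod_ge0 ?mulr_ge0.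
have := le_trans (ler_wpM2r (cmod_ge0 S) H2) key2.
rewrite xE => H3.
have := ler_wpM2l (ltW Lr) H3.
have -> : L%:R * ((2 * (`|k%:~R| / L%:R)) ^+ 2 * cmod S) = 4 * (L%:R^-1 * cmod S * `|k%:~R| ^+ 2) :> R.
  by field; rewrite gt_eqF.
have -> : L%:R * (L%:R * (2 * C / L%:R ^+ 2)) = 2 * C by field; rewrite gt_eqF.
lra.
Qed.

Definition smean tau (L : nat) w : CC R :=
  L%:R^-1 * \sum_(0 <= j < L) gsum tau (w + j%:R / L%:R).

(** A mean over a full period hardly depends on its base point. Its first variation is the mean of
    the derivatives, which up to [O(1 / L)] is a sum of increments telescoping to zero over the
    period. *)
Lemma smean_step tau (Y : R) : 0 < imag tau -> exists2 C, 0 <= C & forall L w d,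
  (0 < L)%N -> cmod w <= Y -> cmod d <= 1 ->
  cmod (smean tau L (w + d) - smean tau L w) <= C * cmod d ^+ 2 + C * cmod d / L%:R.
Proof.
move=> t0; have [C C0 HC] := gsum_taylor (Y + 1) t0.
exists C => // L w d L0 wY d1.
have Lr : 0 < L%:R :> R by rewrite ltr0n.
have Ln0 : L%:R != 0 :> CC R by rewrite pnatr_eq0 -lt0n.
pose W j := w + j%:R / L%:R.
pose e1 j := gsum tau (W j + d) - gsum tau (W j) - d * zsum (dgw tau (W j)).
pose e2 j := gsum tau (W j + L%:R^-1) - gsum tau (W j) - L%:R^-1 * zsum (dgw tau (W j)).
have tele : \sum_(0 <= j < L) (gsum tau (W j + L%:R^-1) - gsum tau (W j)) = 0.
  rewrite (eq_bigr (fun j => gsum tau (W j.+1) - gsum tau (W j))); last first.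
    by move=> j _; rewrite /W -natr1 mulrDl mul1r addrA.
  by rewrite telescope_sumr// /W gsum_period// mul0r addr0 subrr.
have -> : smean tau L (w + d) - smean tau L w =
    L%:R^-1 * (\sum_(0 <= j < L) e1 j) - d * \sum_(0 <= j < L) e2 j.
  rewrite /smean -mulrBr -sumrB.
  have -> : \sum_(0 <= j < L) e2 j = - \sum_(0 <= j < L) L%:R^-1 * zsum (dgw tau (W j)).
    by rewrite /e2 big_split/= tele sumrN add0r.
  rewrite mulrN opprK !mulr_sumr -big_split/=; apply: eq_bigr => j _.
  by rewrite /e1 /W addrAC; ring.
have WY j : (j < L)%N -> cmod (W j) <= Y + 1.
  by move=> jL; rewrite (le_trans (cmodD _ _))// lerD// cmod_frac// ltnW.
apply: (le_trans (cmodB _ _)); apply: lerD.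
  rewrite cmodM cmodV cmod_nat ler_pdivrMl// (le_trans (cmod_sum _ _ _))//.
  apply: (@le_trans _ _ (\sum_(0 <= j < L) (C * cmod d ^+ 2))); last first.
    by rewrite sumr_const_nat subn0 mulr_natl.
  by apply: ler_sum_nat => j /andP[_ jL]; apply: HC => //; exact: WY.
rewrite cmodM [C * _]mulrC -mulrA ler_wpM2l ?cmod_ge0//.
rewrite ler_pdivlMr// (le_trans (ler_wpM2r (ltW Lr) (cmod_sum _ _ _)))//.
apply: (@le_trans _ _ ((\sum_(0 <= j < L) (C * L%:R^-1 ^+ 2)) * L%:R)); last first.
  rewrite sumr_const_nat subn0 -[_ *+ L]mulr_natr.
  by have -> : C * L%:R^-1 ^+ 2 * L%:R * L%:R = C by field; rewrite gt_eqF.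
rewrite ler_wpM2r ?(ltW Lr)//; apply: ler_sum_nat => j /andP[_ jL].
have dd : cmod (L%:R^-1 : CC R) = L%:R^-1 by rewrite cmodV cmod_nat.
rewrite -dd; apply: HC; first exact: WY.
by rewrite dd invf_le1// ler1n.
Qed.

Lemma smean_const tau w v : 0 < imag tau -> exists2 C, 0 <= C & forall L,
  (0 < L)%N -> cmod (smean tau L (w + v) - smean tau L w) <= C / L%:R.
Proof.
move=> t0; have [C C0 HC] := smean_step (cmod w + cmod v) t0.
pose T := (Num.bound (cmod v)).+1.
have Tr : 0 < T%:R :> R by rewrite ltr0n.
have vT : cmod v <= T%:R.
  rewrite ltW// (lt_le_trans (archi_boundP (cmod_ge0 v)))// ler_nat//.
exists (C * cmod v ^+ 2 + C * cmod v); first by rewrite addr_ge0// mulr_ge0 ?sqr_ge0 ?cmod_ge0.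
move=> L L0; have Lr : 0 < L%:R :> R by rewrite ltr0n.
(* The way from [w] to [w + v] is cut into [M] steps: [T >= |v|] keeps each of them of modulus at
   most 1, and the factor [L] makes the quadratic errors add up to [O(1 / L)]. *)
pose M := (T * L)%N; have M0 : (0 < M)%N by rewrite muln_gt0.
have Mr : 0 < M%:R :> R by rewrite ltr0n.
pose d := v / M%:R.
have cd : cmod d = cmod v / M%:R by rewrite cmodM cmodV cmod_nat.
have L1 : 1 <= L%:R :> R by rewrite ler1n.
have d1 : cmod d <= 1.
  by rewrite cd ler_pdivrMr// mul1r natrM (le_trans vT)// ler_peMr ?(ltW Tr).
have H i : (i <= M)%N -> cmod (smean tau L (w + i%:R * d) - smean tau L w) <=
    i%:R * (C * cmod d ^+ 2 + C * cmod d / L%:R).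
  elim: i => [|i IH] iM; first by rewrite !mul0r addr0 subrr cmod0.
  have -> : smean tau L (w + i.+1%:R * d) - smean tau L w =
     (smean tau L (w + i%:R * d + d) - smean tau L (w + i%:R * d)) + (smean tau L (w + i%:R * d) - smean tau L w).
    by rewrite -natr1 mulrDl mul1r addrA; ring.
  rewrite (le_trans (cmodD _ _))// -natr1 mulrDl mul1r [leRHS]addrC lerD//; last exact: IH (ltnW iM).
  apply: HC => //; rewrite (le_trans (cmodD _ _))// lerD2l cmodM cmod_nat cd mulrCA ler_piMr ?cmod_ge0//.
  by rewrite ler_pdivrMr// mul1r ler_nat ltnW.
have := H M (leqnn M).
have -> : M%:R * d = v by rewrite /d mulrC divfK// pnatr_eq0 -lt0n.
move=> /le_trans; apply; rewrite cd /M natrM.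
have -> : T%:R * L%:R * (C * (cmod v / (T%:R * L%:R)) ^+ 2 + C * (cmod v / (T%:R * L%:R)) / L%:R) =
   (C * cmod v ^+ 2 / T%:R + C * cmod v) / L%:R :> R by field; rewrite ?gt_eqF.
rewrite ler_wpM2r ?invr_ge0 ?(ltW Lr)// lerD2r ler_pdivrMr// ler_peMr ?ler1n//.
by rewrite mulr_ge0 ?sqr_ge0.
Qed.

Lemma Zsum_ee (x : CC R) K :
  (ee x - 1) * Zsum (fun k => ee (k%:~R * x)) K = ee (K%:R * x) - ee (- (K%:R * x)).
Proof.
elim: K => [|K IH]; first by rewrite Zsum0 mulr0 mul0r oppr0 subrr.
have E1 : K.+1%:R * x = K%:R * x + x by rewrite -natr1 mulrDl mul1r.
have E2 : (- K.+1%:Z)%:~R * x = - (K%:R * x + x) by rewrite intrN mulNr -pmulrn E1.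
rewrite ZsumS mulrDr IH E1 E2 -pmulrn !eeN !eeD.
by field; apply/andP; split; exact: ee_neq0.
Qed.

(** Orthogonality of characters: the [2 K] frequencies of the window form a complete residue system,
    so only the sample [j = 0] survives. *)
Lemma dft_inversion tau z K : 0 < imag tau -> (0 < K)%N ->
  Zsum (fun k => dft tau (K * 2) k z) K = gsum tau z.
Proof.
move=> t0 K0; set L := (K * 2)%N.
have L0 : (0 < L)%N by rewrite muln_gt0 K0.
have Lr : 0 < L%:R :> R by rewrite ltr0n.
have Ln0 : L%:R != 0 :> CC R by rewrite pnatr_eq0 -lt0n.
have LK : L%:R = K%:R * 2 :> CC R by rewrite natrM.
have -> : Zsum (fun k => dft tau L k z) K = L%:R^-1 * \sum_(0 <= j < L)
    gsum tau (z + j%:R / L%:R) * Zsum (fun k => ee (k%:~R * (- (j%:R / L%:R)))) K.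
  rewrite /Zsum /dft (eq_bigr (fun n : nat => L%:R^-1 * \sum_(0 <= j < L) gsum tau (z + j%:R / L%:R) *
    (ee (n%:Z%:~R * (- (j%:R / L%:R))) + ee ((- n.+1%:Z)%:~R * (- (j%:R / L%:R)))))); last first.
    move=> n _; rewrite -mulrDr -big_split/=; congr (_ * _); apply: eq_bigr => j _.
    by rewrite -mulrDr !mulrN !mulNr.
  rewrite -mulr_sumr exchange_big/=; congr (_ * _); apply: eq_bigr => j _.
  by rewrite mulr_sumr.
rewrite big_ltn// big_nat big1 ?addr0; last first.
  move=> j /andP[j1 jL].
  suff -> : Zsum (fun k => ee (k%:~R * (- (j%:R / L%:R) : CC R))) K = 0 by rewrite mulr0.
  have zn : ee (- (j%:R / L%:R) : CC R) != 1.
    (* The representative of [- j / L] modulo 1 in [[-1/2, 1/2]] is nonzero, and [one_sub_ee_ge]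
       applies to it. *)
    have [x [x12 x0 ->]] : exists x : R, [/\ `|x| <= 1 / 2, 0 < `|x| & ee (- (j%:R / L%:R)) = ee (ofR x)].
      have jr : 0 < j%:R :> R by rewrite ltr0n.
      have jl : j%:R < L%:R :> R by rewrite ltr_nat.
      have LKr : L%:R = K%:R * 2 :> R by rewrite natrM.
      case: (leqP j K) => jK.
        have {}jK : j%:R <= K%:R :> R by rewrite ler_nat.
        exists (- (j%:R / L%:R)); rewrite normrN ger0_norm ?divr_ge0//; split.
        - rewrite ler_pdivrMr// LKr; lra.
        - by rewrite divr_gt0.
        - by rewrite ofRN ofRM ofRV !ofR_nat.
      have {}jK : K%:R <= j%:R :> R by rewrite ler_nat ltnW.
      have q1 : j%:R / L%:R < 1 :> R by rewrite ltr_pdivrMr// mul1r.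
      exists (1 - j%:R / L%:R); rewrite ger0_norm ?subr_ge0 ?(ltW q1)//; split.
      - suff : 1 / 2 <= j%:R / L%:R :> R by lra.
        rewrite ler_pdivlMr// LKr; lra.
      - by rewrite subr_gt0.
      - by rewrite ofRB eeD (ee_nat 1 : ee (ofR 1) = 1) mul1r ofRM ofRV !ofR_nat.
    rewrite eq_sym -subr_eq0 -cmod_gt0.
    by rewrite (lt_le_trans _ (one_sub_ee_ge x12))// mulr_gt0.
  apply: (mulfI (x := ee (- (j%:R / L%:R)) - 1)); first by rewrite subr_eq0.
  rewrite mulr0 Zsum_ee.
  have E : K%:R * - (j%:R / L%:R) = - (K%:R * - (j%:R / L%:R)) + (- j%:Z)%:~R :> CC R.
    by rewrite intrN -pmulrn LK; field; rewrite -?LK ?pnatr_eq0 -?lt0n.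
  by rewrite {1}E eeD ee_int mulr1 subrr.
rewrite mul0r addr0 oppr0.
have -> : (fun k : int => ee (k%:~R * 0)) = (fun=> 1 : CC R).
  by apply/funext => k; rewrite mulr0 ee0.
have -> : Zsum (fun=> 1 : CC R) K = L%:R.
  by rewrite /Zsum sumr_const_nat subn0 LK -[_ *+ K]mulr_natl.
by field.
Qed.

End SampledFourier.

(** * Proportionality of theta functions under inversion *)

Section ThetaInversion.
Context {R : realType}.
Implicit Types (tau w z d p : CC R) (n k : int).

Definition tht p z n : CC R := ee (p / 2 * n%:~R ^+ 2 + n%:~R * z).

Lemma imag_inv tau : 0 < imag tau -> 0 < imag (- tau^-1).
Proof.
move=> t0; have tn0 := imag_neq0 t0.
rewrite /imag; case: tau t0 tn0 => a b /= t0 tn0.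
have : 0 < a ^+ 2 + b ^+ 2 by rewrite ltr_wpDl ?sqr_ge0// exprn_gt0.
by move=> ab; rewrite opprK divr_gt0.
Qed.

Lemma tht_zgeo p z : 0 < imag p -> zgeo (tht p z).
Proof.
move=> p0; have pn0 := imag_neq0 p0.
have := zgeoM (ee (- (z ^+ 2 / (2 * p)))) (gw_zgeo (z / p) p0).
by congr zgeo; apply/funext => n; rewrite /gw /tht -eeD; congr ee; field.
Qed.

(** Twisting the samples by frequency [k] amounts to moving the argument by [- k / tau], by
    quasi-periodicity; the compensating factor is a term of the theta series at [- 1 / tau]. *)
Lemma dft_tht tau L k z : 0 < imag tau ->
  dft tau L k z = tht (- tau^-1) z k * smean tau L (z - k%:~R / tau).
Proof.
move=> t0; have tn0 := imag_neq0 t0.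
rewrite /dft /smean mulrCA; congr (_ * _); rewrite mulr_sumr; apply: eq_bigr => j _.
have key : tht (- tau^-1) z k * ee (- k%:~R * (z + j%:R / L%:R) + k%:~R ^+ 2 / (2 * tau)) =
    ee (- k%:~R * (j%:R / L%:R)).
  rewrite /tht -eeD; congr ee; set J := j%:R / L%:R; field; exact: tn0.
have -> : z - k%:~R / tau + j%:R / L%:R = (z + j%:R / L%:R) - k%:~R / tau by rewrite addrAC.
by rewrite [in RHS]gsum_shift// [RHS]mulrA key mulrC.
Qed.

Lemma smean_bounded tau : 0 < imag tau -> exists2 B, 0 <= B & forall L,
  (0 < L)%N -> cmod (smean tau L 0) <= B.
Proof.
move=> t0; have [B B0 HB] := gsum_bounded 1 t0.
exists B => // L L0; have Lr : 0 < L%:R :> R by rewrite ltr0n.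
rewrite /smean cmodM cmodV cmod_nat ler_pdivrMl// (le_trans (cmod_sum _ _ _))//.
apply: (@le_trans _ _ (\sum_(0 <= j < L) B)); last first.
  by rewrite sumr_const_nat subn0 mulr_natl.
apply: ler_sum_nat => j jL; apply: HB; rewrite add0r cmod_frac//.
by case/andP: jL => _ /ltnW.
Qed.

Lemma cvg_telescoping_series (D : R) : 0 <= D ->
  cvgn (series (fun n : nat => D / ((n.+1)%:R * (n.+2)%:R))).
Proof.
move=> D0; apply: nondecreasing_is_cvgn.
  by apply: nondecreasing_series => n _ _; rewrite divr_ge0// mulr_ge0.
exists D => _ [K _ <-].
suff -> : series (fun n : nat => D / ((n.+1)%:R * (n.+2)%:R)) K = D - D / K.+1%:R.
  by rewrite gerBl divr_ge0.
elim: K => [|K IH]; first by rewrite /series /= big_nil divr1 subrr.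
rewrite seriesSr IH -[in K.+2%:R]natr1; field.
by rewrite ![1 + _]addrC !natr1 !pnatr_eq0.
Qed.

(** Replaces the decay [1 / (1 + k ^ 2)] by a majorant whose series telescopes. The factor 3 is
    attained at [n = |k| = 1], where [2 * 3 = 3 * (1 + 1)]. *)
Lemma inv_sqr_le (D : R) (n : nat) k : 0 <= D -> (n <= absz k)%N ->
  D / (1 + `|k%:~R| ^+ 2) <= 3 * D / ((n.+1)%:R * (n.+2)%:R).
Proof.
move=> D0 nk; have -> : `|k%:~R| = (absz k)%:R :> R by rewrite -intr_norm -abszE.
set m := absz k in nk *.
rewrite ler_pdivrMr; last by rewrite ltr_pwDl ?sqr_ge0.
rewrite [leRHS]mulrAC ler_pdivlMr ?mulr_gt0//.
have : (n.+1 * n.+2 <= 3 * (1 + m ^ 2))%N.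
  have h : (n * n <= m * m)%N by exact: leq_mul.
  by rewrite -mulnn; case: (n) h => [|n']; nia.
rewrite -(ler_nat R) !natrM natrD natrX => H.
have := ler_wpM2l D0 H; lra.
Qed.

Lemma cvg_cmod0 (T : Type) (F : set_system T) {FF : Filter F} (h : T -> CC R) :
  h x @[x --> F] --> (0 : CC R) -> cmod (h x) @[x --> F] --> (0 : R).
Proof.
move=> /cvgC_cmod H; apply/cvgrPdist_lt => e e0.
apply: filterS (H e e0) => x.
by rewrite !sub0r cmodN normrN ger0_norm ?cmod_ge0.
Qed.

(** The difference is a sum over [k] of theta terms times differences of sample means. Each tends to
    zero by [smean_const], and [dft_decay] together with the bound on the means at 0 gives a
    majorant independent of [K]. *)
Lemma poisson_tail tau z : 0 < imag tau ->
  gsum tau z - smean tau (K.+1 * 2) 0 * Zsum (tht (- tau^-1) z) K.+1 @[K --> \oo] --> (0 : CC R).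
Proof.
move=> t0; set p := - tau^-1; have p0 : 0 < imag p := imag_inv t0.
have [C C0 HC] := dft_decay z t0; have [B B0 HB] := smean_bounded t0.
have [G HG] := tht_zgeo z p0; have G0 := zbound_ge0 HG.
pose L K := (K.+1 * 2)%N.
pose f K k : CC R := tht p z k * (smean tau (L K) (z - k%:~R / tau) - smean tau (L K) 0).
have E K : gsum tau z - smean tau (L K) 0 * Zsum (tht p z) K.+1 = Zsum (f K) K.+1.
  rewrite -(dft_inversion z t0 (ltn0Sn K)) /Zsum mulr_sumr -sumrB.
  by apply: eq_bigr => n _; rewrite !dft_tht// /f -/p /L; ring.
have Hf K k : (absz k <= K.+1)%N -> cmod (f K k) <= C / (1 + `|k%:~R| ^+ 2) + B * (G / 2 ^+ absz k).
  move=> kK; have -> : f K k = dft tau (L K) k z - smean tau (L K) 0 * tht p z k.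
    by rewrite dft_tht// /f; ring.
  rewrite (le_trans (cmodB _ _))// lerD//.
    rewrite ler_pdivlMr ?ltr_pwDl ?sqr_ge0//; by apply: HC => //; rewrite mulnC leq_mul2r kK.
  by rewrite cmodM ler_pM ?cmod_ge0 ?HB// HG.
(* Both [n] and [- n - 1] have absolute value at least [n], hence twice each of the two bounds. *)
pose v (n : nat) : R := 6 * C / ((n.+1)%:R * (n.+2)%:R) + 2 * (B * G) / 2 ^+ n.
have v0 (n : nat) : 0 <= v n.
  by rewrite addr_ge0// divr_ge0// ?mulr_ge0// exprn_ge0.
pose u K (n : nat) : R := cmod (f K n%:Z) + cmod (f K (- n.+1%:Z)).
have Hu K (n : nat) : (n < K.+1)%N -> 0 <= u K n <= v n.
  move=> nK; rewrite addr_ge0 ?cmod_ge0//=.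
  have h1 := Hf K n%:Z (ltnW nK); have h2 := Hf K (- n.+1%:Z); rewrite abszN in h2.
  have {}h2 := h2 nK.
  have i1 := inv_sqr_le C0 (leqnn n : (n <= absz n%:Z)%N).
  have i2 := inv_sqr_le (k := - n.+1%:Z) C0 (leqnSn n).
  have i3 : (2 ^+ n.+1)^-1 <= (2 ^+ n)^-1 :> R.
    by rewrite lef_pV2 ?posrE ?exprn_gt0// ler_weXn2l// ler1n.
  have := ler_wpM2l (mulr_ge0 B0 G0) i3.
  rewrite /u /v /=; rewrite /= in h1 h2 i1 i2.
  set P := (_ * _)^-1 in i1 i2 *; set Q1 := C / _ in h1 i1; set Q2 := C / _ in h2 i2.
  set q1 := (2 ^+ n)^-1 in h1 *; set q2 := (2 ^+ n.+1)^-1 in h2 *.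
  lra.
have cv : cvgn (series v).
  have -> : series v = (fun K => series (fun n : nat => 6 * C / ((n.+1)%:R * (n.+2)%:R)) K + series (fun n : nat => 2 * (B * G) / 2 ^+ n) K).
    by apply/funext => K; rewrite /series /= -big_split.
  apply: is_cvgD; last exact: cvg_half_series.
  by apply: cvg_telescoping_series; rewrite mulr_ge0.
have fc k : cmod (f K k) @[K --> \oo] --> (0 : R).
  have [D D0 HD] := smean_const 0 (z - k%:~R / tau) t0.
  apply: cvg_cmod0; apply: (@cvgC_squeeze _ _ _ _ _ _ (fun K => cmod (tht p z k) * D * harmonic K)).
    move=> K; rewrite sub0r cmodN cmodM -mulrA ler_wpM2l ?cmod_ge0//.
    rewrite -[in smean _ _ (z - _)](add0r (z - _)).
    apply: le_trans (HD (L K) _) _; first by rewrite muln_gt0.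
    by rewrite ler_wpM2l// /harmonic /= lef_pV2 ?posrE ?ltr0n// ler_nat leq_pmulr.
  rewrite -[X in _ --> X](mulr0 (cmod (tht p z k) * D)).
  by apply: cvgMl_tmp; exact: cvg_harmonic.
have uc (n : nat) : u K n @[K --> \oo] --> 0.
  rewrite -[X in _ --> X]addr0; apply: cvgD; exact: fc.
apply: (@cvgC_squeeze _ _ _ _ _ _ (fun K => \sum_(0 <= n < K.+1) u K n)).
  move=> K; rewrite sub0r cmodN E (le_trans (cmod_sum _ _ _))//.
  by apply: ler_sum => n _; exact: cmodD.
exact: (tannery Hu v0 cv uc).
Qed.

(** The sample means in [poisson_tail] are the same for [z] and [z'], so they can be eliminated
    before the limit is taken. *)
Theorem theta_proportional tau z z' : 0 < imag tau ->
  gsum tau z * zsum (tht (- tau^-1) z') = gsum tau z' * zsum (tht (- tau^-1) z).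
Proof.
move=> t0; set p := - tau^-1; have p0 : 0 < imag p := imag_inv t0.
have S w : Zsum (tht p w) K.+1 @[K --> \oo] --> zsum (tht p w).
  apply: (@cvg_comp _ _ _ S (Zsum (tht p w)) _ _ _ _ (cvg_Zsum (tht_zgeo w p0))).
  by move=> A [N _ HN]; exists N => // K /= NK; apply: HN => /=; rewrite ltnW.
apply/eqP; rewrite -subr_eq0; apply/eqP.
pose E w K := gsum tau w - smean tau (K.+1 * 2) 0 * Zsum (tht p w) K.+1.
have H1 : E z K * Zsum (tht p z') K.+1 - E z' K * Zsum (tht p z) K.+1 @[K --> \oo] -->
    0 * zsum (tht p z') - 0 * zsum (tht p z).
  exact: (cvgCB (cvgCM (poisson_tail z t0) (S z')) (cvgCM (poisson_tail z' t0) (S z))).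
rewrite !mul0r subr0 in H1.
have H2 : gsum tau z * Zsum (tht p z') K.+1 - gsum tau z' * Zsum (tht p z) K.+1 @[K --> \oo] -->
    gsum tau z * zsum (tht p z') - gsum tau z' * zsum (tht p z).
  exact: (cvgCB (cvgCM (@cvgC_cst R nat \oo _ (gsum tau z)) (S z')) (cvgCM (@cvgC_cst R nat \oo _ (gsum tau z')) (S z))).
have EE : (fun K => E z K * Zsum (tht p z') K.+1 - E z' K * Zsum (tht p z) K.+1) =
  (fun K => gsum tau z * Zsum (tht p z') K.+1 - gsum tau z' * Zsum (tht p z) K.+1).
  by apply/funext => K; rewrite /E -/p; ring.
rewrite EE in H1; apply: (cvg_unique _ H2 H1); exact: norm_hausdorff.
Qed.

End ThetaInversion.

(** * Power series in the unit disc, their products and infinite products *)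

Section PowerSeries.
Context {R : realType}.
Implicit Types (a b : nat -> CC R) (q : CC R) (x B : R).

(** A bound for the weighted l1 norm at radius [x]. This norm is submultiplicative for the Cauchy
    product [pconv], which keeps infinite products under control. *)
Definition pbound x B a := forall n, \sum_(0 <= k < n) cmod (a k) * x ^+ k <= B.
Definition pbounded a := forall x, 0 < x < 1 -> exists B, pbound x B a.
Definition pterm a q (k : nat) : CC R := a k * q ^+ k.
Definition peval a q : CC R := limn (series (pterm a q)).
Definition pconv a b (k : nat) : CC R := \sum_(i < k.+1) a i * b (k - i)%N.

Lemma pbound_cvg x B a q : 0 <= x -> pbound x B a -> cmod q <= x ->
  series (pterm a q) @ \oo --> peval a q.
Proof.
move=> x0 H qx; apply: (@series_cvgC _ _ (fun k => cmod (a k) * x ^+ k)).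
  move=> k; rewrite /pterm cmodM cmodX ler_wpM2l ?cmod_ge0// lerXn2r ?nnegrE ?cmod_ge0//.
apply: nondecreasing_is_cvgn.
  by apply: nondecreasing_series => n _ _; rewrite mulr_ge0 ?cmod_ge0 ?exprn_ge0.
by exists B => _ [K _ <-]; exact: H.
Qed.

Lemma mid_radius q : cmod q < 1 -> exists2 x : R, 0 < x < 1 & cmod q < x.
Proof.
move=> q1; have q0 := cmod_ge0 q; exists ((1 + cmod q) / 2); last by lra.
by apply/andP; split; lra.
Qed.

Lemma pbounded_cvg a q : pbounded a -> cmod q < 1 ->
  series (pterm a q) @ \oo --> peval a q.
Proof.
move=> H /mid_radius[x /[dup] x01 /andP[x0 x1] qx].
by have [B HB] := H x x01; apply: (pbound_cvg (ltW x0) HB); exact: ltW.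
Qed.

Lemma poly_coef_conv a b n k : (k < n)%N ->
  ((\poly_(i < n) a i) * (\poly_(i < n) b i))`_k = pconv a b k.
Proof.
move=> kn; rewrite coefM; apply: eq_bigr => i _; rewrite !coef_poly.
by have := ltn_ord i; rewrite ltnS => ik; rewrite (leq_ltn_trans ik kn) (leq_ltn_trans (leq_subr _ _) kn).
Qed.

Lemma poly_coef_cmod a b n k :
  cmod ((\poly_(i < n) a i) * (\poly_(i < n) b i))`_k <=
  ((\poly_(i < n) cmod (a i)) * (\poly_(i < n) cmod (b i)))`_k.
Proof.
rewrite !coefM (le_trans (cmod_sum _ _ _))//; apply: ler_sum => i _.
by rewrite cmodM !coef_poly ler_pM ?cmod_ge0//; case: ifP => // _; rewrite cmod0.
Qed.

Lemma horner_nonneg_ge (p : {poly R}) x n : 0 <= x -> (forall k, 0 <= p`_k) ->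
  \sum_(0 <= k < n) p`_k * x ^+ k <= p.[x].
Proof.
move=> x0 p0; rewrite (@horner_coef_wide _ (n + size p))%N ?leq_addl//.
rewrite -(big_mkord xpredT (fun i => p`_i * x ^+ i)) [leRHS](@big_cat_nat _ _ _ n)//= ?leq_addr//.
by rewrite lerDl sumr_ge0// => k _; rewrite mulr_ge0 ?exprn_ge0.
Qed.

Lemma horner_poly_bound a x B n : pbound x B a -> (\poly_(i < n) cmod (a i)).[x] <= B.
Proof. by move=> /(_ n); rewrite horner_poly big_mkord. Qed.

Lemma horner_poly_cmod_ge0 a x n : 0 <= x -> 0 <= (\poly_(i < n) cmod (a i)).[x].
Proof.
by move=> x0; rewrite horner_poly sumr_ge0// => i _; rewrite mulr_ge0 ?cmod_ge0 ?exprn_ge0.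
Qed.

Lemma poly_cmod_conv_ge0 a b n k : 0 <= ((\poly_(i < n) cmod (a i)) * (\poly_(i < n) cmod (b i)))`_k :> R.
Proof.
rewrite coefM sumr_ge0// => i _; rewrite !coef_poly mulr_ge0//; case: ifP => // _; exact: cmod_ge0.
Qed.

Lemma pbound_conv x A B a b : 0 <= x -> pbound x A a -> pbound x B b ->
  pbound x (A * B) (pconv a b).
Proof.
move=> x0 HA HB n.
set P := \poly_(i < n) cmod (a i); set Q := \poly_(i < n) cmod (b i).
apply: (@le_trans _ _ ((P * Q).[x])); last first.
  by rewrite hornerM ler_pM ?horner_poly_cmod_ge0 ?horner_poly_bound.
apply: le_trans (horner_nonneg_ge n x0 (poly_cmod_conv_ge0 a b n)).
rewrite !big_nat; apply: ler_sum => k /andP[_ kn].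
by rewrite ler_wpM2r ?exprn_ge0// -(poly_coef_conv a b kn) poly_coef_cmod.
Qed.

Lemma pbounded_conv a b : pbounded a -> pbounded b -> pbounded (pconv a b).
Proof.
move=> Ha Hb x /[dup] x01 /andP[x0 _]; have [A HA] := Ha x x01; have [B HB] := Hb x x01.
by exists (A * B); apply: pbound_conv => //; exact: ltW.
Qed.

Lemma cvg_pow0 (A x : R) : 0 <= x < 1 -> A * x ^+ n @[n --> \oo] --> (0 : R).
Proof.
by move=> /andP[x0 x1]; apply: (@cvg_geometric _ A x); rewrite ger0_norm.
Qed.

Lemma ler_cmod_ratio x q k n : 0 < x -> cmod q <= x -> (n <= k)%N ->
  cmod q ^+ k <= (cmod q / x) ^+ n * x ^+ k.
Proof.
move=> x0 qx /subnKC <-; rewrite exprD exprD exprMn exprVn mulrA.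
rewrite -[_ * _ * x ^+ n]mulrA mulVf ?expf_neq0 ?gt_eqF// mulr1.
by rewrite ler_wpM2l ?exprn_ge0 ?cmod_ge0// lerXn2r ?nnegrE ?cmod_ge0// ltW.
Qed.

(** The product of the truncations differs from the truncated Cauchy product only in degrees at
    least [n]; comparing with a radius [x > |q|], these contribute at most [A B (|q| / x) ^ n]. *)
Lemma peval_conv a b q : pbounded a -> pbounded b -> cmod q < 1 ->
  peval (pconv a b) q = peval a q * peval b q.
Proof.
move=> Ha Hb q1; have [x /[dup] x01 /andP[x0 x1] qx] := mid_radius q1.
have [A HA] := Ha x x01; have [B HB] := Hb x x01.
have cA := pbounded_cvg Ha q1; have cB := pbounded_cvg Hb q1.
have cC := pbounded_cvg (pbounded_conv Ha Hb) q1.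
suff H : series (pterm a q) n * series (pterm b q) n - series (pterm (pconv a b) q) n @[n --> \oo] --> (0 : CC R).
  have H2 : series (pterm a q) n * series (pterm b q) n - series (pterm (pconv a b) q) n @[n --> \oo] -->
     peval a q * peval b q - peval (pconv a b) q by exact: (cvgCB (cvgCM cA cB) cC).
  apply/eqP; rewrite eq_sym -subr_eq0; apply/eqP.
  by apply: (cvg_unique _ H2 H); exact: norm_hausdorff.
have r01 : 0 <= cmod q / x < 1.
  by rewrite divr_ge0 ?cmod_ge0 ?(ltW x0)//= ltr_pdivrMr// mul1r.
apply: (@cvgC_squeeze _ _ _ _ _ _ (fun n => A * B * (cmod q / x) ^+ n)); last exact: cvg_pow0.
move=> n; rewrite sub0r cmodN.
set P := \poly_(i < n) a i; set Q := \poly_(i < n) b i.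
have eA : series (pterm a q) n = P.[q] by rewrite horner_poly /series /= big_mkord.
have eB : series (pterm b q) n = Q.[q] by rewrite horner_poly /series /= big_mkord.
have -> : series (pterm a q) n * series (pterm b q) n - series (pterm (pconv a b) q) n =
   \sum_(n <= k < n + size (P * Q)) (P * Q)`_k * q ^+ k.
  rewrite eA eB -hornerM (@horner_coef_wide _ (n + size (P * Q)%R)%N) ?leq_addl//.
  rewrite -(big_mkord xpredT (fun i => (P * Q)`_i * q ^+ i)) (@big_cat_nat _ _ _ n)//= ?leq_addr//.
  have -> : series (pterm (pconv a b) q) n = \sum_(0 <= i < n) (P * Q)`_i * q ^+ i.
    rewrite /series /= !big_nat; apply: eq_bigr => i /andP[_ iN].
    by rewrite /pterm -(poly_coef_conv _ _ iN).
  by rewrite addrAC subrr add0r.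
rewrite (le_trans (cmod_sum _ _ _))//.
set P' := \poly_(i < n) cmod (a i); set Q' := \poly_(i < n) cmod (b i).
have HPQ : (P' * Q').[x] <= A * B.
  by rewrite hornerM ler_pM ?horner_poly_cmod_ge0 ?horner_poly_bound ?(ltW x0).
rewrite [leRHS]mulrC; apply: le_trans (ler_wpM2l _ HPQ); last by rewrite exprn_ge0//; case/andP: r01.
have := horner_nonneg_ge (n + size (P * Q)) (ltW x0) (poly_cmod_conv_ge0 a b n).
rewrite (@big_cat_nat _ _ _ n)//= ?leq_addr// => H.
apply: (@le_trans _ _ ((cmod q / x) ^+ n * \sum_(n <= k < n + size (P * Q)) (P' * Q')`_k * x ^+ k)); last first.
  rewrite ler_wpM2l ?exprn_ge0//; first by case/andP: r01.
  apply: le_trans H; rewrite lerDr sumr_ge0// => k _.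
  by rewrite mulr_ge0 ?exprn_ge0 ?(ltW x0)// poly_cmod_conv_ge0.
rewrite mulr_sumr; apply: ler_sum_nat => k /andP[nk _].
rewrite cmodM cmodX mulrCA ler_pM ?cmod_ge0 ?exprn_ge0 ?cmod_ge0// ?poly_coef_cmod//.
by apply: ler_cmod_ratio => //; exact: ltW.
Qed.


Definition pone (k : nat) : CC R := (k == 0%N)%:R.

Lemma pbound_one x : pbound x 1 pone.
Proof.
case=> [|n]; first by rewrite big_nil.
rewrite big_nat_recl//= big1 => [|i _]; last by rewrite /pone /= cmod0 mul0r.
by rewrite /pone eqxx cmod1 expr0 mul1r addr0.
Qed.

Lemma peval_one q : peval pone q = 1.
Proof.
apply: cvg_lim; first exact: norm_hausdorff.
have E n : series (pterm pone q) n.+1 = 1.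
  rewrite /series /= big_nat_recl//= big1 => [|i _]; last by rewrite /pterm /pone /= mul0r.
  by rewrite /pterm /pone eqxx expr0 mul1r addr0.
rewrite -(cvg_shiftS (series (pterm pone q))).
under eq_fun do rewrite E; exact: cvgC_cst.
Qed.

Fixpoint ppartial (u : nat -> nat -> CC R) M : nat -> CC R :=
  if M is M'.+1 then pconv (ppartial u M') (u M') else pone.

Section InfiniteProduct.
Variable u : nat -> nat -> CC R.
Hypothesis u0 : forall n, u n 0 = 1.
Hypothesis uk : forall n k, (0 < k <= n)%N -> u n k = 0.
Hypothesis ub : forall x, 0 < x < 1 -> exists2 C : R, 0 <= C &
  forall n, pbound x (1 + C * x ^+ n) (u n).

(** Factor number [m] is [1 + O(q ^ (m + 1))], so factors from number [k] on leave the coefficient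
    of [q ^ k] alone. *)
Lemma ppartial_stable M k : (k <= M)%N -> ppartial u M k = ppartial u k k.
Proof.
move=> /subnK <-; elim: (M - k)%N => // d IH.
rewrite addSn /= /pconv big_ord_recr/= subnn u0 mulr1 big1 ?add0r// => i _.
by rewrite uk ?mulr0// subn_gt0 ltn_ord (leq_trans (leq_subr _ _))// leq_addl.
Qed.

Lemma prod_geo_le C x M : 0 <= C -> 0 < x < 1 ->
  \prod_(0 <= n < M) (1 + C * x ^+ n) <= expR (C / (1 - x)).
Proof.
move=> C0 /andP[x0 x1].
apply: (@le_trans _ _ (\prod_(0 <= n < M) expR (C * x ^+ n))).
  apply: ler_prod => i _; by rewrite expR_ge1Dx andbT addr_ge0// mulr_ge0// exprn_ge0// ltW.
rewrite -expR_sum ler_expR -mulr_sumr ler_wpM2l//.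
have H : (1 - x) * \sum_(0 <= i < M) x ^+ i = 1 - x ^+ M.
  by rewrite -[LHS]opprK -mulNr opprB big_mkord -subrX1 opprB.
by rewrite -[leRHS]mul1r ler_pdivlMr ?subr_gt0// mulrC H gerBl exprn_ge0// ltW.
Qed.

Lemma ppartial_pbound x : 0 < x < 1 -> exists B, forall M, pbound x B (ppartial u M).
Proof.
move=> /[dup] x01 /andP[x0 x1]; have [C C0 HC] := ub x01.
exists (expR (C / (1 - x))) => M.
have H : pbound x (\prod_(0 <= n < M) (1 + C * x ^+ n)) (ppartial u M).
  elim: M => [|M IH]; first by rewrite big_nil; exact: pbound_one.
  by rewrite big_nat_recr//=; apply: pbound_conv => //; exact: ltW.
by move=> n; apply: le_trans (prod_geo_le _ C0 x01).
Qed.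

(** The coefficients of the product are the stable ones, [ppartial u k k]. Norms of the partial
    products stay below [exp (C / (1 - x))], so they satisfy one common bound. *)
Lemma infinite_product_series : exists2 b, pbounded b & forall q, cmod q < 1 ->
  \prod_(0 <= n < M) peval (u n) q @[M --> \oo] --> peval b q.
Proof.
pose b k := ppartial u k k.
have Hb x B : (forall M, pbound x B (ppartial u M)) -> pbound x B b.
  move=> HB K; apply: le_trans (HB K K); rewrite !big_nat; apply: ler_sum => k /andP[_ kK].
  by rewrite /b (ppartial_stable (ltnW kK)).
have pb : pbounded b by move=> x /ppartial_pbound[B HB]; exists B; exact: Hb.
exists b => // q q1.
have [x /[dup] x01 /andP[x0 x1] qx] := mid_radius q1.
have [B HB] := ppartial_pbound x01.
have pu n : pbounded (u n).
  by move=> y /ub[C C0 HC]; exists (1 + C * y ^+ n).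
have pw M : pbounded (ppartial u M).
  elim: M => [|M IH] /=; first by move=> y _; exists 1; exact: pbound_one.
  exact: pbounded_conv.
have E M : \prod_(0 <= n < M) peval (u n) q = peval (ppartial u M) q.
  elim: M => [|M IH]; first by rewrite big_nil peval_one.
  by rewrite big_nat_recr//= IH peval_conv.
have r01 : 0 <= cmod q / x < 1.
  by rewrite divr_ge0 ?cmod_ge0 ?(ltW x0)//= ltr_pdivrMr// mul1r.
(* Below degree [M] the two series agree, so only the tail of the partial product has to be
   estimated. *)
have D M : cmod (peval (ppartial u M) q - series (pterm b q) M) <= B * (cmod q / x) ^+ M.
  have cM := pbounded_cvg (pw M) q1.
  apply: (cvgC_cmod_le (h := fun N => series (pterm (ppartial u M) q) (N + M)%N - series (pterm b q) M)).
    apply: cvgCB; last exact: cvgC_cst.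
    apply: (@cvg_comp _ _ _ (fun N => (N + M)%N) (series (pterm (ppartial u M) q)) _ _ _ _ cM).
    by move=> A [N _ HN]; exists N => // K /= NK; apply: HN => /=; rewrite (leq_trans NK)// leq_addr.
  move=> N.
  have -> : series (pterm (ppartial u M) q) (N + M)%N - series (pterm b q) M =
      \sum_(M <= k < N + M) ppartial u M k * q ^+ k.
    rewrite /series /= (@big_cat_nat _ _ _ M)//= ?leq_addl//.
    have -> : \sum_(0 <= k < M) pterm (ppartial u M) q k = \sum_(0 <= k < M) pterm b q k.
      rewrite !big_nat; apply: eq_bigr => k /andP[_ kM].
      by rewrite /pterm /b (ppartial_stable (ltnW kM)).
    by rewrite addrAC subrr add0r.
  rewrite (le_trans (cmod_sum _ _ _))//.
  have := HB M (N + M)%N; rewrite (@big_cat_nat _ _ _ M)//= ?leq_addl// => H.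
  rewrite [leRHS]mulrC; apply: (@le_trans _ _ ((cmod q / x) ^+ M * \sum_(M <= k < N + M) cmod (ppartial u M k) * x ^+ k)).
    rewrite mulr_sumr; apply: ler_sum_nat => k /andP[nk _].
    rewrite cmodM cmodX mulrCA ler_wpM2l ?cmod_ge0//.
    by apply: ler_cmod_ratio => //; exact: ltW.
  rewrite ler_wpM2l ?exprn_ge0//; first by case/andP: r01.
  apply: le_trans H; rewrite lerDr sumr_ge0// => k _.
  by rewrite mulr_ge0 ?cmod_ge0 ?exprn_ge0 ?(ltW x0).
under eq_fun do rewrite E.
have c1 : peval (ppartial u M) q - series (pterm b q) M @[M --> \oo] --> (0 : CC R).
  apply: (@cvgC_squeeze _ _ _ _ _ _ (fun n => B * (cmod q / x) ^+ n)); last exact: cvg_pow0.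
  by move=> M; rewrite sub0r cmodN.
have c2 := pbounded_cvg pb q1.
have : (peval (ppartial u M) q - series (pterm b q) M) + series (pterm b q) M @[M --> \oo] --> 0 + peval b q.
  exact: (cvgCD c1 c2).
by rewrite add0r; under eq_fun do rewrite subrK.
Qed.

End InfiniteProduct.

End PowerSeries.

(** * Functions given by power series; infinite products and their inverses *)

Section PowerSeriesFunctions.
Context {R : realType}.
Implicit Types (a b : nat -> CC R) (q g : CC R) (x B : R).

Definition PS (f : CC R -> CC R) := exists2 a : nat -> CC R, pbounded a &
  forall q, cmod q < 1 -> f q = peval a q.

Lemma pbound_add x A B a b : 0 <= x -> pbound x A a -> pbound x B b ->
  pbound x (A + B) (fun k => a k + b k).
Proof.
move=> x0 HA HB n; apply: le_trans (lerD (HA n) (HB n)); rewrite -big_split /=.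
by apply: ler_sum => k _; rewrite -mulrDl ler_wpM2r ?exprn_ge0// cmodD.
Qed.

Lemma pbounded_add a b : pbounded a -> pbounded b -> pbounded (fun k => a k + b k).
Proof.
move=> Ha Hb x /[dup] x01 /andP[x0 _]; have [A HA] := Ha x x01; have [B HB] := Hb x x01.
by exists (A + B); apply: pbound_add => //; exact: ltW.
Qed.

Lemma peval_add a b q : pbounded a -> pbounded b -> cmod q < 1 ->
  peval (fun k => a k + b k) q = peval a q + peval b q.
Proof.
move=> Ha Hb q1; apply: cvg_lim; first exact: norm_hausdorff.
have -> : series (pterm (fun k => a k + b k) q) = (fun n => series (pterm a q) n + series (pterm b q) n).
  by apply/funext => n; rewrite /series /= -big_split; apply: eq_bigr => k _; rewrite /pterm mulrDl.
exact: (cvgCD (pbounded_cvg Ha q1) (pbounded_cvg Hb q1)).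
Qed.

Lemma PS_add f h : PS f -> PS h -> PS (fun q => f q + h q).
Proof.
move=> [a Ha fa] [b Hb hb]; exists (fun k => a k + b k); first exact: pbounded_add.
by move=> q q1; rewrite peval_add// fa// hb.
Qed.

Lemma PS_mul f h : PS f -> PS h -> PS (fun q => f q * h q).
Proof.
move=> [a Ha fa] [b Hb hb]; exists (pconv a b); first exact: pbounded_conv.
by move=> q q1; rewrite peval_conv// fa// hb.
Qed.

Definition pmono (c : CC R) (e k : nat) : CC R := c * (k == e)%:R.

Lemma pbound_mono c e x : 0 <= x -> pbound x (cmod c * x ^+ e) (pmono c e).
Proof.
move=> x0 n; have [en|en] := ltnP e n.
  rewrite (bigD1_seq e) ?mem_index_iota ?iota_uniq//= big1 => [|i ie].
    by rewrite /pmono eqxx mulr1 addr0.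
  by rewrite /pmono (negbTE ie) mulr0 cmod0 mul0r.
rewrite big_nat big1 ?mulr_ge0 ?cmod_ge0 ?exprn_ge0// => i /andP[_ iN].
by rewrite /pmono (ltn_eqF (leq_trans iN en)) mulr0 cmod0 mul0r.
Qed.

Lemma pbounded_mono c e : pbounded (pmono c e).
Proof. by move=> x /andP[/ltW x0 _]; exists (cmod c * x ^+ e); exact: pbound_mono. Qed.

Lemma peval_mono c e q : peval (pmono c e) q = c * q ^+ e.
Proof.
apply: cvg_lim; first exact: norm_hausdorff.
rewrite -(cvg_shiftn e.+1 (series (pterm (pmono c e) q))).
have E n : series (pterm (pmono c e) q) (n + e.+1)%N = c * q ^+ e.
  rewrite /series /= (bigD1_seq e) ?mem_index_iota ?iota_uniq ?leq_addl//= big1 => [|i ie].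
    by rewrite /pterm /pmono eqxx mulr1 addr0.
  by rewrite /pterm /pmono (negbTE ie) mulr0 mul0r.
by under eq_fun do rewrite E; exact: cvgC_cst.
Qed.

Lemma PS_monomial c e : PS (fun q => c * q ^+ e).
Proof. by exists (pmono c e) => [|q _]; rewrite ?peval_mono//; exact: pbounded_mono. Qed.

Lemma PS_eq f h : (forall q, cmod q < 1 -> f q = h q) -> PS f -> PS h.
Proof. by move=> E [a Ha fa]; exists a => // q q1; rewrite -E// fa. Qed.

Lemma PS_cst c : PS (fun=> c).
Proof. by apply: PS_eq (PS_monomial c 0) => q _; rewrite expr0 mulr1. Qed.

(** The coefficients of the geometric series [1 / (1 - g q ^ e)]. *)
Definition pinv g (e k : nat) : CC R := if (e %| k)%N then g ^+ (k %/ e) else 0.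

Lemma pinv_rec g e k : (0 < e)%N ->
  pinv g e k = (k == 0%N)%:R + (if (e <= k)%N then g * pinv g e (k - e)%N else 0).
Proof.
move=> e0; rewrite /pinv; case: (leqP e k) => ek.
  rewrite gtn_eqF ?(leq_trans e0)// add0r.
  have -> : (e %| k - e)%N = (e %| k)%N by rewrite -{2}(subnK ek) dvdn_addl.
  case: ifP => [dk|]; last by rewrite mulr0.
  rewrite -exprS; congr (_ ^+ _).
  by rewrite -{1}(subnK ek) divnDr// divnn e0 addn1.
case: k ek => [|k] ek; first by rewrite dvdn0 div0n expr0 addr0.
by rewrite gtnNdvd// addr0.
Qed.

(** The partial norms satisfy [S <= 1 + x ^ e S], hence [S <= 1 / (1 - x)]; reinserting this bound
    on the right produces the factor [x ^ e] that the infinite product requires. *)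
Lemma pbound_inv g e x : (0 < e)%N -> 0 < x < 1 -> cmod g <= 1 ->
  pbound x (1 + (1 - x)^-1 * x ^+ e) (pinv g e).
Proof.
move=> e0 /andP[x0 x1] g1 n; set S := BIG_F; pose SS m := \sum_(0 <= k < m) cmod (pinv g e k) * x ^+ k.
have rec m : SS m <= 1 + x ^+ e * SS m.
  have t0 k : 0 <= cmod (pinv g e k) * x ^+ k by rewrite mulr_ge0 ?cmod_ge0// exprn_ge0// ltW.
  have [me|em] := leqP m e.
    apply: (@le_trans _ _ 1); last by rewrite lerDl mulr_ge0 ?exprn_ge0 ?(ltW x0)// sumr_ge0.
    case: m me => [|m] me; first by rewrite /SS big_nil.
    rewrite /SS big_nat_recl// big_nat big1 => [|i /andP[_ im]].
      by rewrite /pinv dvdn0 div0n expr0 cmod1 expr0 mulr1 addr0.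
    by rewrite /pinv gtnNdvd// ?cmod0 ?mul0r// (leq_trans _ me).
  rewrite {1}/SS (@big_cat_nat _ _ _ e)//=; last exact: ltnW.
  apply: lerD.
    have := t0 0%N => _; rewrite -(prednK e0) big_nat_recl// big_nat big1 => [|i /andP[_ im]].
      by rewrite /pinv dvdn0 div0n expr0 cmod1 expr0 mulr1 addr0.
    by rewrite /pinv gtnNdvd// ?cmod0 ?mul0r// -(prednK e0).
  rewrite -{1}[e]add0n -{1}(subnK (ltnW em)) big_addn addnK.
  apply: (@le_trans _ _ (x ^+ e * \sum_(0 <= k < m - e) cmod (pinv g e k) * x ^+ k)).
    rewrite mulr_sumr; apply: ler_sum => k _.
    rewrite pinv_rec// addnK leq_addl addn_eq0 (gtn_eqF e0) andbF add0r cmodM exprD.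
    have -> : x ^+ e * (cmod (pinv g e k) * x ^+ k) = cmod (pinv g e k) * (x ^+ k * x ^+ e) by ring.
    by rewrite -mulrA ler_piMl// !mulr_ge0 ?exprn_ge0 ?cmod_ge0 ?(ltW x0).
  rewrite ler_wpM2l ?exprn_ge0 ?(ltW x0)// [leRHS]/SS (@big_cat_nat _ _ _ (m - e) 0 m)//= ?leq_subr//.
  by rewrite lerDl sumr_ge0.
have xe : x ^+ e <= x by rewrite -{2}(expr1 x) ler_wiXn2l// ?ltW.
have S0 : 0 <= SS n by rewrite sumr_ge0// => k _; rewrite mulr_ge0 ?cmod_ge0// exprn_ge0// ltW.
have H : SS n <= (1 - x)^-1.
  by rewrite -[leRHS]mul1r ler_pdivlMr ?subr_gt0//; have := rec n; nra.
by apply: (le_trans (rec n)); rewrite lerD2l mulrC ler_wpM2r// exprn_ge0// ltW.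
Qed.

Lemma pconv_factor_inv g e : (0 < e)%N ->
  pconv (fun k => pone k + pmono (- g) e k) (pinv g e) = pone.
Proof.
move=> e0; apply/funext => k; rewrite /pconv.
have -> : \sum_(i < k.+1) (pone i + pmono (- g) e i) * pinv g e (k - i) =
   pinv g e k - (if (e <= k)%N then g * pinv g e (k - e)%N else 0).
  under eq_bigr do rewrite mulrDl; rewrite big_split /=; congr (_ + _).
    rewrite big_ord_recl/= big1 => [|i _]; last by rewrite /pone /= mul0r.
    by rewrite /pone eqxx mul1r subn0 addr0.
  case: leqP => ek.
    rewrite (bigD1 (Ordinal (ek : (e < k.+1)%N)))//= big1 => [|i ie].
      by rewrite /pmono eqxx mulr1 mulNr addr0.
    by rewrite /pmono (_ : (i == e :> nat) = false) ?mulr0 ?mul0r//; apply/negbTE; apply: contraNneq ie => ie; apply/eqP/val_inj.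
  rewrite big1 ?oppr0// => i _; rewrite /pmono (_ : (i == e :> nat) = false) ?mulr0 ?mul0r//.
  by apply/ltn_eqF; rewrite (leq_ltn_trans _ ek)// -ltnS.
by rewrite pinv_rec// addrK.
Qed.

Section EulerProduct.
Variables (al be : CC R) (a b : nat).
Hypotheses (al1 : cmod al <= 1) (be1 : cmod be <= 1) (a0 : (0 < a)%N) (b0 : (0 < b)%N).

(** Factor [n] of the product is [1 - g n * q ^ (e n)]; since [n < e n], the coefficients stabilize
    as required by [infinite_product_series]. *)
Let g n := al * be ^+ n.
Let e n := (a + b * n)%N.

Let g1 n : cmod (g n) <= 1.
Proof. by rewrite cmodM cmodX mulr_ile1 ?cmod_ge0 ?exprn_ge0 ?cmod_ge0// exprn_ile1 ?cmod_ge0. Qed.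
Let e_gt n : (n < e n)%N.
Proof. by rewrite /e; nia. Qed.
Let e0 n : (0 < e n)%N.
Proof. exact: leq_ltn_trans (e_gt n). Qed.

Let fac n k := pone k + pmono (- g n) (e n) k.
Let facP n q : cmod q < 1 -> peval (fac n) q = 1 - al * q ^+ a * (be * q ^+ b) ^+ n.
Proof.
move=> q1; rewrite peval_add// ?peval_one ?peval_mono.
- by rewrite /g /e exprMn exprD exprM; ring.
- by move=> x _; exists 1; exact: pbound_one.
- exact: pbounded_mono.
Qed.
Let xe n x : 0 < x < 1 -> x ^+ e n <= x ^+ n.
Proof. by move=> /andP[x0 x1]; rewrite ler_wiXn2l// ?ltW// ltnW. Qed.
Let fac_bound n x : 0 < x < 1 -> pbound x (1 + 1 * x ^+ n) (fac n).
Proof.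
move=> x01; have /andP[x0 x1] := x01 => N.
apply: le_trans (pbound_add (ltW x0) (pbound_one x) (pbound_mono (- g n) (e n) (ltW x0)) N) _.
by rewrite lerD2l cmodN ler_pM ?cmod_ge0 ?exprn_ge0 ?(ltW x0)// xe.
Qed.
Let fac_pb n : pbounded (fac n).
Proof. by move=> x x01; exists (1 + 1 * x ^+ n); exact: fac_bound. Qed.
Let inv_pb n : pbounded (pinv (g n) (e n)).
Proof. by move=> x x01; eexists; apply: pbound_inv. Qed.

Let invK n q : cmod q < 1 -> peval (fac n) q * peval (pinv (g n) (e n)) q = 1.
Proof. by move=> q1; rewrite -peval_conv// pconv_factor_inv// peval_one. Qed.

Let invP n q : cmod q < 1 ->
  peval (pinv (g n) (e n)) q = (1 - al * q ^+ a * (be * q ^+ b) ^+ n)^-1.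
Proof.
move=> q1; have H := invK n q1; rewrite facP// in H.
have nz : 1 - al * q ^+ a * (be * q ^+ b) ^+ n != 0.
  by apply: contraPneq H => ->; rewrite mul0r => /eqP; rewrite eq_sym oner_eq0.
by apply: (mulfI nz); rewrite H divff.
Qed.

(** The inverse is built as the product of the geometric series of the factors. That its product
    with the original is 1 in the limit also yields nonvanishing. *)
Lemma qpoch_series : [/\ PS (fun q => qpoch (al * q ^+ a) (be * q ^+ b)),
  PS (fun q => (qpoch (al * q ^+ a) (be * q ^+ b))^-1) &
  forall q, cmod q < 1 -> qpoch (al * q ^+ a) (be * q ^+ b) != 0 /\
   \prod_(0 <= n < N) (1 - al * q ^+ a * (be * q ^+ b) ^+ n) @[N --> \oo] -->
     qpoch (al * q ^+ a) (be * q ^+ b)].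
Proof.
have [|||F FP HF] := @infinite_product_series R fac.
- by move=> n; rewrite /fac /pone /pmono eqxx (ltn_eqF (e0 n)) mulr0 addr0.
- move=> n k /andP[k0 kn]; rewrite /fac /pone /pmono (gtn_eqF k0) (ltn_eqF (leq_ltn_trans kn (e_gt n))).
  by rewrite mulr0 addr0.
- by move=> x x01; exists 1 => // n; exact: fac_bound.
have [|||G GP HG] := @infinite_product_series R (fun n => pinv (g n) (e n)).
- by move=> n; rewrite /pinv dvdn0 div0n.
- move=> n k /andP[k0 kn]; rewrite /pinv gtnNdvd//; exact: leq_ltn_trans kn (e_gt n).
- move=> x /[dup] x01 /andP[x0 x1]; exists (1 - x)^-1; first by rewrite invr_ge0 subr_ge0 ltW.
  move=> n N; apply: (le_trans (pbound_inv (e0 n) x01 (g1 n) N)).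
  by rewrite lerD2l ler_wpM2l ?xe// invr_ge0 subr_ge0 ltW.
have cF q : cmod q < 1 -> \prod_(0 <= n < N) (1 - al * q ^+ a * (be * q ^+ b) ^+ n) @[N --> \oo] --> peval F q.
  move=> q1; have := HF q q1; under eq_fun do under eq_bigr do rewrite facP//.
  by [].
have qF q : cmod q < 1 -> qpoch (al * q ^+ a) (be * q ^+ b) = peval F q.
  by move=> q1; apply: cvg_lim; [exact: norm_hausdorff | exact: cF].
have FG q : cmod q < 1 -> peval F q * peval G q = 1.
  move=> q1; have H := cvgCM (cF q q1) (HG q q1).
  have E1 : (fun N => (\prod_(0 <= n < N) (1 - al * q ^+ a * (be * q ^+ b) ^+ n)) *
     \prod_(0 <= n < N) peval (pinv (g n) (e n)) q) = (fun=> 1).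
    apply/funext => N; rewrite -big_split big1//= => n _.
    by rewrite invP// -facP// divff//; apply/eqP => z0; have := invK n q1; rewrite z0 mul0r => /eqP; rewrite eq_sym oner_eq0.
  have H1 : (fun=> 1 : CC R) x @[x --> \oo] --> peval F q * peval G q by rewrite -E1; exact: H.
  exact: cvgC_unique H1 (@cvgC_cst R nat \oo _ 1).
have qn0 q : cmod q < 1 -> qpoch (al * q ^+ a) (be * q ^+ b) != 0.
  by move=> q1; rewrite qF//; apply: contraPneq (FG q q1) => ->; rewrite mul0r => /eqP; rewrite eq_sym oner_eq0.
split.
- by exists F.
- by exists G => // q q1; apply: (mulfI (qn0 q q1)); rewrite divff ?qn0// qF// FG.
- by move=> q q1; split; [exact: qn0 | rewrite qF//; exact: cF].
Qed.

End EulerProduct.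

End PowerSeriesFunctions.

(** * The Jacobi triple product identity *)

Section JacobiTripleProduct.
Context {R : realType}.
Implicit Types (P z zeta : CC R) (n k : int).

Lemma zsum_tail C (f : int -> CC R) M : zbound C f ->
  cmod (zsum f - Zsum f M) <= 4 * C / 2 ^+ M.
Proof.
move=> H; have C0 := zbound_ge0 H.
have c1 := cvg_Zsum (ex_intro _ C H).
apply: (cvgC_cmod_le (h := fun N => Zsum f (N + M)%N - Zsum f M)).
  apply: cvgCB; last exact: cvgC_cst.
  apply: (@cvg_comp _ _ _ (fun N => (N + M)%N) (Zsum f) _ _ _ _ c1).
  by move=> A [N _ HN]; exists N => // K /= NK; apply: HN => /=; rewrite (leq_trans NK)// leq_addr.
move=> N; have -> : Zsum f (N + M)%N - Zsum f M = \sum_(M <= k < N + M) (f k%:Z + f (- k.+1%:Z)).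
  by rewrite /Zsum (@big_cat_nat _ _ _ M 0 (N + M)%N)//= ?leq_addl// addrAC subrr add0r.
rewrite (le_trans (cmod_sum _ _ _))//.
apply: (@le_trans _ _ (\sum_(M <= k < N + M) (2 * C / 2 ^+ k))).
  by apply: ler_sum => k _; exact: zbound_pair.
have -> : \sum_(M <= k < N + M) (2 * C / 2 ^+ k) = 4 * C / 2 ^+ M - 4 * C / 2 ^+ (N + M)%N.
  elim: N => [|N IH]; first by rewrite big_geq// subrr.
  by rewrite addSn big_nat_recr ?leq_addl//= IH exprS; field; rewrite !expf_neq0.
by rewrite gerBl divr_ge0 ?exprn_ge0// mulr_ge0.
Qed.

Lemma zsum_tannery (f : nat -> int -> CC R) C : (forall M, zbound C (f M)) ->
  (forall n, f M n @[M --> \oo] --> (0 : CC R)) -> zsum (f M) @[M --> \oo] --> (0 : CC R).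
Proof.
move=> H Hc; have C0 := zbound_ge0 (H 0%N).
have h1 : \sum_(0 <= n < M) (cmod (f M n%:Z) + cmod (f M (- n.+1%:Z))) @[M --> \oo] --> (0 : R).
  have T := @tannery R (fun M (n : nat) => cmod (f M n%:Z) + cmod (f M (- n.+1%:Z))) (fun n : nat => 2 * C / 2 ^+ n) (fun M => M).
  apply: T.
  - move=> M n _; rewrite addr_ge0 ?cmod_ge0//=.
    have a1 := H M n%:Z; have a2 := H M (- n.+1%:Z); rewrite abszN in a2.
    have i3 : (2 ^+ n.+1)^-1 <= (2 ^+ n)^-1 :> R.
      by rewrite lef_pV2 ?posrE ?exprn_gt0// ler_weXn2l// ler1n.
    rewrite /= in a1 a2; have := ler_wpM2l C0 i3.
    set q1 := (2 ^+ n)^-1 in a1 *; set q2 := (2 ^+ n.+1)^-1 in a2 *; lra.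
  - by move=> n; rewrite divr_ge0 ?mulr_ge0 ?exprn_ge0.
  - exact: cvg_half_series.
  - by move=> n; rewrite -[X in _ --> X]addr0; apply: cvgD; apply: cvg_cmod0; exact: Hc.
apply: (@cvgC_squeeze _ _ _ _ _ _ (fun M => 4 * C * (1 / 2) ^+ M + \sum_(0 <= n < M) (cmod (f M n%:Z) + cmod (f M (- n.+1%:Z))))).
  move=> M; rewrite sub0r cmodN -[zsum _](subrK (Zsum (f M) M)) (le_trans (cmodD _ _))// lerD//.
    by have := zsum_tail M (H M); rewrite div1r exprVn.
  by rewrite (le_trans (cmod_sum _ _ _))//; apply: ler_sum => n _; exact: cmodD.
rewrite -[X in _ --> X]addr0; apply: cvgD => //; apply: cvg_pow0; lra.
Qed.

Lemma tht_succ P z n : tht P z (n + 1) = ee (n%:~R * P + P / 2 + z) * tht P z n.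
Proof. by rewrite /tht -eeD intrD; congr ee; field. Qed.

Section Product.
Variables (P zeta : CC R).
Hypothesis P0 : 0 < imag P.
Let p := ee P.
(** With [x = ee zeta], this choice makes [t n] equal to [(-1) ^ n p ^ (n (n - 1) / 2) x ^ n], the
    usual term of the triple product. *)
Let z := zeta - P / 2 + 1 / 2.
Let t := tht P z.
Hypothesis cvg_x : \prod_(0 <= n < N) (1 - ee zeta * p ^+ n) @[N --> \oo] --> qpoch (ee zeta) p.
Hypothesis cvg_y : \prod_(0 <= n < N) (1 - ee (P - zeta) * p ^+ n) @[N --> \oo] --> qpoch (ee (P - zeta)) p.
Hypothesis cvg_p : \prod_(0 <= n < N) (1 - p * p ^+ n) @[N --> \oo] --> qpoch p p.
Hypothesis pp0 : qpoch p p != 0.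

Let pf M := \prod_(0 <= n < M) (1 - p * p ^+ n).
(** [1 / (p; p)_k], extended by zero to negative [k] so that the recurrence [r_pred] holds for all
    integers. *)
Let r k : CC R := if k is Posz m then (pf m)^-1 else 0.

Let p_lt1 : cmod p < 1.
Proof. by rewrite cmod_ee expR_lt1 oppr_lt0 !mulr_gt0 ?pi_gt0. Qed.

Let fac_neq0 m : 1 - p * p ^+ m != 0.
Proof.
rewrite -exprS; apply: contraTneq p_lt1 => /eqP; rewrite subr_eq0 => /eqP E.
rewrite -leNgt; have := congr1 cmod E; rewrite cmod1 cmodX => E1.
rewrite leNgt; apply/negP => H; have := exprn_ilt1 m.+1 (cmod_ge0 p) H.
by rewrite -E1 ltxx.
Qed.

Let r_pred k : r (k - 1) = (1 - ee (k%:~R * P)) * r k.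
Proof.
case: k => [[|m]|m].
- by rewrite mul0r ee0 subrr mul0r.
- have -> : (m.+1%:Z - 1 = m%:Z)%R by lia.
  rewrite /r /pf big_nat_recr//= invfM mulrCA.
  have -> : ee (m.+1%:~R * P) = p * p ^+ m by rewrite /p -exprS eeX.
  by rewrite divff ?mulr1// fac_neq0.
- have -> : (Negz m - 1 = Negz m.+1)%R by lia.
  by rewrite /r mulr0.
Qed.

(** The Gaussian binomial coefficient of [2 M] over [M + n] in base [p]; it vanishes for
    [|n| > M]. *)
Let c M n := pf M.*2 * r (M%:Z + n) * r (M%:Z - n).

(** The recurrence matches multiplication by [(1 - x p ^ M) (1 - p ^ (M + 1) / x)]. In terms of
    [u = p ^ (M + 1 + n)] and [v = p ^ (M + 1 - n)] it is a rational identity. *)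
Let cS M n : c M.+1 n = (1 + ee ((M.*2.+1)%:R * P)) * c M n +
   ee ((M%:Z - n + 1)%:~R * P) * c M (n - 1) + ee ((M%:Z + n + 1)%:~R * P) * c M (n + 1).
Proof.
set A := r (M.+1%:Z + n); set B := r (M.+1%:Z - n).
pose u := ee ((M.+1%:Z + n)%:~R * P); pose v := ee ((M.+1%:Z - n)%:~R * P).
have pn0 : p != 0 := ee_neq0 _.
have e1 : r (M%:Z + n) = (1 - u) * A.
  by rewrite -r_pred; congr r; lia.
have e2 : r (M%:Z - n) = (1 - v) * B.
  by rewrite -r_pred; congr r; lia.
have up : ee ((M%:Z + n)%:~R * P) = u / p.
  by rewrite /u /p -eeB; congr ee; rewrite !intrD -!pmulrn -natr1; ring.
have vp : ee ((M%:Z - n)%:~R * P) = v / p.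
  by rewrite /v /p -eeB; congr ee; rewrite !intrD -!pmulrn -natr1; ring.
have e3 : r (M%:Z + (n - 1)) = (1 - u / p) * ((1 - u) * A).
  by rewrite -e1 -up -r_pred; congr r; lia.
have e4 : r (M%:Z - (n + 1)) = (1 - v / p) * ((1 - v) * B).
  by rewrite -e2 -vp -r_pred; congr r; lia.
have e5 : r (M%:Z - (n - 1)) = B by congr r; lia.
have e6 : r (M%:Z + (n + 1)) = A by congr r; lia.
have uv : ee ((M.*2.+1)%:R * P) = u * v / p.
  rewrite /u /v /p -eeD -eeB; congr ee; rewrite !intrD intrN -!pmulrn -addnn -!natr1 natrD; ring.
have e7 : ee ((M%:Z - n + 1)%:~R * P) = v.
  by rewrite /v; have -> : (M%:Z - n + 1 = M.+1%:Z - n)%R by lia.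
have e8 : ee ((M%:Z + n + 1)%:~R * P) = u.
  by rewrite /u; have -> : (M%:Z + n + 1 = M.+1%:Z + n)%R by lia.
have e9 : pf M.+1.*2 = pf M.*2 * (1 - u * v / p) * (1 - u * v).
  rewrite /pf doubleS !big_nat_recr//= -!exprS /p !eeX -/p uv; congr (_ * _ * (1 - _)).
  rewrite -natr1 mulrDl mul1r eeD uv -/p; field; exact: pn0.
by rewrite /c e1 e2 e3 e4 e5 e6 uv e7 e8 e9 -/A -/B; field.
Qed.

Let pf_cvg (h : nat -> nat) : (forall N, \forall n \near \oo, (N <= h n)%N) ->
  pf (h n) @[n --> \oo] --> qpoch p p.
Proof.
move=> Hh; apply: (@cvg_comp _ _ _ h pf _ _ _ _ cvg_p).
move=> A [N _ HN]; have := Hh N; apply: filterS => n Nn; exact: HN.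
Qed.

Let c_bounded : exists2 B, 0 <= B & forall M n, cmod (c M n) <= B.
Proof.
have [A A0 HA] := cvgC_bounded cvg_p.
have [B B0 HB] := cvgC_bounded (cvgCV cvg_p pp0).
have rB k : cmod (r k) <= B.
  by case: k => [m|m]; [exact: HB | rewrite /r cmod0].
exists (A * B * B) => [|M n]; first by rewrite !mulr_ge0.
by rewrite /c !cmodM !ler_pM ?mulr_ge0 ?cmod_ge0//; exact: HA.
Qed.

Let r_cvg n : r (M%:Z + n) @[M --> \oo] --> (qpoch p p)^-1.
Proof.
have H : (fun M => (pf (absz ((M + absz n)%N%:Z + n)))^-1) M @[M --> \oo] --> (qpoch p p)^-1.
  have H : pf (absz ((M + absz n)%N%:Z + n)) @[M --> \oo] --> qpoch p p.
    by apply: pf_cvg => N; exists N => // K /= NK; lia.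
  exact: (cvgCV H pp0).
rewrite -(cvg_shiftn (absz n)).
have -> : (fun M => r ((M + absz n)%N%:Z + n)) = (fun M => (pf (absz ((M + absz n)%N%:Z + n)))^-1).
  by apply/funext => M; rewrite -[in LHS](@gez0_abs ((M + absz n)%N%:Z + n))//; lia.
exact: H.
Qed.

Let c_cvg n : c M n @[M --> \oo] --> (qpoch p p)^-1.
Proof.
have -> : (qpoch p p)^-1 = qpoch p p * (qpoch p p)^-1 * (qpoch p p)^-1 by rewrite divff// mul1r.
apply: cvgCM; last exact: r_cvg.
apply: cvgCM; last exact: r_cvg.
by apply: pf_cvg => N; exists N => // K /= NK; lia.
Qed.

Let t_zgeo : zgeo t.
Proof. exact: tht_zgeo. Qed.

Let ct_zgeo M : zgeo (fun n => c M n * t n).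
Proof.
have [B B0 HB] := c_bounded; have [C HC] := t_zgeo; exists (B * C) => n.
by rewrite cmodM -mulrA ler_pM ?cmod_ge0.
Qed.

(** The finite triple product, a form of the q-binomial theorem. Its right-hand side has finite
    support; as a sum over all integers it is ready for dominated convergence. *)
Let finite_JTP M :
  (\prod_(0 <= n < M) (1 - ee zeta * p ^+ n)) * (\prod_(0 <= n < M) (1 - ee (P - zeta) * p ^+ n)) =
  zsum (fun n => c M n * t n).
Proof.
elim: M => [|M IH].
  rewrite !big_nil mulr1; apply/esym/zsum_unique.
  rewrite -(cvg_shiftS (Zsum (fun n => c 0 n * t n))).
  have c0 n : n != 0 -> c 0 n * t n = 0.
    move=> n0; rewrite /c add0r sub0r.
    case: n n0 => [[//|m]|m] _; last by rewrite /= mulr0 !mul0r.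
    by have -> : (- m.+1%:Z = Negz m)%R by []; rewrite /= mulr0 mul0r.
  have c00 : c 0 0 * t 0 = 1.
    have -> : c 0 0 = 1 by rewrite /c /r /pf /= big_nil invr1 !mulr1.
    by rewrite mul1r /t /tht expr0n /= mulr0 mul0r addr0 ee0.
  have -> : (fun K : nat => Zsum (fun n => c 0 n * t n) K.+1) = (fun=> 1).
    apply/funext; elim => [|K IH]; first by rewrite ZsumS Zsum0 add0r c00 c0// addr0.
    by rewrite ZsumS IH !c0// !addr0.
  exact: cvgC_cst.
rewrite !big_nat_recr//= mulrACA IH.
set f := fun n => c M n * t n.
have Hf : zgeo f := ct_zgeo M.
have Hf1 : zgeo (fun n => f (n + 1)) := zgeoS Hf.
have Hf2 : zgeo (fun n => f (n - 1)).
  have := zgeoN (zgeoS (zgeoN Hf)); congr zgeo; apply/funext => n; congr f; lia.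
have -> : (fun n => c M.+1 n * t n) = (fun n => (1 + ee ((M.*2.+1)%:R * P)) * f n +
   ((- (ee zeta * p ^+ M)) * f (n - 1) + (- (ee (P - zeta) * p ^+ M)) * f (n + 1))).
  apply/funext => n; rewrite cS /f.
  have E1 : t n = - ee ((n - 1)%:~R * P + zeta) * t (n - 1).
    rewrite -{1}(subrK 1 n) /t tht_succ -/t; congr (_ * _).
    have -> : (n - 1)%:~R * P + P / 2 + z = (n - 1)%:~R * P + zeta + 1 / 2 by rewrite /z; field.
    by rewrite eeD ee_half mulrN1.
  have E2 : t (n + 1) = - ee (n%:~R * P + zeta) * t n.
    rewrite /t tht_succ -/t; congr (_ * _).
    have -> : n%:~R * P + P / 2 + z = n%:~R * P + zeta + 1 / 2 by rewrite /z; field.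
    by rewrite eeD ee_half mulrN1.
  rewrite !mulrDl -addrA; congr (_ + _); first by ring.
  congr (_ + _).
    have F : ee zeta * p ^+ M = ee ((M%:Z - n + 1)%:~R * P) * ee ((n - 1)%:~R * P + zeta).
      by rewrite /p eeX -!eeD; congr ee; rewrite !intrD !intrN -!pmulrn; ring.
    by rewrite E1 F; ring.
  have F : ee ((M%:Z + n + 1)%:~R * P) = ee (P - zeta) * p ^+ M * ee (n%:~R * P + zeta).
    by rewrite /p eeX -!eeD; congr ee; rewrite !intrD -!pmulrn; ring.
  by rewrite E2 F; ring.
rewrite zsumD//; [|exact: zgeoM|by apply: zgeoD; exact: zgeoM].
rewrite zsumD; [|exact: zgeoM|exact: zgeoM].
rewrite !zsumM//.
have -> : zsum (fun n => f (n - 1)) = zsum f.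
  rewrite -[LHS]zsumS//; congr zsum; apply/funext => n; by rewrite addrK.
rewrite zsumS//.
have -> : ee ((M.*2.+1)%:R * P) = ee zeta * p ^+ M * (ee (P - zeta) * p ^+ M).
  rewrite /p eeX -!eeD; congr ee; rewrite -addnn -natr1 natrD; ring.
ring.
Qed.

(** For fixed [n] the coefficients [c M n] tend to [1 / (p; p)_oo], and they are bounded uniformly
    in [M] and [n]. *)
Lemma jacobi_triple_product :
  qpoch (ee zeta) p * qpoch (ee (P - zeta)) p * qpoch p p = zsum t.
Proof.
have H1 := cvgCM cvg_x cvg_y.
have H2 : zsum (fun n => c M n * t n) @[M --> \oo] --> qpoch (ee zeta) p * qpoch (ee (P - zeta)) p.
  by under eq_fun do rewrite -finite_JTP; exact: H1.
have [B B0 HB] := c_bounded; have [C HC] := t_zgeo.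
have H3 : zsum (fun n => (c M n - (qpoch p p)^-1) * t n) @[M --> \oo] --> (0 : CC R).
  apply: (@zsum_tannery _ ((B + cmod (qpoch p p)^-1) * C)).
    move=> M n; rewrite cmodM -mulrA ler_pM ?cmod_ge0//.
    by rewrite (le_trans (cmodB _ _))// lerD2r.
  move=> n; rewrite -[X in _ --> X](mul0r (t n)) -(subrr (qpoch p p)^-1).
  exact: (cvgCM (cvgCB (@c_cvg n) (@cvgC_cst R nat \oo _ _)) (@cvgC_cst R nat \oo _ _)).
have E : (fun M => zsum (fun n => (c M n - (qpoch p p)^-1) * t n)) =
   (fun M => zsum (fun n => c M n * t n) - (qpoch p p)^-1 * zsum t).
  apply/funext => M; rewrite -zsumM// -zsumB//; last exact: zgeoM.
  by congr zsum; apply/funext => n; rewrite mulrBl.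
rewrite E in H3.
have H4 : zsum (fun n => c M n * t n) - (qpoch p p)^-1 * zsum t @[M --> \oo] -->
    qpoch (ee zeta) p * qpoch (ee (P - zeta)) p - (qpoch p p)^-1 * zsum t.
  exact: (cvgCB H2 (@cvgC_cst R nat \oo _ _)).
have H5 : qpoch (ee zeta) p * qpoch (ee (P - zeta)) p - (qpoch p p)^-1 * zsum t = 0.
  exact: cvgC_unique H4 H3.
move/eqP: H5; rewrite subr_eq0 => /eqP ->.
by rewrite mulrAC mulVf// mul1r.
Qed.

End Product.
End JacobiTripleProduct.

(** * A calculus of complex derivatives *)

Section ComplexDerivative.
Context {R : realType}.
Implicit Types (f g : CC R -> CC R) (z h d e : CC R).

(* Differentiability with a quadratic remainder; it holds for all holomorphic
   functions and spares the filters in the rules of calculus. *)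
Definition qder f z d := exists M del : R, [/\ 0 <= M, 0 < del &
  forall h, cmod h < del -> cmod (f (z + h) - f z - h * d) <= M * cmod h ^+ 2].

Lemma qder_lip f z d : qder f z d -> exists K del : R, [/\ 0 <= K, 0 < del &
  forall h, cmod h < del -> cmod (f (z + h) - f z) <= K * cmod h].
Proof.
move=> [M [del [M0 d0 H]]]; exists (M + cmod d), (Num.min del 1).
split; [by rewrite addr_ge0 ?cmod_ge0 | by rewrite lt_min d0 ltr01 |].
move=> h; rewrite lt_min => /andP[hd h1].
rewrite -[_ - _](subrK (h * d)) (le_trans (cmodD _ _))// mulrDl lerD//.
  by rewrite (le_trans (H h hd))// ler_wpM2l// expr2 ler_piMr ?cmod_ge0// ltW.
by rewrite cmodM mulrC.
Qed.

Lemma qder_cst (c : CC R) z : qder (fun=> c) z 0.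
Proof.
by exists 0, 1; split=> // h _; rewrite subrr mulr0 subr0 cmod0 mul0r.
Qed.

Lemma qder_id z : qder id z 1.
Proof.
exists 0, 1; split=> // h _.
have -> : id (z + h) - id z - h * 1 = 0 by rewrite /=; ring.
by rewrite cmod0 mul0r.
Qed.

Lemma qderD f g z d e : qder f z d -> qder g z e -> qder (fun w => f w + g w) z (d + e).
Proof.
move=> [M [del [M0 d0 H]]] [N [eps [N0 e0 K]]].
exists (M + N), (Num.min del eps); split; [exact: addr_ge0|by rewrite lt_min d0|].
move=> h; rewrite lt_min => /andP[hd he].
have -> : f (z + h) + g (z + h) - (f z + g z) - h * (d + e) =
  (f (z + h) - f z - h * d) + (g (z + h) - g z - h * e) by ring.
by rewrite (le_trans (cmodD _ _))// [leRHS]mulrDl lerD// ?H ?K.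
Qed.

Lemma qderM f g z d e : qder f z d -> qder g z e ->
  qder (fun w => f w * g w) z (d * g z + f z * e).
Proof.
move=> Hf Hg; have [K1 [del1 [K10 d10 L1]]] := qder_lip Hf; have [K2 [del2 [K20 d20 L2]]] := qder_lip Hg.
move: Hf Hg => [M [del [M0 d0 H]]] [N [eps [N0 e0 K]]].
exists (M * cmod (g z) + cmod (f z) * N + K1 * K2), (Num.min (Num.min del eps) (Num.min del1 del2)).
split; [by rewrite !addr_ge0 ?mulr_ge0 ?cmod_ge0|by rewrite !lt_min d0 e0 d10 d20|].
move=> h; rewrite !lt_min => /andP[/andP[hd he] /andP[hd1 hd2]].
have -> : f (z + h) * g (z + h) - f z * g z - h * (d * g z + f z * e) =
  (f (z + h) - f z - h * d) * g z + f z * (g (z + h) - g z - h * e) +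
  (f (z + h) - f z) * (g (z + h) - g z) by ring.
rewrite (le_trans (cmodD _ _))// [leRHS]mulrDl lerD//.
  rewrite (le_trans (cmodD _ _))// [leRHS]mulrDl lerD// cmodM.
    by rewrite mulrAC ler_wpM2r ?cmod_ge0// H.
  by rewrite -mulrA ler_wpM2l ?cmod_ge0// K.
rewrite cmodM expr2 mulrACA ler_pM ?cmod_ge0//; [exact: L1|exact: L2].
Qed.

Lemma qderV f z d : f z != 0 -> qder f z d -> qder (fun w => (f w)^-1) z (- d / f z ^+ 2).
Proof.
move=> fz Hf; have [K1 [del1 [K10 d10 L1]]] := qder_lip Hf.
move: Hf => [M [del [M0 d0 H]]].
have F0 : 0 < cmod (f z) by rewrite cmod_gt0.
pose F := cmod (f z).
pose eps := F / 2 / (K1 + 1).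
have eps0 : 0 < eps by rewrite !divr_gt0// ltr_wpDl.
exists ((M * F + cmod d * K1) * 2 / F ^+ 3), (Num.min (Num.min del del1) eps).
split; [by rewrite divr_ge0 ?mulr_ge0 ?addr_ge0 ?mulr_ge0 ?cmod_ge0 ?exprn_ge0 ?(ltW F0)|by rewrite !lt_min d0 d10|].
move=> h; rewrite !lt_min => /andP[/andP[hd hd1] he].
have Lh := L1 h hd1; have Hh := H h hd.
have fh : F / 2 <= cmod (f (z + h)).
  have : F <= cmod (f (z + h)) + cmod (f (z + h) - f z).
    by rewrite /F -{1}[f z](subKr (f (z + h))) cmodB.
  have : K1 * cmod h <= F / 2.
    move: he; rewrite /eps ltr_pdivlMr ?ltr_wpDl// => he.
    have := cmod_ge0 h; nra.
  lra.
have fh0 : f (z + h) != 0 by rewrite -cmod_gt0 (lt_le_trans _ fh)// divr_gt0.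
have -> : (f (z + h))^-1 - (f z)^-1 - h * (- d / f z ^+ 2) =
  (- (f (z + h) - f z - h * d) * f z + h * d * (f (z + h) - f z)) / (f (z + h) * f z ^+ 2).
  by field; apply/andP; split.
rewrite cmodM cmodV cmodM cmodX -/F.
have G0 : 0 < cmod (f (z + h)) * F ^+ 2 by rewrite mulr_gt0 ?exprn_gt0// (lt_le_trans _ fh)// divr_gt0.
rewrite ler_pdivrMr//.
apply: (@le_trans _ _ ((M * F + cmod d * K1) * cmod h ^+ 2)).
  rewrite (le_trans (cmodD _ _))// [leRHS]mulrDl lerD//.
    by rewrite cmodM cmodN -/F mulrAC ler_wpM2r// ltW.
  by rewrite !cmodM; have := ler_wpM2l (mulr_ge0 (cmod_ge0 h) (cmod_ge0 d)) Lh; lra.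
have -> : (M * F + cmod d * K1) * 2 / F ^+ 3 * cmod h ^+ 2 * (cmod (f (z + h)) * F ^+ 2) =
  (M * F + cmod d * K1) * cmod h ^+ 2 * (cmod (f (z + h)) / (F / 2)).
  by field; rewrite gt_eqF.
rewrite ler_peMr//; first by rewrite mulr_ge0 ?sqr_ge0 ?addr_ge0 ?mulr_ge0 ?cmod_ge0 ?(ltW F0).
by rewrite ler_pdivlMr ?divr_gt0// mul1r.
Qed.

Lemma qder_comp f g z d e : qder f (g z) d -> qder g z e -> qder (fun w => f (g w)) z (d * e).
Proof.
move=> [M [del [M0 d0 H]]] Hg; have [K1 [del1 [K10 d10 L1]]] := qder_lip Hg.
move: Hg => [N [eps [N0 e0 K]]].
pose eta := del / (K1 + 1).
have eta0 : 0 < eta by rewrite divr_gt0// ltr_wpDl.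
exists (M * K1 ^+ 2 + cmod d * N), (Num.min (Num.min eps del1) eta).
split; [by rewrite addr_ge0 ?mulr_ge0 ?sqr_ge0 ?cmod_ge0|by rewrite !lt_min d10 e0|].
move=> h; rewrite !lt_min => /andP[/andP[he hd1] heta].
pose k := g (z + h) - g z.
have Lk : cmod k <= K1 * cmod h by exact: L1.
have kd : cmod k < del.
  apply: (le_lt_trans Lk); move: heta; rewrite /eta ltr_pdivlMr ?ltr_wpDl//.
  have := cmod_ge0 h; nra.
have -> : f (g (z + h)) - f (g z) - h * (d * e) =
  (f (g z + k) - f (g z) - k * d) + d * (k - h * e).
  have -> : g z + k = g (z + h) by rewrite /k addrC subrK.
  by ring.
rewrite (le_trans (cmodD _ _))// [leRHS]mulrDl lerD//.
  rewrite (le_trans (H k kd))// -mulrA ler_wpM2l// -exprMn.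
  by rewrite lerXn2r ?nnegrE ?cmod_ge0 ?mulr_ge0 ?cmod_ge0.
by rewrite cmodM -mulrA ler_wpM2l ?cmod_ge0// K.
Qed.

Lemma qder_derivable f z d : qder f z d -> derivable f z 1.
Proof.
move=> [M [del [M0 d0 H]]]; apply/cvg_ex; exists d; apply/cvgC_cmod => e e0.
have r0 : 0 < Num.min del (e / (M + 1)).
  by rewrite lt_min d0 divr_gt0// ltr_wpDl.
have r0' : 0 < ofR (Num.min del (e / (M + 1))) :> CC R by rewrite -ofR0 ltr_ofR.
near=> h.
have h0 : h != 0 by near: h; exact: nbhs_dnbhs_neq.
have : `|h| < ofR (Num.min del (e / (M + 1))) by near: h; exact: dnbhs0_lt.
rewrite cmodE ltr_ofR lt_min => /andP[hd he].
have := H h hd.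
have -> : f (z + h) - f z - h * d = (- h) * (d - h^-1 *: (f (h *: 1 + z) - f z)).
  have -> : h *: 1 = h :> CC R by rewrite /GRing.scale /= mulr1.
  rewrite [z + h]addrC -[h^-1 *: _]/(h^-1 * _).
  by field.
have hp : 0 < cmod h by rewrite cmod_gt0.
rewrite cmodM cmodN [M * _]mulrC expr2 -mulrA ler_pM2l// => /le_lt_trans; apply.
move: he; rewrite ltr_pdivlMr ?ltr_wpDl// mulrC => he.
by apply: le_lt_trans he; rewrite mulrDr mulr1 mulrC lerDl cmod_ge0.
Unshelve. all: by end_near. Qed.

End ComplexDerivative.

(** * Constancy on the upper half-plane; derivatives of exponential series *)

Section ExponentialSeries.
Context {R : realType}.
Implicit Types (t h : CC R).

Lemma sin_lip (x y : R) : `|sin x - sin y| <= `|x - y|.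
Proof.
wlog xy : x y / x < y.
  move=> H; case: (ltgtP x y) => [/H//|/H|->]; last by rewrite !subrr.
  by rewrite distrC [leRHS]distrC.
have [|c _] := @MVT R sin cos x y xy (fun x _ => is_derive_sin x).
  by apply: continuous_subspaceT => z; exact: continuous_sin.
rewrite distrC => ->; rewrite normrM [leRHS]distrC ler_piMl// ler_norml.
by rewrite cos_geN1 cos_le1.
Qed.

Lemma derive0_cst (phi : R -> R) : (forall s : R, is_derive s (1 : R) phi 0) -> phi 0 = phi 1.
Proof.
move=> H; have [|c _ E] := @MVT R phi (fun=> 0) 0 1 ltr01 (fun x _ => H x).
  apply: continuous_subspaceT => x; apply: differentiable_continuous.
  by apply/derivable1_diffP; exact: ex_derive.
by apply/esym/eqP; rewrite -subr_eq0 E mul0r.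
Qed.

Lemma is_derive0_quad (phi : R -> R) (s K del : R) : 0 < del -> 0 <= K ->
  (forall h : R, `|h| < del -> `|phi (s + h) - phi s| <= K * h ^+ 2) -> is_derive s (1 : R) phi 0.
Proof.
move=> d0 K0 H.
have C : h^-1 *: ((phi \o shift s) (h *: (1 : R)) - phi s) @[h --> (0 : R)^'] --> (0 : R).
  apply/cvgrPdist_lt => e e0.
  have r0 : 0 < Num.min del (e / (K + 1)) by rewrite lt_min d0 divr_gt0// ltr_wpDl.
  near=> h.
  have h0 : h != 0 by near: h; exact: nbhs_dnbhs_neq.
  have : `|h| < Num.min del (e / (K + 1)) by near: h; exact: dnbhs0_lt.
  rewrite lt_min => /andP[hd he]; rewrite sub0r normrN.
  have -> : h *: 1 = h :> R by rewrite /GRing.scale /= mulr1.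
  rewrite /= [h + s]addrC -[_ *: _]/(h^-1 * _) normrM normfV.
  have hp : 0 < `|h| by rewrite normr_gt0.
  rewrite ltr_pdivrMl// (le_lt_trans (H h hd))// -real_normK ?num_real// expr2 mulrCA ltr_pM2l//.
  move: he; rewrite ltr_pdivlMr ?ltr_wpDl// => he; nra.
by apply: DeriveDef; [apply/cvg_ex; exists 0 | exact: cvg_lim].
Unshelve. all: by end_near. Qed.

(** By convexity two points are joined inside the half-plane by a real-parameter path, along which
    real and imaginary parts have zero derivative. *)
Lemma qder0_const (f : CC R -> CC R) t t' :
  (forall z, 0 < imag z -> qder f z 0) -> 0 < imag t -> 0 < imag t' -> f t = f t'.
Proof.
move=> H t0 t0'.
(* the segment is parametrized by sin^2 so as to stay inside it for all s *)
pose u (s : R) := sin (s * (pi / 2)) ^+ 2.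
pose ga s := t + ofR (u s) * (t' - t).
have u01 s : 0 <= u s <= 1.
  by rewrite /u sqr_ge0/=; have := cos2Dsin2 (s * (pi / 2)); have := sqr_ge0 (cos (s * (pi / 2))); lra.
have ga0 s : 0 < imag (ga s).
  have -> : imag (ga s) = (1 - u s) * imag t + u s * imag t'.
    by rewrite /imag /ga ImD Im_ofRM ImD ImN; ring.
  have /andP[a b] := u01 s; nra.
have lipu s (h : R) : `|u (s + h) - u s| <= pi * `|h|.
  rewrite /u subr_sqr normrM mulrC.
  have H1 : `|sin ((s + h) * (pi / 2)) + sin (s * (pi / 2))| <= 2.
    by rewrite (le_trans (ler_normD _ _))// (_ : 2 = 1 + 1) ?lerD ?sin_max//.
  have H2 : `|sin ((s + h) * (pi / 2)) - sin (s * (pi / 2))| <= pi / 2 * `|h|.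
    apply: le_trans (sin_lip _ _) _.
    have -> : (s + h) * (pi / 2) - s * (pi / 2) = pi / 2 * h by ring.
    by rewrite normrM ger0_norm// divr_ge0// pi_ge0.
  have := ler_pM (normr_ge0 _) (normr_ge0 _) H1 H2; lra.
have key s : exists K del : R, [/\ 0 <= K, 0 < del & forall h : R, `|h| < del ->
    cmod (f (ga (s + h)) - f (ga s)) <= K * h ^+ 2].
  have [M [del [M0 d0 Hd]]] := H _ (ga0 s).
  pose c := cmod (t' - t); have c0 : 0 <= c := cmod_ge0 _.
  exists (M * (pi * c) ^+ 2), (del / (pi * c + 1)); split.
  - by rewrite mulr_ge0 ?sqr_ge0.
  - by rewrite divr_gt0// ltr_wpDl// mulr_ge0 ?pi_ge0.
  move=> h; rewrite ltr_pdivlMr ?ltr_wpDl ?mulr_ge0 ?pi_ge0// => hd.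
  pose k := ofR (u (s + h) - u s) * (t' - t).
  have kE : cmod k <= pi * c * `|h|.
    rewrite cmodM cmod_ofR -/c mulrAC ler_wpM2r//.
  have -> : ga (s + h) = ga s + k by rewrite /ga /k ofRB; ring.
  have := Hd k; rewrite mulr0 subr0 => Hk; apply: (le_trans (Hk _)).
    by apply: (le_lt_trans kE); have : 0 <= `|h| by []; nra.
  rewrite -mulrA ler_wpM2l// -[h ^+ 2]real_normK ?num_real// -exprMn.
  by rewrite lerXn2r ?nnegrE ?cmod_ge0 ?mulr_ge0 ?pi_ge0.
have E (pr : CC R -> R) : (forall z w, pr (z - w) = pr z - pr w) -> (forall z, `|pr z| <= cmod z) ->
    pr (f t) = pr (f t').
  move=> prB prle.
  have -> : t = ga 0 by rewrite /ga /u mul0r sin0 expr0n mul0r addr0.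
  have -> : t' = ga 1 by rewrite /ga /u mul1r sin_pihalf expr1n mul1r addrC subrK.
  apply: (derive0_cst (phi := fun s => pr (f (ga s)))) => s.
  have [K [del [K0 d0 HK]]] := key s.
  apply: (is_derive0_quad d0 K0) => h hd.
  by rewrite -prB (le_trans (prle _))// HK.
have E1 := E (@complex.Re R); have E2 := E (@complex.Im R).
apply/eqP; rewrite eq_complex; apply/andP; split; apply/eqP.
- by apply: E1; [move=> [? ?] [? ?] | exact: Re_le_cmod].
- by apply: E2; [move=> [? ?] [? ?] | exact: Im_le_cmod].
Qed.

Section Series.
Variables (a : nat -> CC R) (la : nat -> R).
Hypothesis la0 : forall k, 0 <= la k.
Hypothesis ha : forall y, 0 < y -> cvgn (series (fun k => cmod (a k) * expR (- (2 * pi * la k * y)))).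

(** Real frequencies cover both uses: halves of squares for the theta constant, and [k / N] for
    series in [ee (t / N)]. *)
Definition eterm t k : CC R := a k * ee (ofR (la k) * t).
Definition determ t k : CC R := 2 * ofR pi * (0 +i* 1)%C * ofR (la k) * eterm t k.

Lemma cmod_eterm t k : cmod (eterm t k) = cmod (a k) * expR (- (2 * pi * la k * imag t)).
Proof. by rewrite cmodM cmod_ee Im_ofRM mulrA. Qed.

Lemma eterm_cvg t : 0 < imag t -> cvgn (series (eterm t)).
Proof.
move=> t0; apply: series_cvgC (ha t0) => k; by rewrite cmod_eterm.
Qed.

Let cmod_2pii : cmod (2 * ofR pi * (0 +i* 1)%C : CC R) = 2 * pi.
Proof. by rewrite !cmodM cmod_nat cmod_ofR cmod_i mulr1 ger0_norm ?pi_ge0. Qed.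

(** The factor [X = 2 pi la k] costs half of the height [y]: [X <= (2 / y) exp (X y / 2)], so the
    series at height [y / 2] dominates. *)
Lemma determ_cvg t : 0 < imag t -> cvgn (series (determ t)).
Proof.
move=> t0; have y0 : 0 < imag t / 2 by rewrite divr_gt0.
have cC : cvgn (series (fun k => (2 / imag t) * (cmod (a k) * expR (- (2 * pi * la k * (imag t / 2)))))).
  have -> : series (fun k => (2 / imag t) * (cmod (a k) * expR (- (2 * pi * la k * (imag t / 2))))) =
     (fun n => (2 / imag t) * series (fun k => (cmod (a k) * expR (- (2 * pi * la k * (imag t / 2))))) n).
    by apply/funext => n; rewrite /series /= mulr_sumr.
  by apply: is_cvgMl_tmp; exact: ha.
apply: series_cvgC cC => k.
rewrite cmodM cmod_eterm cmodM cmod_2pii cmod_ofR ger0_norm// mulrCA [leRHS]mulrCA.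
rewrite ler_wpM2l ?cmod_ge0//.
set X := 2 * pi * la k; have X0 : 0 <= X by rewrite !mulr_ge0 ?pi_ge0.
have -> : expR (- (X * imag t)) = expR (- (X * (imag t / 2))) * expR (- (X * (imag t / 2))).
  by rewrite -expRD; congr expR; field.
rewrite [leLHS]mulrA ler_wpM2r ?expR_ge0// expRN ler_pdivrMr ?expR_gt0//.
apply: (@le_trans _ _ (2 / imag t * (X * (imag t / 2)))).
  by rewrite le_eqVlt; apply/orP; left; apply/eqP; field; rewrite gt_eqF.
rewrite ler_wpM2l ?divr_ge0 ?(ltW t0)//; have := expR_ge1Dx (X * (imag t / 2)); lra.
Qed.

Definition esum t := limn (series (eterm t)).
Definition desum t := limn (series (determ t)).

(** For [|h| < y / 4] the remainder of term [k] carries [X ^ 2 exp (X y / 4)], where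
    [X = 2 pi la k]. Bounding [X ^ 2] by a multiple of another [exp (X y / 4)] leaves the convergent
    series at height [y / 2]. *)
Lemma esum_qder t : 0 < imag t -> qder esum t (desum t).
Proof.
move=> t0; pose y := imag t; have y0 : 0 < y / 2 by rewrite divr_gt0.
pose B k := cmod (a k) * expR (- (2 * pi * la k * (y / 2))).
have cB : cvgn (series B) := ha y0.
pose M := 5 * (8 / y) ^+ 2 * limn (series B).
have SB n : series B n <= limn (series B).
  apply: nondecreasing_cvgn_le => //; apply: nondecreasing_series => n' _ _.
  by rewrite mulr_ge0 ?cmod_ge0 ?expR_ge0.
have LB0 : 0 <= limn (series B) by have := SB 0%N; rewrite /series /= big_nil.
exists M, (y / 4); split; [by rewrite mulr_ge0// mulr_ge0// sqr_ge0|by rewrite divr_gt0|].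
move=> h hd.
have th0 : 0 < imag (t + h).
  rewrite /imag ImD -/(imag t) -/y; have := Im_le_cmod h; rewrite ler_norml => /andP[h1 _].
  rewrite /y in hd y0 *; lra.
have c1 := eterm_cvg th0; have c2 := eterm_cvg t0; have c3 := determ_cvg t0.
apply: (cvgC_cmod_le (h := fun n => series (eterm (t + h)) n - series (eterm t) n - h * series (determ t) n)).
  exact: (cvgCB (cvgCB c1 c2) (cvgCM (@cvgC_cst R nat \oo _ h) c3)).
move=> n; have -> : series (eterm (t + h)) n - series (eterm t) n - h * series (determ t) n =
   \sum_(0 <= k < n) (eterm (t + h) k - eterm t k - h * determ t k).
  by rewrite /series /= mulr_sumr -!sumrB.
rewrite (le_trans (cmod_sum _ _ _))//.
apply: (@le_trans _ _ (5 * (8 / y) ^+ 2 * cmod h ^+ 2 * series B n)); last first.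
  rewrite /M [leRHS]mulrAC ler_wpM2l//.
  by rewrite mulr_ge0 ?sqr_ge0// mulr_ge0// sqr_ge0.
rewrite /series /= mulr_sumr; apply: ler_sum => k _.
pose v : CC R := 2 * ofR pi * (0 +i* 1)%C * (ofR (la k) * h).
have -> : eterm (t + h) k - eterm t k - h * determ t k = eterm t k * (cexp v - 1 - v).
  by rewrite /determ /eterm mulrDr eeD /v -eeE; ring.
rewrite cmodM cmod_eterm -/y.
pose X := 2 * pi * la k; have X0 : 0 <= X by rewrite !mulr_ge0 ?pi_ge0.
have vE : cmod v = X * cmod h by rewrite /v cmodM cmod_2pii cmodM cmod_ofR ger0_norm// mulrA.
have H := cexp_sub1x_le v; rewrite vE in H.
have E1 : expR (X * cmod h) <= expR (X * (y / 4)) by rewrite ler_expR ler_wpM2l// ltW.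
have E2 : X ^+ 2 <= (8 / y) ^+ 2 * expR (X * (y / 4)).
  have := @ler_sqr_expR _ (X * y / 8); rewrite divr_ge0 ?(mulr_ge0 X0 (ltW t0))// => /(_ isT).
  have -> : 2 * (X * y / 8) = X * (y / 4) by field.
  move=> H1; have -> : X ^+ 2 = (8 / y) ^+ 2 * (X * y / 8) ^+ 2 by field; rewrite gt_eqF.
  by rewrite ler_wpM2l ?sqr_ge0.
have H3 : cmod (cexp v - 1 - v) <= 5 * (8 / y) ^+ 2 * cmod h ^+ 2 * (expR (X * (y / 4)) * expR (X * (y / 4))).
  apply: (le_trans H).
  have hh := ler_pM (mulr_ge0 (sqr_ge0 X) (sqr_ge0 (cmod h))) (expR_ge0 (X * cmod h)) (ler_wpM2r (sqr_ge0 (cmod h)) E2) E1.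
  rewrite -exprMn in hh; rewrite -[leLHS]mulrA; apply: (le_trans (ler_wpM2l _ hh)) => //.
  by rewrite le_eqVlt; apply/orP; left; apply/eqP; ring.
have := ler_wpM2l (mulr_ge0 (cmod_ge0 (a k)) (expR_ge0 (- (X * y)))) H3.
move=> /le_trans; apply.
rewrite /B -/X -expRD.
have -> : expR (- (X * (y / 2))) = expR (- (X * y)) * expR (X * (y / 4) + X * (y / 4)).
  by rewrite -expRD; congr expR; field.
by rewrite le_eqVlt; apply/orP; left; apply/eqP; ring.
Qed.

End Series.

End ExponentialSeries.

(** * The theta constant, and the Taylor expansion of theta at 0 *)

Section ThetaConstant.
Context {R : realType}.
Implicit Types (P Q z t tau zeta : CC R).

Lemma triple_product_zsum Q P zeta (al al' be : CC R) (a a' b : nat) :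
  cmod Q < 1 -> cmod al <= 1 -> cmod al' <= 1 -> cmod be <= 1 ->
  (0 < a)%N -> (0 < a')%N -> (0 < b)%N -> 0 < imag P ->
  ee zeta = al * Q ^+ a -> ee (P - zeta) = al' * Q ^+ a' -> ee P = be * Q ^+ b ->
  qpochs [:: al * Q ^+ a; al' * Q ^+ a'; be * Q ^+ b] (be * Q ^+ b) =
  zsum (tht P (zeta - P / 2 + 1 / 2)).
Proof.
move=> Q1 al1 al1' be1 a0 a0' b0 P0 E1 E2 E3.
have [_ _ /(_ _ Q1)[_ c1]] := qpoch_series al1 be1 a0 b0.
have [_ _ /(_ _ Q1)[_ c2]] := qpoch_series al1' be1 a0' b0.
have [_ _ /(_ _ Q1)[n3 c3]] := qpoch_series be1 be1 b0 b0.
rewrite -E1 -E3 in c1; rewrite -E2 -E3 in c2; rewrite -E3 in c3 n3.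
rewrite /qpochs !big_cons big_nil mulr1 mulrA -E1 -E2 -E3.
exact: jacobi_triple_product.
Qed.

Lemma triple_product_neq0 Q (al al' be : CC R) (a a' b : nat) :
  cmod Q < 1 -> cmod al <= 1 -> cmod al' <= 1 -> cmod be <= 1 ->
  (0 < a)%N -> (0 < a')%N -> (0 < b)%N ->
  qpochs [:: al * Q ^+ a; al' * Q ^+ a'; be * Q ^+ b] (be * Q ^+ b) != 0.
Proof.
move=> Q1 al1 al1' be1 a0 a0' b0.
have [_ _ /(_ _ Q1)[n1 _]] := qpoch_series al1 be1 a0 b0.
have [_ _ /(_ _ Q1)[n2 _]] := qpoch_series al1' be1 a0' b0.
have [_ _ /(_ _ Q1)[n3 _]] := qpoch_series be1 be1 b0 b0.
by rewrite /qpochs !big_cons big_nil mulr1 !mulf_neq0.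
Qed.

Definition th3 t := zsum (tht t 0).
(** Up to constants, both the derivative of [th3] in [t] and the second derivative of [thz t] at 0;
    this coincidence is the heat equation. *)
Definition th3sq t := zsum (fun n => n%:~R ^+ 2 * tht t 0 n).

Lemma cmod_ee_lt1 t : 0 < imag t -> cmod (ee t) < 1.
Proof. by move=> t0; rewrite cmod_ee expR_lt1 oppr_lt0 !mulr_gt0 ?pi_gt0. Qed.

Lemma imag_scale (x : R) t : imag (ofR x * t) = x * imag t.
Proof. exact: Im_ofRM. Qed.

Lemma imag_half t : imag (t / 2) = imag t / 2.
Proof. by rewrite mulrC -[2]ofR_nat -ofRV imag_scale mulrC. Qed.

(** With [Q = ee (t / 2)] the triple product gives [th3 t = (- Q, - Q, Q ^ 2; Q ^ 2)], whose factors
    do not vanish. *)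
Lemma th3_neq0 t : 0 < imag t -> th3 t != 0.
Proof.
move=> t0; have Q1 : cmod (ee (t / 2)) < 1.
  by rewrite cmod_ee_lt1// imag_half divr_gt0.
have h1 : cmod (-1 : CC R) <= 1 by rewrite cmodN cmod1.
have h2 : cmod (1 : CC R) <= 1 by rewrite cmod1.
have := triple_product_neq0 Q1 h1 h1 h2 (isT : 0 < 1)%N (isT : 0 < 1)%N (isT : 0 < 2)%N.
rewrite (triple_product_zsum (P := t) (zeta := t / 2 - 1 / 2)) //.
- by rewrite /th3; congr (zsum (tht _ _) != 0); field.
- by rewrite eeB ee_half expr1 invrN1 mulrN1 mulN1r.
- have -> : t - (t / 2 - 1 / 2) = t / 2 + 1 / 2 by field.
  by rewrite eeD ee_half expr1 mulrN1 mulN1r.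
- by rewrite mul1r eeX; congr ee; field.
Qed.

Lemma gauss_cvg (y : R) (m : nat) : 0 < y ->
  cvgn (series (fun k : nat => cmod (1 : CC R) * expR (- (2 * pi * ((k + m)%N%:R ^+ 2 / 2) * y)))).
Proof.
move=> y0; have s0 : 0 < pi * y by rewrite mulr_gt0 ?pi_gt0.
have [C HC] := gauss_geo 0 s0.
have C0 : 0 <= C.
  by have := HC 0; rewrite expr0 divr1; apply: le_trans; exact: expR_ge0.
have cC := @cvg_half_series R (C / 2).
apply: series_le_cvg cC => k; rewrite ?mulr_ge0 ?cmod_ge0 ?expR_ge0//.
rewrite cmod1 mul1r.
have := HC (k + m)%N%:Z; rewrite mul0r addr0 /= => H.
have -> : 2 * (C / 2) = C by field.
apply: (@le_trans _ _ (C / 2 ^+ (k + m)%N)).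
  by apply: le_trans H; rewrite le_eqVlt; apply/orP; left; apply/eqP; congr expR; rewrite -pmulrn; field.
by rewrite ler_wpM2l// lef_pV2 ?posrE ?exprn_gt0// ler_weXn2l ?ler1n// leq_addr.
Qed.

Lemma tht_gw t n : tht t 0 n = gw t 0 n.
Proof. by rewrite /tht /gw mulr0 !addr0. Qed.

Lemma tht_sq_zgeo t : 0 < imag t -> zgeo (fun n => n%:~R ^+ 2 * tht t 0 n).
Proof.
move=> t0; have [C HC] := gw_bound 0 2 t0; exists C => n.
have c0 : cmod (0 : CC R) <= 0 by rewrite cmod0.
apply: le_trans (HC 0 n c0); rewrite tht_gw cmodM mulrC ler_wpM2l ?cmod_ge0//.
by rewrite cmodX cmod_intr ler_sqr_expR.
Qed.

Lemma th3_qder t : 0 < imag t -> qder th3 t (ofR pi * (0 +i* 1)%C * th3sq t).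
Proof.
move=> t0.
(* The cases [m = 0] and [m = 1] collect the integers [n >= 0] and [n <= -1] respectively. *)
pose la (m k : nat) : R := (k + m)%N%:R ^+ 2 / 2.
have la0 m k : 0 <= la m k by rewrite divr_ge0// sqr_ge0.
have ha m y (y0 : 0 < y) := @gauss_cvg y m y0.
have q m := esum_qder (la0 m) (ha m) t0.
have E u : 0 < imag u -> th3 u = esum (fun=> 1) (la 0) u + esum (fun=> 1) (la 1) u.
  move=> u0; apply: zsum_unique.
  have -> : Zsum (tht u 0) = (fun K => series (eterm (fun=> 1) (la 0) u) K + series (eterm (fun=> 1) (la 1) u) K).
    apply/funext => K; rewrite /Zsum /series /= -big_split /=; apply: eq_bigr => n _.
    rewrite /tht /eterm /la !mulr0 !addr0 !mul1r addn0 addn1.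
    rewrite !(ofRM, ofRX, ofRV, ofR_nat) intrN -!pmulrn sqrrN.
    by congr (ee _ + ee _); field.
  exact: (cvgCD (eterm_cvg (ha 0) u0) (eterm_cvg (ha 1) u0)).
have E2 : ofR pi * (0 +i* 1)%C * th3sq t = desum (fun=> 1) (la 0) t + desum (fun=> 1) (la 1) t.
  rewrite /th3sq -zsumM; last exact: tht_sq_zgeo.
  apply: zsum_unique.
  have -> : Zsum (fun n => ofR pi * (0 +i* 1)%C * (n%:~R ^+ 2 * tht t 0 n)) =
     (fun K => series (determ (fun=> 1) (la 0) t) K + series (determ (fun=> 1) (la 1) t) K).
    apply/funext => K; rewrite /Zsum /series /= -big_split /=; apply: eq_bigr => n _.
    rewrite /tht /determ /eterm /la !mulr0 !addr0 !mul1r addn0 addn1.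
    rewrite !(ofRM, ofRX, ofRV, ofR_nat) intrN -!pmulrn sqrrN.
    have -> : n%:R ^+ 2 / 2 * t = t / 2 * n%:R ^+ 2 by field.
    have -> : n.+1%:R ^+ 2 / 2 * t = t / 2 * n.+1%:R ^+ 2 by field.
    by field.
  exact: (cvgCD (determ_cvg (la0 0) (ha 0) t0) (determ_cvg (la0 1) (ha 1) t0)).
have [M [del [M0 d0 H]]] := qderD (q 0%N) (q 1%N).
exists M, (Num.min del (imag t)); split; rewrite ?lt_min ?d0 ?t0//.
move=> h; rewrite lt_min => /andP[hd ht].
have th0 : 0 < imag (t + h).
  by rewrite /imag ImD -/(imag t); have := Im_le_cmod h; rewrite ler_norml => /andP[]; lra.
by rewrite E2 (E _ th0) (E _ t0); exact: H.
Qed.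

Definition thz t z := zsum (tht t z).

(** Adding the values at [z] and [- z] removes the odd terms, so [th3sq] alone describes the
    expansion up to third order. *)
Lemma thz_taylor t : 0 < imag t -> exists2 C, 0 <= C & forall z, cmod z <= 1 ->
  cmod (thz t z + thz t (- z) - 2 * th3 t - (2 * ofR pi * (0 +i* 1)%C * z) ^+ 2 * th3sq t) <= C * cmod z ^+ 3.
Proof.
(* The remainder of term [n] grows at most like [exp (9 pi |n|)]; [10 pi] leaves room. *)
move=> t0; have [C HC] := gw_bound 0 (10 * pi) t0; pose p := 2 * pi : R.
have p0 : 0 <= p by rewrite mulr_ge0 ?pi_ge0.
have C0 : 0 <= C.
  have c0 : cmod (0 : CC R) <= 0 by rewrite cmod0.
  by have := HC 0 0 c0; rewrite expr0 divr1; apply: le_trans; rewrite mulr_ge0 ?cmod_ge0 ?expR_ge0.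
exists (4 * (18 * C)) => [|z z1]; first by rewrite !mulr_ge0.
have g0 := tht_zgeo z t0; have g1 := tht_zgeo (- z) t0; have g2 := tht_zgeo 0 t0.
have g3 := tht_sq_zgeo t0.
have gA := zgeoD g0 g1; have gB := zgeoB gA (zgeoM 2 g2).
rewrite /thz /th3 /th3sq -(zsumM _ g3) -(zsumM _ g2) -zsumD// -zsumB//; last exact: zgeoM.
rewrite -zsumB//; last exact: zgeoM.
have -> : 4 * (18 * C) * cmod z ^+ 3 = 4 * (18 * C * cmod z ^+ 3) by ring.
apply: zsum_le => n.
(* Half of the exponent [2 pi i n z]: then [exp (2 w) + exp (- 2 w) - 2] is the square of
   [exp w - exp (- w)], and the remainder [rho] of that difference suffices. *)
pose w : CC R := 2 * ofR pi * (0 +i* 1)%C * (n%:~R * z / 2).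
have E1 : tht t z n = tht t 0 n * (cexp w * cexp w).
  by rewrite /tht /w -eeE -!eeD; congr ee; field.
have E2 : tht t (- z) n = tht t 0 n * ((cexp w)^-1 * (cexp w)^-1).
  by rewrite -cexpN /tht /w -mulrN -eeE -!eeD; congr ee; field.
have -> : tht t z n + tht t (- z) n - 2 * tht t 0 n - (2 * ofR pi * (0 +i* 1)%C * z) ^+ 2 * (n%:~R ^+ 2 * tht t 0 n) =
    tht t 0 n * ((cexp w - cexp (- w)) ^+ 2 - (2 * w) ^+ 2).
  rewrite E1 E2 cexpN /w; have := cexp_neq0 (2 * ofR pi * (0 +i* 1)%C * (n%:~R * z / 2)).
  by set E := cexp _ => E0; field.
pose rho := (cexp w - 1 - w) - (cexp (- w) - 1 - (- w)).
have -> : (cexp w - cexp (- w)) ^+ 2 - (2 * w) ^+ 2 = 4 * w * rho + rho ^+ 2.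
  by rewrite /rho; ring.
pose a := cmod w; have a0 : 0 <= a := cmod_ge0 w.
have aE : a = p * `|n%:~R| * cmod z / 2.
  by rewrite /a /w !cmodM cmodV !cmod_nat cmod_ofR cmod_i cmod_intr /p ger0_norm ?pi_ge0//; field.
have rhoE : cmod rho <= 10 * a ^+ 2 * expR a.
  have := cexp_sub1x_le w; have := cexp_sub1x_le (- w); rewrite cmodN -/a.
  have := cmodB (cexp w - 1 - w) (cexp (- w) - 1 - (- w)); rewrite -/rho; lra.
have bd : cmod (4 * w * rho + rho ^+ 2) <= 140 * a ^+ 3 * expR (3 * a).
  rewrite (le_trans (cmodD _ _))// cmodX 2!cmodM cmod_nat -/a.
  have ea1 : 1 <= expR a by have := expR_ge1Dx a; lra.
  have ea : a <= expR a by have := expR_ge1Dx a; lra.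
  have e3 : expR (3 * a) = expR a ^+ 3 by rewrite -expRM_natl.
  have r2 : cmod rho ^+ 2 <= (10 * a ^+ 2 * expR a) ^+ 2.
    by rewrite lerXn2r ?nnegrE ?cmod_ge0// mulr_ge0 ?expR_ge0// mulr_ge0 ?sqr_ge0.
  rewrite e3; set x := expR a in ea1 ea rhoE r2 *.
  have s1 : 4 * a * cmod rho <= 40 * a ^+ 3 * x.
    have := ler_wpM2l (mulr_ge0 (ler0n R 4) a0) rhoE; lra.
  have s2 : a ^+ 3 * x <= a ^+ 3 * x ^+ 3.
    rewrite ler_wpM2l ?exprn_ge0// -{1}[x]expr1 ler_weXn2l//.
  have s3 : a ^+ 4 * x ^+ 2 <= a ^+ 3 * x ^+ 3.
    have := ler_wpM2l (mulr_ge0 (exprn_ge0 3 a0) (sqr_ge0 x)) ea.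
    have -> : a ^+ 3 * x ^+ 2 * a = a ^+ 4 * x ^+ 2 by ring.
    by have -> : a ^+ 3 * x ^+ 2 * x = a ^+ 3 * x ^+ 3 by ring.
  have : (10 * a ^+ 2 * x) ^+ 2 = 100 * (a ^+ 4 * x ^+ 2) by ring.
  lra.
set m : R := `|n%:~R| in aE.
have m0 : 0 <= m by rewrite /m.
have pm0 : 0 <= p * m by rewrite mulr_ge0.
have a3 : a ^+ 3 <= cmod z ^+ 3 * expR (3 * (p * m)) / 8.
  have -> : a ^+ 3 = cmod z ^+ 3 * (p * m) ^+ 3 / 8 by rewrite aE; field.
  rewrite ler_wpM2r// ler_wpM2l ?exprn_ge0 ?cmod_ge0// -[3]/(3%:R) expRM_natl lerXn2r ?nnegrE ?expR_ge0//.
  by have := expR_ge1Dx (p * m); lra.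
have ea : expR (3 * a) <= expR (3 * pi * m).
  rewrite ler_expR aE; have : p * m * cmod z <= p * m by rewrite ler_piMr.
  rewrite /p; have := mulr_ge0 (pi_ge0 R) m0; lra.
have tot : cmod (4 * w * rho + rho ^+ 2) <= 18 * cmod z ^+ 3 * expR (10 * pi * m).
  apply: (le_trans bd).
  have H := ler_pM (exprn_ge0 3 a0) (expR_ge0 _) a3 ea.
  have E3 : expR (3 * (p * m)) * expR (3 * pi * m) <= expR (10 * pi * m).
    by rewrite -expRD ler_expR /p; have := mulr_ge0 (pi_ge0 R) m0; lra.
  have := ler_wpM2l (exprn_ge0 3 (cmod_ge0 z)) E3; have := mulr_ge0 (exprn_ge0 3 (cmod_ge0 z)) (expR_ge0 (10 * pi * m)).
  lra.
have c0 : cmod (0 : CC R) <= 0 by rewrite cmod0.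
have Hn := HC 0 n c0; rewrite -tht_gw -/m in Hn.
rewrite cmodM; apply: (le_trans (ler_wpM2l (cmod_ge0 _) tot)).
have := ler_wpM2l (mulr_ge0 (ler0n R 18) (exprn_ge0 3 (cmod_ge0 z))) Hn.
set I := (2 ^+ absz n)^-1; lra.
Qed.

End ThetaConstant.

(** * The heat equation and the inversion factor *)

Section HeatEquation.
Context {R : realType}.
Implicit Types (f g : R -> CC R) (t : CC R) (x : R).

(** Positive real [x] are enough, since the notion serves only to compare coefficients of
    [x ^ 2]. *)
Definition bigO (k : nat) f := exists C del : R, [/\ 0 <= C, 0 < del &
  forall x, 0 < x < del -> cmod (f x) <= C * x ^+ k].

Lemma bigO_add k f g : bigO k f -> bigO k g -> bigO k (fun x => f x + g x).
Proof.
move=> [C [d [C0 d0 H]]] [D [e [D0 e0 K]]]; exists (C + D), (Num.min d e).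
split; [exact: addr_ge0|by rewrite lt_min d0|] => x /andP[x0]; rewrite lt_min => /andP[xd xe].
by rewrite (le_trans (cmodD _ _))// [leRHS]mulrDl lerD ?H ?K// x0.
Qed.

Lemma bigO_mul k l f g : bigO k f -> bigO l g -> bigO (k + l) (fun x => f x * g x).
Proof.
move=> [C [d [C0 d0 H]]] [D [e [D0 e0 K]]]; exists (C * D), (Num.min d e).
split; [exact: mulr_ge0|by rewrite lt_min d0|] => x /andP[x0]; rewrite lt_min => /andP[xd xe].
by rewrite cmodM exprD mulrACA ler_pM ?cmod_ge0 ?H ?K// x0.
Qed.

Lemma bigO_cst (c : CC R) : bigO 0 (fun=> c).
Proof. by exists (cmod c), 1; split; rewrite ?cmod_ge0// => x _; rewrite expr0 mulr1. Qed.

Lemma bigO_pow k : bigO k (fun x => ofR x ^+ k).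
Proof.
exists 1, 1; split=> // x /andP[x0 _].
by rewrite cmodX cmod_ofR mul1r gtr0_norm.
Qed.

Lemma bigO_weak k l f : (l <= k)%N -> bigO k f -> bigO l f.
Proof.
move=> lk [C [d [C0 d0 H]]]; exists C, (Num.min d 1); split; rewrite ?lt_min ?d0 ?ltr01//.
move=> x /andP[x0]; rewrite lt_min => /andP[xd x1].
rewrite (le_trans (H x _)) ?x0// ler_wpM2l//.
by rewrite ler_wiXn2l// ltW.
Qed.

Lemma bigO_zero (X : CC R) : bigO 3 (fun x => X * ofR x ^+ 2) -> X = 0.
Proof.
move=> [C [d [C0 d0 H]]]; apply/eqP; rewrite -cmod_eq0; apply/eqP/le_anti.
rewrite cmod_ge0 andbT; apply/ler_addgt0Pr => e e0; rewrite add0r.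
pose x := Num.min (d / 2) (e / (C + 1)).
have x0 : 0 < x by rewrite lt_min !divr_gt0// ltr_wpDl.
have xd : x < d by rewrite (@le_lt_trans _ _ (d / 2))// ?ge_min ?lexx//; lra.
have := H x; rewrite x0 xd => /(_ isT).
rewrite cmodM cmodX cmod_ofR gtr0_norm//.
have -> : C * x ^+ 3 = C * x * x ^+ 2 by ring.
rewrite ler_pM2r ?exprn_gt0// => h.
have : x <= e / (C + 1) by rewrite ge_min lexx orbT.
rewrite ler_pdivlMr ?ltr_wpDl// => h2; nra.
Qed.

Let K : CC R := 2 * ofR pi * (0 +i* 1)%C.

Let K0 : K != 0.
Proof.
rewrite -cmod_gt0 !cmodM cmod_nat cmod_ofR cmod_i mulr1 ger0_norm ?pi_ge0//.
by rewrite mulr_gt0// pi_gt0.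
Qed.

Lemma thz_bigO t (c : CC R) : 0 < imag t -> bigO 3 (fun x =>
  thz t (c * ofR x) + thz t (- (c * ofR x)) - 2 * th3 t - (K * (c * ofR x)) ^+ 2 * th3sq t).
Proof.
move=> t0; have [C C0 H] := thz_taylor t0.
exists (C * cmod c ^+ 3), (1 / (cmod c + 1)).
have c1 : 0 < cmod c + 1 by rewrite ltr_wpDl ?cmod_ge0.
split; [by rewrite mulr_ge0// exprn_ge0// cmod_ge0|by rewrite divr_gt0|].
move=> x /andP[x0]; rewrite ltr_pdivlMr// => xd.
have cx : cmod (c * ofR x) = cmod c * x by rewrite cmodM cmod_ofR gtr0_norm.
apply: (le_trans (H _ _)); rewrite cx; first by have := cmod_ge0 c; nra.
by rewrite exprMn mulrA.
Qed.

Lemma ee_bigO (c : CC R) : bigO 3 (fun x => ee (c * ofR x ^+ 2) - 1 - K * c * ofR x ^+ 2).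
Proof.
apply: (bigO_weak (k := 4)) => //.
pose a := cmod (K * c); have a0 : 0 <= a := cmod_ge0 _.
exists (5 * a ^+ 2 * expR a), 1; split=> //; first by rewrite mulr_ge0 ?expR_ge0// mulr_ge0// sqr_ge0.
move=> x /andP[x0 x1].
have vE : cmod (K * (c * ofR x ^+ 2)) = a * x ^+ 2.
  by rewrite mulrA cmodM cmodX cmod_ofR gtr0_norm.
rewrite eeE -/K -[K * c * _]mulrA (le_trans (cexp_sub1x_le _))// vE.
have -> : 5 * (a * x ^+ 2) ^+ 2 * expR (a * x ^+ 2) = 5 * a ^+ 2 * expR (a * x ^+ 2) * x ^+ 4 by ring.
rewrite ler_wpM2r ?exprn_ge0 ?(ltW x0)// ler_wpM2l ?mulr_ge0 ?sqr_ge0// ler_expR.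
by rewrite ler_piMr// expr_le1// ltW.
Qed.

Lemma gsum_thz t (z : CC R) : 0 < imag t -> gsum t z = ee (t / 2 * z ^+ 2) * thz t (t * z).
Proof.
move=> t0; rewrite /gsum /thz -zsumM; last exact: tht_zgeo.
by congr zsum; apply/funext => n; rewrite /gw /tht -eeD; congr ee; field.
Qed.

Lemma thz0 t : thz t 0 = th3 t.
Proof. by []. Qed.

(** The coefficient of [x ^ 2] in [theta_proportional], applied at [x] and [- x] against 0 and
    added. The term with [th3 t] on the left comes from the factor [ee (t / 2 * x ^ 2)] of
    [gsum_thz]. *)
Lemma heat_relation t : 0 < imag t ->
  t * th3 (- t^-1) * (th3 t + K * t * th3sq t) = th3 t * K * th3sq (- t^-1).
Proof.
move=> t0; set p := - t^-1; have p0 : 0 < imag p := imag_inv t0.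
set A := th3 t; set B := th3 p; set S := th3sq t; set S' := th3sq p.
pose T1 x := thz t (t * ofR x) + thz t (- (t * ofR x)) - 2 * A - (K * (t * ofR x)) ^+ 2 * S.
pose T2 x := thz p (1 * ofR x) + thz p (- (1 * ofR x)) - 2 * B - (K * (1 * ofR x)) ^+ 2 * S'.
pose E x := ee (t / 2 * ofR x ^+ 2) - 1 - K * (t / 2) * ofR x ^+ 2.
have hT1 : bigO 3 T1 := thz_bigO t t0.
have hT2 : bigO 3 T2 := thz_bigO 1 p0.
have hE : bigO 3 E := ee_bigO (t / 2).
have id1 (z : CC R) : ee (t / 2 * z ^+ 2) * thz t (t * z) * B = A * thz p z.
  have := theta_proportional z 0 t0; rewrite !gsum_thz// expr0n /= !mulr0 ee0 mul1r -/p.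
  by rewrite thz0 -/A -[zsum (tht p 0)]/(th3 p) -/B.
pose X := K * (t * B * (A + K * t * S) - A * K * S').
(* Every summand on the right is [O(x ^ 3)], which forces [X = 0]. *)
have XE x : X * ofR x ^+ 2 = A * T2 x + (- B) * (E x * (2 * A + (K * t) ^+ 2 * S * ofR x ^+ 2 + T1 x)
    + (1 + K * (t / 2) * ofR x ^+ 2) * T1 x + (K * (t / 2) * (K * t) ^+ 2 * S) * ofR x ^+ 4).
  have H1 := id1 (ofR x); have H2 := id1 (- ofR x); rewrite sqrrN mulrN in H2.
  have -> : T2 x = thz p (ofR x) + thz p (- ofR x) - 2 * B - (K * ofR x) ^+ 2 * S'.
    by rewrite /T2 mul1r.
  have H : A * (thz p (ofR x) + thz p (- ofR x)) = (1 + K * (t / 2) * ofR x ^+ 2 + E x) *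
      (2 * A + (K * (t * ofR x)) ^+ 2 * S + T1 x) * B.
    by rewrite mulrDr -H1 -H2 /E /T1; ring.
  by rewrite mulrBr mulrBr H /X; field.
have : bigO 3 (fun x => X * ofR x ^+ 2).
  have -> : (fun x => X * ofR x ^+ 2) = (fun x => A * T2 x + (- B) * (E x * (2 * A + (K * t) ^+ 2 * S * ofR x ^+ 2 + T1 x)
    + (1 + K * (t / 2) * ofR x ^+ 2) * T1 x + (K * (t / 2) * (K * t) ^+ 2 * S) * ofR x ^+ 4)).
    by apply/funext.
  have c0 k (c : CC R) f : bigO k f -> bigO k (fun x => c * f x).
    by move=> H; have := bigO_mul (bigO_cst c) H.
  apply: bigO_add; first exact: (c0 _).
  apply: (c0 _); apply: bigO_add; first (apply: bigO_add).
  - apply: (@bigO_mul 3 0) => //; apply: bigO_add; first (apply: bigO_add; first exact: bigO_cst).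
      by apply: (bigO_weak (k := 2)) => //; apply: (c0 _); exact: bigO_pow.
    exact: (bigO_weak (k := 3)).
  - apply: (@bigO_mul 0 3) => //; apply: bigO_add; first exact: bigO_cst.
    by apply: (bigO_weak (k := 2)) => //; apply: (c0 _); exact: bigO_pow.
  - by apply: (bigO_weak (k := 4)) => //; apply: (c0 _); exact: bigO_pow.
move=> /bigO_zero /eqP; rewrite mulf_eq0 (negbTE K0) /= subr_eq0 => /eqP.
by [].
Qed.

(* [thc t = sqrt (i / t)], but only its behaviour under scaling of [t] is used. *)
Definition thc t := th3 t / th3 (- t^-1).

Lemma thc_neq0 t : 0 < imag t -> thc t != 0.
Proof. by move=> t0; rewrite mulf_neq0 ?invr_neq0 ?th3_neq0// imag_inv. Qed.

(** [heat_relation] says that the logarithmic derivative of [thc] is [- 1 / (2 t)], as for a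
    multiple of [t ^ (- 1 / 2)], but with no choice of a square root. *)
Lemma thc_qder t : 0 < imag t -> qder thc t (- thc t / (2 * t)).
Proof.
move=> t0; have p0 := imag_inv t0; have tn0 := imag_neq0 t0.
have B0 := th3_neq0 p0; have HR := heat_relation t0.
have q1 := th3_qder t0.
have q2 : qder (fun w : CC R => - w^-1) t (t ^- 2).
  have := qderM (qder_cst (-1) t) (qderV tn0 (qder_id t)).
  have -> : (fun w : CC R => -1 * (id w)^-1) = (fun w => - w^-1).
    by apply/funext => w; rewrite mulN1r.
  by congr qder; rewrite /=; field.
have q3 := qder_comp (g := fun w => - w^-1) (th3_qder p0) q2.
have := qderM q1 (qderV (f := fun w => th3 (- w^-1)) B0 q3).
congr qder; rewrite /thc.
set A := th3 t in HR *; set B := th3 (- t^-1) in HR B0 *.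
set S := th3sq t in HR *; set S' := th3sq (- t^-1) in HR *.
have K2 : ofR pi * (0 +i* 1)%C = K / 2 :> CC R by rewrite /K; field.
rewrite K2.
have -> : K / 2 * S / B + A * (- (K / 2 * S' * t ^- 2) / B ^+ 2) =
   (K * S * B * t ^+ 2 - A * K * S') / (2 * t ^+ 2 * B ^+ 2).
  by field; apply/andP.
by rewrite -HR; field; apply/andP.
Qed.

(** The logarithmic derivative [- 1 / (2 t)] is homogeneous of degree -1, so the quotient has
    derivative zero; the constant is its value at [i]. *)
Lemma thc_ratio x : 0 < x -> exists2 kappa : CC R, kappa != 0 &
  forall t, 0 < imag t -> thc (ofR x * t) = kappa * thc t.
Proof.
move=> x0; pose F t := thc (ofR x * t) / thc t.
have i0 : 0 < imag ((0 +i* 1)%C : CC R) by exact: ltr01.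
have xt0 t : 0 < imag t -> 0 < imag (ofR x * t) by move=> t0; rewrite imag_scale mulr_gt0.
have xn0 : ofR x != 0 by rewrite -ofR0 (inj_eq (@ofR_inj R)) gt_eqF.
exists (F (0 +i* 1)%C); first by rewrite mulf_neq0 ?invr_neq0 ?thc_neq0// xt0.
move=> t t0; rewrite -(@qder0_const R F t)//.
  by rewrite /F divfK// thc_neq0.
move=> z z0.
have q1 : qder (fun w : CC R => ofR x * w) z (ofR x).
  have := qderM (qder_cst (ofR x) z) (qder_id z).
  by congr qder; rewrite /= mul0r add0r mulr1.
have := qderM (qder_comp (g := fun w => ofR x * w) (thc_qder (xt0 z z0)) q1) (qderV (thc_neq0 z0) (thc_qder z0)).
congr qder; field.
by rewrite thc_neq0 ?xn0 ?(imag_neq0 z0)//.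
Qed.

End HeatEquation.

(** * Theta series with characteristics and their inversion *)

Section TwistedTheta.
Context {R : realType}.
Implicit Types (tau t b be : CC R) (n k : int).

(* The theta series with characteristics; here [b] may be any complex number. *)
Definition tw tau be b n : CC R := ee (n%:~R * be + tau / 2 * (n%:~R - b) ^+ 2).

Lemma tw_gw tau be b n : tau != 0 ->
  tw tau be b n = ee (be * b - be ^+ 2 / (2 * tau)) * gw tau (- b + be / tau) n.
Proof. by move=> t0; rewrite /tw /gw -eeD; congr ee; field. Qed.

Lemma tw_zgeo tau be b : 0 < imag tau -> zgeo (tw tau be b).
Proof.
move=> t0; have tn0 := imag_neq0 t0.
have := zgeoM (ee (be * b - be ^+ 2 / (2 * tau))) (gw_zgeo (- b + be / tau) t0).
by congr zgeo; apply/funext => n; rewrite tw_gw.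
Qed.

Lemma gsum_inversion tau z : 0 < imag tau -> gsum tau z = thc tau * thz (- tau^-1) z.
Proof.
move=> t0; have B0 := th3_neq0 (imag_inv t0).
have := theta_proportional z 0 t0.
have -> : gsum tau 0 = th3 tau by rewrite gsum_thz// expr0n/= !mulr0 ee0 mul1r thz0.
rewrite -[zsum (tht _ 0)]/(th3 _) -[zsum (tht _ z)]/(thz _ z) => H.
apply: (mulIf B0); rewrite H /thc; field; exact: B0.
Qed.

(** The characteristics change roles: the twist [be] becomes a shift of the index, the centre [b]
    becomes a twist. *)
Lemma tw_inversion tau be b : 0 < imag tau ->
  zsum (tw tau be b) = thc tau * zsum (fun k => ee (- (k%:~R - be) * b + (- tau^-1) / 2 * (k%:~R - be) ^+ 2)).
Proof.
move=> t0; have tn0 := imag_neq0 t0; have p0 := imag_inv t0.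
have -> : tw tau be b = (fun n => ee (be * b - be ^+ 2 / (2 * tau)) * gw tau (- b + be / tau) n).
  by apply/funext => n; rewrite tw_gw.
rewrite zsumM; last exact: gw_zgeo.
rewrite -/(gsum _ _) gsum_inversion// mulrCA; congr (thc _ * _).
rewrite /thz -zsumM; last exact: tht_zgeo.
by congr zsum; apply/funext => n; rewrite /tht -eeD; congr ee; field.
Qed.

Lemma eq_zsum (f g : int -> CC R) : (forall n, f n = g n) -> zsum f = zsum g.
Proof. by move=> H; congr zsum; apply/funext. Qed.

(** [n] and [- n - 1] are exactly the two terms paired in [Zsum], so every partial sum vanishes. *)
Lemma zsum_antisym (f : int -> CC R) : (forall n, f (- n - 1) = - f n) -> zsum f = 0.
Proof.
move=> H; apply: zsum_unique; suff -> : Zsum f = (fun=> 0) by exact: (@cvgC_cst R nat \oo _ 0).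
apply/funext => K; rewrite /Zsum big1// => n _.
have -> : - n.+1%:Z = - n%:Z - 1 by lia.
by rewrite H addrN.
Qed.

Lemma zgeo_pred (f : int -> CC R) : zgeo f -> zgeo (fun n => f (n - 1)).
Proof.
move=> Hf; have := zgeoN (zgeoS (zgeoN Hf)); congr zgeo; apply/funext => n; congr f; lia.
Qed.

Lemma zsum_pred (f : int -> CC R) : zgeo f -> zsum (fun n => f (n - 1)) = zsum f.
Proof.
by move=> Hf; rewrite -(zsumS (zgeo_pred Hf)); apply: eq_zsum => n; rewrite addrK.
Qed.

Lemma zgeo_shift (f : int -> CC R) k : zgeo f -> zgeo (fun n => f (n + k)).
Proof.
move=> Hf; elim: k => [|m IH|m IH].
- by move: Hf; congr zgeo; apply/funext => n; rewrite addr0.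
- by have := zgeoS IH; congr zgeo; apply/funext => n; congr f; lia.
- by have := zgeo_pred IH; congr zgeo; apply/funext => n; congr f; lia.
Qed.

Lemma zsum_shift (f : int -> CC R) k : zgeo f -> zsum (fun n => f (n + k)) = zsum f.
Proof.
move=> Hf; elim: k => [|m IH|m IH].
- by apply: eq_zsum => n; rewrite addr0.
- rewrite -[RHS]IH -(zsumS (zgeo_shift m Hf)); apply: eq_zsum => n.
  by have -> : (n + m.+1 = n + 1 + m)%R by lia.
- rewrite -[RHS]IH -(zsum_pred (zgeo_shift (- m%:Z) Hf)); apply: eq_zsum => n.
  by have -> : (n - m.+1%:Z = n - 1 - m%:Z)%R by lia.
Qed.

Lemma zsum_parity (f : int -> CC R) : zgeo f ->
  zsum f = zsum (fun n => f (2 * n)) + zsum (fun n => f (2 * n + 1)).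
Proof.
move=> Hf; rewrite (zsum_split (P := 2))// !big_ord_recl big_ord0 addr0.
by congr (_ + _); apply: eq_zsum => n /=; rewrite mulrC ?addr0.
Qed.

(* Odd integers are grouped according to their class up to sign modulo
   [2 * (2 * m + 1)]; the last term collects the odd multiples of [2 * m + 1]. *)
Lemma zsum_odd_classes (F : int -> CC R) (m : nat) : zgeo (fun k => F (2 * k + 1)) ->
  zsum (fun k => F (2 * k + 1)) =
  \sum_(i < m) zsum (fun n => F (2 * (m.*2.+1)%:Z * n + (i.*2.+1)%:Z) +
                              F (- (2 * (m.*2.+1)%:Z * n + (i.*2.+1)%:Z))) +
  zsum (fun n => F ((m.*2.+1)%:Z * (2 * n + 1))).
Proof.
move=> HF; set N := m.*2.+1.
have HFi i : zgeo (fun n => F (2 * (n * N%:Z + i%:Z) + 1)).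
  exact: (zgeo_split (P := N) i isT HF).
(* The classes of [k] modulo [N]: those below [m], then [m] itself, where [2 k + 1 = N], then those
   above, matched with the first by [k |-> N - 1 - k]. *)
have NE : N = (m + (1 + m))%N by rewrite /N -addnn; lia.
rewrite (zsum_split (P := m + (1 + m)))//; last by rewrite -NE.
rewrite big_split_ord big_split_ord big_ord1 /= -NE.
rewrite addrCA addrC; congr (_ + _); last first.
  by apply: eq_zsum => n; congr F; rewrite /N; lia.
rewrite [X in _ + X](reindex_inj rev_ord_inj) /= -big_split/=.
apply: eq_bigr => i _.
set f1 := fun n => F (2 * (n * N%:Z + i%:Z) + 1).
set f2 := fun n => F (2 * (n * N%:Z + (m + (1 + (m - i.+1)))%N%:Z) + 1).
have h1 : zgeo f1 by exact: HFi.
have h2 : zgeo f2 by exact: HFi.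
have -> : zsum f2 = zsum (fun n => F (- (2 * N%:Z * n + (i.*2.+1)%:Z))).
  rewrite -(zsumN h2) -(zsum_shift 1 (zgeoN h2)); apply: eq_zsum => n; rewrite /f2; congr F.
  by have := ltn_ord i; rewrite /N; lia.
rewrite -zsumD//; first by apply: eq_zsum => n; rewrite /f1; congr (F _ + _); lia.
have := zgeo_shift 1 (zgeoN h2); congr zgeo; apply/funext => n; rewrite /f2; congr F.
by have := ltn_ord i; rewrite /N; lia.
Qed.

End TwistedTheta.

(** * The entries of the vector as theta quotients *)

Section ThetaQuotients.
Context {R : realType}.
Implicit Types (N a t u : CC R) (n k : int).

Lemma ee_period x y n : x = y + n%:~R -> ee x = ee y :> CC R.
Proof. by move=> ->; rewrite eeD ee_int mulr1. Qed.

Lemma ee_antiperiod x y n : x = y + n%:~R + 1 / 2 -> ee x = - ee y :> CC R.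
Proof. by move=> ->; rewrite 2!eeD ee_int ee_half mulr1 mulrN1. Qed.

(* With [a = 2 j - 1], the products in [g_j] and [g_j^\vee] are [thA], [thB] and
   [thC] up to a power of [q]; [thD1] is [(q, q^3, q^4; q^4)] up to [q^(1/8)]. *)
Definition thA N a t := zsum (tw (4 * N * t) (1 / 2) (a / (2 * N))).
Definition thB N a t := zsum (tw (4 * N * t) (1 / 2) ((N - 2 * a) / (4 * N))) +
                        zsum (tw (4 * N * t) (1 / 2) (- (N + 2 * a) / (4 * N))).
Definition thC N a t := zsum (tw (N * t) (1 / 2) (a / (2 * N))).
Definition thD1 t := zsum (tw (4 * t) (1 / 2) (1 / 4)).
Definition thD2 t := zsum (tw (4 * t) (1 / 2) 0).

Lemma imag_natM (n : nat) t : imag (n%:R * t) = n%:R * imag t.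
Proof. by rewrite -[n%:R]ofR_nat imag_scale. Qed.

Lemma imag_natM_gt0 (n : nat) t : (0 < n)%N -> 0 < imag t -> 0 < imag (n%:R * t).
Proof. by move=> n0 t0; rewrite imag_natM mulr_gt0// ltr0n. Qed.

Lemma imagD_half t : imag (t + 1 / 2) = imag t.
Proof. by rewrite /imag ImD -[1](@ofR_nat R 1) -[2](@ofR_nat R 2) -ofRV -ofRM /= addr0. Qed.

Lemma natr_neq0 (n : nat) : (0 < n)%N -> (n%:R : CC R) != 0.
Proof. by move=> n0; rewrite pnatr_eq0 -lt0n. Qed.

(** Triple product with [zeta = t] and [P = 4 t]; completing the square moves the centre to [1 / 4]
    and leaves [ee (- t / 8)]. The other products are treated in the same way. *)
Lemma qprod_D1 t : 0 < imag t ->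
  qpochs [:: ee t; ee t ^+ 3; ee t ^+ 4] (ee t ^+ 4) = ee (- (t / 8)) * thD1 t.
Proof.
move=> t0; have t4 : 0 < imag (4 * t) by exact: imag_natM_gt0.
have h : cmod (1 : CC R) <= 1 by rewrite cmod1.
have E1 : ee t = 1 * ee t ^+ 1 by rewrite mul1r.
have E3 : ee (4 * t - t) = 1 * ee t ^+ 3 by rewrite mul1r eeX; congr ee; ring.
have E4 : ee (4 * t) = 1 * ee t ^+ 4 by rewrite mul1r eeX.
have := triple_product_zsum (cmod_ee_lt1 t0) h h h (isT : 0 < 1)%N (isT : 0 < 3)%N (isT : 0 < 4)%N t4 E1 E3 E4.
rewrite !mul1r expr1 => ->; rewrite -zsumM; last exact: tw_zgeo.
by apply: eq_zsum => n; rewrite /tht /tw -eeD; congr ee; field.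
Qed.

Lemma qprod_D2 t : 0 < imag t ->
  qpochs [:: ee t ^+ 2; ee t ^+ 2; ee t ^+ 4] (ee t ^+ 4) = thD2 t.
Proof.
move=> t0; have t4 : 0 < imag (4 * t) by exact: imag_natM_gt0.
have h : cmod (1 : CC R) <= 1 by rewrite cmod1.
have E1 : ee (2 * t) = 1 * ee t ^+ 2 by rewrite mul1r eeX.
have E3 : ee (4 * t - 2 * t) = 1 * ee t ^+ 2 by rewrite mul1r eeX; congr ee; ring.
have E4 : ee (4 * t) = 1 * ee t ^+ 4 by rewrite mul1r eeX.
have := triple_product_zsum (cmod_ee_lt1 t0) h h h (isT : 0 < 2)%N (isT : 0 < 2)%N (isT : 0 < 4)%N t4 E1 E3 E4.
rewrite !mul1r => ->.
by apply: eq_zsum => n; rewrite /tht /tw; congr ee; field.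
Qed.

Lemma thD1_neq0 t : 0 < imag t -> thD1 t != 0.
Proof.
move=> t0; have h : cmod (1 : CC R) <= 1 by rewrite cmod1.
have := triple_product_neq0 (cmod_ee_lt1 t0) h h h (isT : 0 < 1)%N (isT : 0 < 3)%N (isT : 0 < 4)%N.
by rewrite !mul1r expr1 qprod_D1// mulf_eq0 negb_or => /andP[].
Qed.

Lemma thD2_neq0 t : 0 < imag t -> thD2 t != 0.
Proof.
move=> t0; have h : cmod (1 : CC R) <= 1 by rewrite cmod1.
have := triple_product_neq0 (cmod_ee_lt1 t0) h h h (isT : 0 < 2)%N (isT : 0 < 2)%N (isT : 0 < 4)%N.
by rewrite !mul1r qprod_D2.
Qed.

Section Index.
Variables r i : nat.
Hypotheses (i_lt : (i < 2 * r - 1)%N).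
Let N : CC R := (4 * r - 1)%:R.
Let a : CC R := i.*2.+1%:R.

Let N_gt0 : (0 < 4 * r - 1)%N. Proof. lia. Qed.
Let N0 : N != 0. Proof. exact: natr_neq0. Qed.
Let NE : N = 4 * r%:R - 1.
Proof. by rewrite /N natrB ?natrM//; lia. Qed.
Let aE : a = 2 * i%:R + 1.
Proof. by rewrite /a -addn1 natrD -muln2 natrM mulrC. Qed.
Let N8 : 32 * r%:R - 8 != 0 :> CC R.
Proof. have -> : 32 * r%:R - 8 = 8 * N by rewrite NE; ring.
by rewrite mulf_neq0// natr_neq0. Qed.
Let N16 : 16 * r%:R - 4 != 0 :> CC R.
Proof. have -> : 16 * r%:R - 4 = 4 * N by rewrite NE; ring.
by rewrite mulf_neq0// natr_neq0. Qed.
Let rE : (r%:R : CC R) = (N + 1) / 4.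
Proof. by rewrite NE; field. Qed.
Let iE : (i%:R : CC R) = (a - 1) / 2.
Proof. by rewrite aE; field. Qed.

Lemma qprod_A t : 0 < imag t ->
  qpochs [:: ee t ^+ (8 * r - 4 * i.+1); ee t ^+ (8 * r + 4 * i.+1 - 4);
             ee t ^+ (16 * r - 4)] (ee t ^+ (16 * r - 4)) =
  ee (- (a ^+ 2 / (2 * N) * t)) * thA N a t.
Proof.
move=> t0.
have t4 : 0 < imag (4 * N * t).
  by rewrite /N -natrM; apply: imag_natM_gt0 => //; lia.
have h : cmod (1 : CC R) <= 1 by rewrite cmod1.
have E1 : ee ((8 * r - 4 * i.+1)%:R * t) = 1 * ee t ^+ (8 * r - 4 * i.+1) by rewrite mul1r eeX.
have e1 : (8 * r - 4 * i.+1)%:R = 2 * N - 2 * a :> CC R.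
  by rewrite natrB ?natrM -?natr1 ?rE ?iE; [field | lia].
have E3 : ee (4 * N * t - (8 * r - 4 * i.+1)%:R * t) = 1 * ee t ^+ (8 * r + 4 * i.+1 - 4).
  rewrite mul1r eeX; congr ee; rewrite e1.
  by rewrite natrB ?natrD ?natrM -?natr1 ?rE ?iE; [field | lia].
have E4 : ee (4 * N * t) = 1 * ee t ^+ (16 * r - 4).
  rewrite mul1r eeX; congr ee.
  by rewrite natrB ?natrD ?natrM -?natr1 ?rE ?iE; [field | lia].
have := triple_product_zsum (cmod_ee_lt1 t0) h h h _ _ _ t4 E1 E3 E4.
rewrite !mul1r => ->; try lia; rewrite -zsumM; last exact: tw_zgeo.
by apply: eq_zsum => n; rewrite /tht /tw -eeD e1; congr ee; field; rewrite N0.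
Qed.

(** The nome [- q ^ N] is [ee (N t + 1 / 2)]. Its half gives the phase [ee (n ^ 2 / 4)], constant on
    each parity of [n], so even and odd [n] yield the two series of [thB]. *)
Lemma qprod_B t : 0 < imag t ->
  qpochs [:: - ee t ^+ (2 * i.+1 - 1); ee t ^+ (4 * r - 2 * i.+1);
             - ee t ^+ (4 * r - 1)] (- ee t ^+ (4 * r - 1)) =
  ee (- ((N - 2 * a) ^+ 2 / (8 * N) * t)) * thB N a t.
Proof.
move=> t0.
have t4 : 0 < imag (N * t + 1 / 2) by rewrite imagD_half imag_natM_gt0.
have tN : 0 < imag (4 * N * t).
  by rewrite /N -natrM; apply: imag_natM_gt0 => //; lia.
have h : cmod (1 : CC R) <= 1 by rewrite cmod1.
have h' : cmod (-1 : CC R) <= 1 by rewrite cmodN cmod1.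
have E1 : ee (a * t + 1 / 2) = -1 * ee t ^+ (2 * i.+1 - 1).
  rewrite eeD ee_half mulrC eeX.
  by have -> : (2 * i.+1 - 1 = i.*2.+1)%N by lia.
have E3 : ee (N * t + 1 / 2 - (a * t + 1 / 2)) = 1 * ee t ^+ (4 * r - 2 * i.+1).
  have e3 : (4 * r - 2 * i.+1)%:R = N - a :> CC R.
    by rewrite natrB ?natrM -?natr1 ?rE ?iE; [field | lia].
  by rewrite [RHS]mul1r eeX e3; have -> : N * t + 1 / 2 - (a * t + 1 / 2) = (N - a) * t by field.
have E4 : ee (N * t + 1 / 2) = -1 * ee t ^+ (4 * r - 1).
  by rewrite eeD ee_half mulrC eeX.
have := triple_product_zsum (cmod_ee_lt1 t0) h' h h' _ _ _ t4 E1 E3 E4.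
rewrite ![-1 * ee t ^+ _]mulN1r ![1 * ee t ^+ _]mul1r => ->; try lia.
rewrite zsum_parity; last exact: tht_zgeo.
rewrite mulrDr; congr (_ + _); rewrite -zsumM; try exact: tw_zgeo.
  apply: eq_zsum => n; rewrite /tht /tw -eeD; apply: (ee_period (n := n ^+ 2 + n)).
  by field; rewrite N0.
apply: eq_zsum => n; rewrite /tht /tw -eeD; apply: (ee_period (n := n ^+ 2 + 2 * n + 1)).
by field; rewrite N0.
Qed.

(** The powers of [q] in the definition of [g] are exactly those left over by completing the
    squares. *)
Lemma g_theta t : 0 < imag t ->
  g r i.+1 t = thA N a t / thD1 t + thB N a t / thD2 t.
Proof.
move=> t0; have d1 := thD1_neq0 t0; have d2 := thD2_neq0 t0.
rewrite /g; cbv zeta; rewrite !qpowE rmorph1 mul1r qprod_A// qprod_B// qprod_D1// qprod_D2//.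
set x := ratr _ * t; set y := ratr _ * t.
have xE : x = (N - 2 * a) ^+ 2 / (8 * N) * t.
  by rewrite /x aE NE; field; rewrite -NE N0 N8.
have yE : y = (a ^+ 2 / (2 * N) - 1 / 8 - (N - 2 * a) ^+ 2 / (8 * N)) * t.
  by rewrite /y aE NE; field; rewrite -NE N0.
have e1 : ee x * (ee y * (ee (- (a ^+ 2 / (2 * N) * t)) / ee (- (t / 8)))) = 1.
  by rewrite -eeN -!eeD xE yE -[RHS]ee0; congr ee; field; rewrite N0.
have e2 : ee x * ee (- ((N - 2 * a) ^+ 2 / (8 * N) * t)) = 1.
  by rewrite -eeD xE subrr ee0.
have aux (X Y E F A D E' B D' : CC R) : X * (Y * (E / F)) = 1 -> X * E' = 1 ->
    X * (Y * (E * A / (F * D)) + E' * B / D') = A / D + B / D'.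
  move=> H1 H2; rewrite mulrDr -[E' * B / D']mulrA [X * (E' * _)]mulrA H2 mul1r.
  by congr (_ + _); rewrite -[RHS]mul1r -H1 invfM; ring.
exact: aux.
Qed.

Lemma qquotient_C u : 0 < imag u ->
  qpochs [:: ee u ^+ (2 * r - i.+1); ee u ^+ (2 * r + i.+1 - 1); ee u ^+ (4 * r - 1)]
     (ee u ^+ (4 * r - 1)) / qpochs [:: ee u; ee u ^+ 3; ee u ^+ 4] (ee u ^+ 4) =
  ee (- ((a ^+ 2 - N) / (8 * N) * u)) * (thC N a u / thD1 u).
Proof.
move=> u0.
have t4 : 0 < imag (N * u) by exact: imag_natM_gt0.
have h : cmod (1 : CC R) <= 1 by rewrite cmod1.
have E1 : ee ((2 * r - i.+1)%:R * u) = 1 * ee u ^+ (2 * r - i.+1) by rewrite mul1r eeX.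
have e1 : (2 * r - i.+1)%:R = (N - a) / 2 :> CC R.
  by rewrite natrB ?natrM -?natr1 ?rE ?iE; [field | lia].
have E3 : ee (N * u - (2 * r - i.+1)%:R * u) = 1 * ee u ^+ (2 * r + i.+1 - 1).
  rewrite mul1r eeX; congr ee; rewrite e1.
  by rewrite natrB ?natrD ?natrM -?natr1 ?rE ?iE; [field | lia].
have E4 : ee (N * u) = 1 * ee u ^+ (4 * r - 1) by rewrite mul1r eeX.
have := triple_product_zsum (cmod_ee_lt1 u0) h h h _ _ _ t4 E1 E3 E4.
rewrite !mul1r => ->; try lia; rewrite qprod_D1//.
have -> : zsum (tht (N * u) ((2 * r - i.+1)%:R * u - N * u / 2 + 2^-1)) =
    ee (- (a ^+ 2 / (8 * N) * u)) * thC N a u.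
  rewrite -zsumM; last exact: tw_zgeo.
  by apply: eq_zsum => n; rewrite /tht /tw -eeD e1; congr ee; field; rewrite N0.
have d1 := thD1_neq0 u0; rewrite [(_ * thD1 u)^-1]invfM -[(ee (- (u / 8)))^-1]eeN mulrACA -eeD; congr (ee _ * _); field.
by rewrite N0.
Qed.

(** Since [- q = ee (u + 1 / 2)] and [4 r - 1] is odd, the second summand is the first one at
    [u + 1 / 2]. The root of unity arises because the common power of [q] is still taken at [u]. *)
Lemma gdual_double_theta u : 0 < imag u ->
  gdual_double r i.+1 u = 2^-1 * (thC N a u / thD1 u +
    (-1) ^+ ((i.+1 * i) %/ 2) * ee (- ((a ^+ 2 - N) / (16 * N))) *
    (thC N a (u + 1 / 2) / thD1 (u + 1 / 2))).
Proof.
move=> u0; have v0 : 0 < imag (u + 1 / 2) by rewrite imagD_half.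
have aux (e X Z S X' Z' W : CC R) : X = X' -> Z = Z' ->
  2^-1 * e * (X' + S * Z') = W -> 2^-1 * e * (X + S * Z) = W by move=> -> ->.
rewrite /gdual_double; cbv zeta; rewrite !qpowE rmorph1 ![1 * u]mul1r.
have -> : (i.+1 * (i.+1 - 1) = i.+1 * i)%N by rewrite subn1.
have Q : - ee u = ee (u + 1 / 2) by rewrite eeD ee_half mulrN1.
have Q3 : - ee u ^+ 3 = ee (u + 1 / 2) ^+ 3 by rewrite -Q; ring.
have Q4 : ee u ^+ 4 = ee (u + 1 / 2) ^+ 4 by rewrite -Q; ring.
have QN : - ee u ^+ (4 * r - 1) = ee (u + 1 / 2) ^+ (4 * r - 1).
  rewrite -Q exprNn -signr_odd.
  have o : odd (4 * r - 1) by rewrite oddB ?oddM//; move: i_lt; clear; lia.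
  by rewrite o expr1 mulN1r.
apply: (aux _ _ _ _ _ _ _ (qquotient_C u0)).
  rewrite Q Q3 QN Q4; exact: (qquotient_C v0).
set x := ratr _ * u; have -> : x = (a ^+ 2 - N) / (8 * N) * u.
  by rewrite /x aE NE; field; rewrite -NE N0 N16.
have aux2 (X s E E' A B : CC R) : X * E = 1 -> X * E' = A ->
    forall Z, 2^-1 * X * (E * Z + s * (E' * B)) = 2^-1 * (Z + s * A * B).
  by move=> H <- Z; rewrite -[in RHS](mul1r Z) -H; ring.
apply: aux2; first by rewrite -eeD subrr ee0.
by rewrite -eeD; congr ee; field; exact: N0.
Qed.

End Index.
End ThetaQuotients.

(** * Inversion of the theta series of level [N] *)

Section ThetaInversions.
Context {R : realType}.
Implicit Types (N a t u tau b be : CC R) (n k : int).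

Lemma thc_sum_zgeo tau be b : 0 < imag tau ->
  zgeo (fun k => ee (- (k%:~R - be) * b + (- tau^-1) / 2 * (k%:~R - be) ^+ 2)).
Proof.
move=> t0; have := zgeoM (ee (be * b)) (tw_zgeo (- b) be (imag_inv t0)).
by congr zgeo; apply/funext => k; rewrite /tw -eeD; congr ee; ring.
Qed.

(** For the twist [1 / 2] the inverted series runs over [k - 1 / 2 = n / 2] with [n] odd; its term
    is written as a function of [n]. *)
Definition oddF tau b n : CC R := ee (- (n%:~R / 2 * b) - tau^-1 / 8 * n%:~R ^+ 2).

Lemma oddF_shift tau b n :
  ee (- ((n + 1)%:~R - 1 / 2) * b + (- tau^-1) / 2 * ((n + 1)%:~R - 1 / 2) ^+ 2) =
  oddF tau b (2 * n + 1).
Proof.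
rewrite /oddF; congr ee.
have -> : (n + 1)%:~R - 1 / 2 = (2 * n + 1)%:~R / 2 :> CC R by field.
set x := _%:~R / 2; have -> : (2 * n + 1)%:~R = 2 * x by rewrite /x; field.
by move: (tau^-1) => s; field.
Qed.

Lemma oddF_zgeo tau b : 0 < imag tau -> zgeo (fun n => oddF tau b (2 * n + 1)).
Proof.
move=> t0; have := zgeoS (thc_sum_zgeo (1 / 2) b t0).
by congr zgeo; apply/funext => n; rewrite oddF_shift.
Qed.

Lemma tw_inversion_half tau b : 0 < imag tau ->
  zsum (tw tau (1 / 2) b) = thc tau * zsum (fun n => oddF tau b (2 * n + 1)).
Proof.
move=> t0; rewrite tw_inversion// -(zsumS (thc_sum_zgeo _ _ t0)).
by congr (_ * _); apply: eq_zsum => n; rewrite oddF_shift.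
Qed.

(* [w8 = sqrt 2] and [mc N a b = 2 cos (pi a b / (2 N))] for real [a], [b]. *)
Definition w8 : CC R := ee (1 / 8) + ee (- (1 / 8)).
Definition mc N a b : CC R := ee (a * b / (4 * N)) + ee (- (a * b / (4 * N))).

Lemma mc_ee N a b x : mc N a b * ee x = ee (a * b / (4 * N) + x) + ee (- (a * b / (4 * N)) + x).
Proof. by rewrite /mc mulrDl -!eeD. Qed.

Lemma w8_sqr : w8 ^+ 2 = 2.
Proof.
rewrite /w8 sqrrD -eeD subrr ee0 2!eeX.
have -> : ee (2%:R * (1 / 8)) = - ee (2%:R * - (1 / 8)) :> CC R.
  by apply: (ee_antiperiod (n := 0)); field.
by ring.
Qed.

Lemma w8_neq0 : w8 != 0.
Proof. by apply/eqP => H; have := w8_sqr; rewrite H expr0n => /eqP; rewrite eq_sym pnatr_eq0. Qed.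

Lemma int_pronic n : exists m, n * (n - 1) = 2 * m.
Proof.
have : n = 2 * (n %/ 2)%Z \/ n = 2 * (n %/ 2)%Z + 1 by lia.
set m := (n %/ 2)%Z => -[] ->; [exists (m * (2 * m - 1)) | exists ((2 * m + 1) * m)]; ring.
Qed.

Lemma sgn_ee (h : nat) : (-1) ^+ h = ee (h%:R / 2) :> CC R.
Proof. by rewrite -ee_half eeX; congr ee; field. Qed.

(** The factor [ee (n (n - 1) / 4)] is a sign of period 4 in [n]. It is resolved into two linear
    characters, to which theta inversion applies. *)
Lemma w8_ee n : w8 * ee (n%:~R * (n%:~R - 1) / 4) =
  ee ((2 * n%:~R - 1) / 8) + ee (- ((2 * n%:~R - 1) / 8)).
Proof.
have : n = 2 * (n %/ 2)%Z \/ n = 2 * (n %/ 2)%Z + 1 by lia.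
set m := (n %/ 2)%Z => -[] ->; rewrite /w8 mulrDl -!eeD.
  rewrite addrC; congr (_ + _).
    by apply: (ee_period (n := m ^+ 2 - m)); field.
  by apply: (ee_period (n := m ^+ 2)); field.
congr (_ + _).
  by apply: (ee_period (n := m ^+ 2)); field.
by apply: (ee_period (n := m ^+ 2 + m)); field.
Qed.

Lemma imag_fricke t : 0 < imag t -> 0 < imag (- (4 * t)^-1).
Proof. by move=> t0; apply: imag_inv; exact: imag_natM_gt0. Qed.

(** The argument is half of [- 1 / (2 t)], as [gdual] evaluates [gdual_double] at half its argument.
    The two parity classes of the inverted series both give [thD1 t], with coefficients [ee (1 / 8)]
    and [ee (- 1 / 8)]. *)
Lemma thD1_fricke t : 0 < imag t -> thD1 (- (4 * t)^-1) = thc (- t^-1) * (w8 * thD1 t).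
Proof.
move=> t0; have tn0 := imag_neq0 t0; have t1 := imag_inv t0.
have t4 : 0 < imag (4 * t) by exact: imag_natM_gt0.
rewrite /thD1; have -> : 4 * - (4 * t)^-1 = - t^-1 by field.
have gz := oddF_zgeo (1 / 4) t1; have gD := tw_zgeo (1 / 2) (1 / 4) t4.
rewrite tw_inversion_half// zsum_parity//; congr (_ * _).
rewrite /w8 mulrDl addrC; congr (_ + _); rewrite -zsumM//; last first.
  rewrite -(zsumN (zgeoM _ gD)); apply: eq_zsum => n; rewrite /oddF /tw -eeD.
  by apply: (ee_period (n := 0)); field.
rewrite -(zsumS (zgeoM _ gD)).
apply: eq_zsum => n; rewrite /oddF /tw -eeD.
by apply: (ee_period (n := - (n + 1))); field.
Qed.

(** The half shift contributes [ee ((n - 1 / 4) ^ 2)], which cancels the twist [1 / 2]. After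
    inversion the odd terms cancel in pairs and the even ones form [thD2]. *)
Lemma thD1_fricke_half t : 0 < imag t ->
  thD1 (- (4 * t)^-1 + 1 / 2) = thc (- t^-1) * (ee (1 / 16) * thD2 t).
Proof.
move=> t0; have tn0 := imag_neq0 t0; have t1 := imag_inv t0.
have t4 : 0 < imag (4 * t) by exact: imag_natM_gt0.
have gz := thc_sum_zgeo 0 (1 / 4) t1; have gD := tw_zgeo (1 / 2) 0 t4.
have -> : thD1 (- (4 * t)^-1 + 1 / 2) = ee (1 / 16) * zsum (tw (- t^-1) 0 (1 / 4)).
  rewrite -zsumM; last exact: tw_zgeo.
  apply: eq_zsum => n; rewrite /tw -eeD; apply: (ee_period (n := n ^+ 2)).
  by field.
rewrite tw_inversion// mulrCA zsum_parity//; congr (_ * (_ * _)).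
rewrite [X in _ + X](_ : _ = 0) ?addr0.
  rewrite /thD2 -(zsumN gD).
  by apply: eq_zsum => n; rewrite /tw; apply: (ee_period (n := 0)); field.
apply: zsum_antisym => n; apply: (ee_antiperiod (n := n)); field; exact: tn0.
Qed.

Section Index.
Variables r i : nat.
Hypotheses (r_gt0 : (0 < r)%N).
Let N : CC R := (4 * r - 1)%:R.
Let a : CC R := i.*2.+1%:R.

Let N_gt0 : (0 < 4 * r - 1)%N. Proof. lia. Qed.
Let N0 : N != 0. Proof. exact: natr_neq0. Qed.
Let NE : N = 4 * r%:R - 1.
Proof. by rewrite /N natrB ?natrM//; lia. Qed.
Let aE : a = 2 * i%:R + 1.
Proof. by rewrite /a -addn1 natrD -muln2 natrM mulrC. Qed.
Let mN : (2 * r - 1).*2.+1 = (4 * r - 1)%N. Proof. lia. Qed.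

Lemma thC_fricke t : 0 < imag t ->
  thC N a (- (4 * t)^-1) = thc (- (N / (4 * t))) *
    \sum_(k < 2 * r - 1) mc N a k.*2.+1%:R * thA N k.*2.+1%:R t.
Proof.
move=> t0; have tn0 := imag_neq0 t0; have t1 := imag_fricke t0.
have tau0 : 0 < imag (- (N / (4 * t))).
  by have := imag_natM_gt0 N_gt0 t1; rewrite mulrN.
have t4 : 0 < imag (4 * N * t).
  by rewrite /N -natrM; apply: imag_natM_gt0 => //; lia.
have gz := oddF_zgeo (a / (2 * N)) tau0.
rewrite /thC mulrN tw_inversion_half// (zsum_odd_classes (2 * r - 1))// mN.
(* At opposite odd multiples of [N] the terms differ by the phase [ee] of an odd multiple of
   [a / 2], which is -1 as [a] is odd. *)
rewrite [X in _ + X]zsum_antisym ?addr0; last first.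
  move=> n; apply: (ee_antiperiod (n := (2 * n + 1) * i%:Z + n)); rewrite aE /N; field.
  by rewrite -/N N0 tn0.
congr (_ * _); apply: eq_bigr => k _.
have gA := tw_zgeo (1 / 2) (k.*2.+1%:R / (2 * N)) t4.
rewrite /thA -(zsumN gA) -zsumM; last exact: zgeoN.
apply: eq_zsum => n; rewrite mc_ee addrC /oddF /tw; congr (_ + _).
  apply: (ee_period (n := n * (i%:Z + 1))); rewrite aE /N; field.
  by rewrite -/N N0.
apply: (ee_period (n := - (n * i%:Z))); rewrite aE /N; field.
by rewrite -/N N0.
Qed.

(** The half shift adds a quadratic phase of period 4 in [n]; [w8_ee] resolves it into the twists
    [1 / 4] and [- 1 / 4], at the price of the factor [w8]. The two inverted series are then merged
    into one over odd integers. *)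
Lemma thC_fricke_half t : 0 < imag t ->
  w8 * (-1) ^+ ((i.+1 * i) %/ 2) * thC N a (- (4 * t)^-1 + 1 / 2) =
  thc (- (N / (4 * t))) * (ee (a ^+ 2 / (16 * N)) *
    \sum_(k < 2 * r - 1) mc N a k.*2.+1%:R * thB N k.*2.+1%:R t).
Proof.
move=> t0; have tn0 := imag_neq0 t0; have t1 := imag_fricke t0.
have tau0 : 0 < imag (- (N / (4 * t))).
  by have := imag_natM_gt0 N_gt0 t1; rewrite mulrN.
have tau1 : 0 < imag (N * (- (4 * t)^-1 + 1 / 2)) by rewrite imag_natM_gt0 ?imagD_half.
have t4 : 0 < imag (4 * N * t).
  by rewrite /N -natrM; apply: imag_natM_gt0 => //; lia.
have [h hE] : exists h, (i.+1 * i = 2 * h)%N.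
  by exists ((i.+1 * i) %/ 2)%N; rewrite [RHS]mulnC divnK// dvdn2 oddM /=; case: odd.
have hC : (h%:R : CC R) = i%:R * (i%:R + 1) / 2.
  have : (i.+1 * i)%:R = 2 * h%:R :> CC R by rewrite hE natrM.
  by rewrite natrM -natr1 => H; rewrite [_ * (_ + 1)]mulrC H; field.
rewrite hE mulKn//.
pose b := a / (2 * N).
have g1 := thc_sum_zgeo (- (1 / 4)) b tau0.
have g2 := thc_sum_zgeo (1 / 4) b tau0.
transitivity (ee (a ^+ 2 / (16 * N)) * (ee (a / 8) * zsum (tw (- (N / (4 * t))) (- (1 / 4)) b) +
   ee (- (a / 8)) * zsum (tw (- (N / (4 * t))) (1 / 4) b))).
  rewrite -!zsumM; try exact: tw_zgeo.
  rewrite -zsumD; try (apply: zgeoM; exact: tw_zgeo).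
  rewrite -zsumM; last by apply: zgeoD; apply: zgeoM; exact: tw_zgeo.
  apply: eq_zsum => n; rewrite sgn_ee -mulrA /tw -!eeD.
  have [w Hw] := int_pronic n.
  have wC : w%:~R = n%:~R * (n%:~R - 1) / 2 :> CC R.
    have : (n * (n - 1))%:~R = 2 * w%:~R :> CC R by rewrite Hw intrM.
    by rewrite intrM intrB => ->; field.
  set L := ee _; have -> : L = ee (a ^+ 2 / (16 * N)) *
     (ee ((i%:Z + 1 - n)%:~R * ((i%:Z + 1 - n)%:~R - 1) / 4) *
      ee (- (N / (4 * t)) / 2 * (n%:~R - b) ^+ 2)).
    (* Here [N = 4 r - 1] turns [N n ^ 2 / 4] into an integer plus a phase of the form
       [m (m - 1) / 4] with [m = i + 1 - n]. *)
    rewrite /L -!eeD; apply: (ee_period (n := r%:Z * n ^+ 2 - w)).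
    by rewrite [(_ - w)%:~R]intrB wC hC /b aE NE; field; rewrite tn0 -NE N0.
  rewrite mulrCA; congr (_ * _).
  rewrite mulrA w8_ee mulrDl -!eeD; congr (ee _ + ee _).
    by rewrite /b aE; field; rewrite N0.
  by rewrite /b aE; field; rewrite N0.
rewrite [RHS]mulrCA; congr (_ * _).
rewrite (tw_inversion (- (1 / 4)) b tau0) (tw_inversion (1 / 4) b tau0) -(zsumN g2).
set f1 := (fun k => _) in g1 *; set f2 := (fun k => _) in g2 *.
pose h1 k := ee (a / 8) * f1 k + ee (- (a / 8)) * f2 (- k).
have gh1 : zgeo h1 by apply: zgeoD; apply: zgeoM => //; exact: zgeoN.
pose G p := mc N a p%:~R * ee (t * (N - 2 * p%:~R) ^+ 2 / (8 * N)).
(* For [p = 2 l + 1] one has [(N - 2 p) / 4 = (r - 1 - l) + 1 / 4]; this uses that [N] is 3 modulo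
   4. *)
have GE l : G (2 * l + 1) = h1 (- l + (r%:Z - 1)).
  rewrite /G mc_ee /h1 /f1 /f2 -!eeD; congr (ee _ + ee _).
    by rewrite /b NE; field; rewrite -NE N0 tn0.
  by rewrite /b NE; field; rewrite -NE N0 tn0.
have gG : zgeo (fun l => G (2 * l + 1)).
  by have := zgeoN (zgeo_shift (r%:Z - 1) gh1); congr zgeo; apply/funext => l; rewrite GE.
have -> : ee (a / 8) * (thc (- (N / (4 * t))) * zsum f1) +
    ee (- (a / 8)) * (thc (- (N / (4 * t))) * zsum (fun n => f2 (- n))) =
    thc (- (N / (4 * t))) * zsum (fun l => G (2 * l + 1)).
  rewrite mulrCA [X in _ + X]mulrCA -mulrDr; congr (_ * _).
  rewrite -!zsumM//; last exact: zgeoN.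
  rewrite -zsumD; [|exact: zgeoM|by apply: zgeoM; exact: zgeoN].
  rewrite -[LHS](zsum_shift (r%:Z - 1) gh1) -(zsumN (zgeo_shift _ gh1)).
  by apply: eq_zsum => l; rewrite GE.
congr (_ * _); rewrite (zsum_odd_classes (2 * r - 1))// mN.
rewrite [X in _ + X](_ : _ = 0) ?addr0.
  apply: eq_bigr => k _.
  have gB1 := tw_zgeo (1 / 2) ((N - 2 * k.*2.+1%:R) / (4 * N)) t4.
  have gB2 := tw_zgeo (1 / 2) (- (N + 2 * k.*2.+1%:R) / (4 * N)) t4.
  rewrite /thB -zsumD// -zsumM; last exact: zgeoD.
  apply: eq_zsum => n; rewrite mulrDr; congr (_ + _).
    rewrite /G /tw !mc_ee; congr (_ + _).
      by apply: (ee_period (n := n * i%:Z)); rewrite aE /N; field; rewrite -/N N0.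
    by apply: (ee_period (n := - (n * (i%:Z + 1)))); rewrite aE /N; field; rewrite -/N N0.
  rewrite /G /tw !mc_ee addrC; congr (_ + _).
    by apply: (ee_period (n := n * i%:Z)); rewrite aE /N; field; rewrite -/N N0.
  by apply: (ee_period (n := - (n * (i%:Z + 1)))); rewrite aE /N; field; rewrite -/N N0.
rewrite -[RHS](@zsum_antisym R (fun=> 0)) => [|n]; last by rewrite oppr0.
apply: eq_zsum => n; rewrite /G; apply/eqP; rewrite mulf_eq0; apply/orP; left; apply/eqP.
rewrite /mc addrC; apply/eqP; rewrite addr_eq0; apply/eqP.
by apply: (ee_antiperiod (n := - ((2 * n + 1) * i%:Z + n + 1))); rewrite aE /N; field; rewrite -/N N0.
Qed.

End Index.
End ThetaInversions.

(** * The action of [t |-> - 1 / (2 t)] and of translations *)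

Section Fricke.
Context {R : realType}.
Implicit Types (t z s : CC R).

Lemma ee_neq1 (x : R) : 0 < `|x| < 1 -> ee (ofR x) != 1.
Proof.
move=> /andP[x0 x1]; apply/eqP => H.
have E (y : R) : `|y| <= 1 / 2 -> ee (ofR y) = 1 -> y = 0.
  move=> /one_sub_ee_ge + yE; rewrite yE subrr cmod0 => y0.
  apply/eqP; rewrite -normr_le0; lra.
have xn0 : x != 0 by rewrite -normr_gt0.
have [x12|x12] := leP `|x| (1 / 2); first by move/eqP: xn0; apply; exact: E.
have [xp|xm] := leP 0 x.
  have : x - 1 = 0.
    apply: E; last by rewrite ofRB ofR1 eeB H (ee_nat 1) divr1.
    by rewrite ger0_norm// in x1 x12; rewrite ler0_norm; lra.
  by rewrite ger0_norm// in x1; lra.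
have : x + 1 = 0.
  apply: E; last by rewrite ofRD ofR1 eeD H (ee_nat 1) mulr1.
  by rewrite ltr0_norm// in x1 x12; rewrite ger0_norm; lra.
by rewrite ltr0_norm// in x1; lra.
Qed.

Lemma sinh_coshM x y : (ee x - ee (- x)) * (ee y + ee (- y)) =
  (ee (x + y) - ee (- (x + y))) - (ee (y - x) - ee (- (y - x))) :> CC R.
Proof.
have -> : - (x + y) = - x - y by ring.
have -> : - (y - x) = x - y by ring.
by rewrite !eeD; ring.
Qed.

Lemma cosh_coshM x y : (ee x + ee (- x)) * (ee y + ee (- y)) =
  (ee (x + y) + ee (- (x + y))) + (ee (x - y) + ee (- (x - y))) :> CC R.
Proof.
have -> : - (x + y) = - x - y by ring.
have -> : - (x - y) = - x + y by ring.
by rewrite !eeD; ring.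
Qed.

Section Level.
Variable r : nat.
Hypothesis r_gt0 : (0 < r)%N.
Let N : CC R := (4 * r - 1)%:R.

Let N_gt0 : (0 < 4 * r - 1)%N. Proof. lia. Qed.
Let N0 : N != 0. Proof. exact: natr_neq0. Qed.
Let NE : N = 4 * r%:R - 1.
Proof. by rewrite /N natrB ?natrM//; lia. Qed.

(** The inversion factors of numerators and denominators leave only the constant [kap]; what remains
    are the sums of [thA / thD1] and of [thB / thD2] with equal coefficients, that is, values of
    [g]. *)
Lemma gdual_fricke : exists2 c : CC R, c != 0 & forall (i : nat) t, (i < 2 * r - 1)%N -> 0 < imag t ->
  gdual r i.+1 (- (2 * t)^-1) =
  c * \sum_(k < 2 * r - 1) mc N i.*2.+1%:R k.*2.+1%:R * g r k.+1 t.
Proof.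
(* [- N / (4 t)] is [N / 4] times [- 1 / t]. *)
have N4 : 0 < (4 * r - 1)%:R / 4 :> R by rewrite divr_gt0 ?ltr0n.
have [kap kap0 Hkap] := thc_ratio N4.
have w0 := @w8_neq0 R.
exists (2^-1 * kap / w8) => [|i t i_lt t0]; first by rewrite !mulf_neq0 ?invr_eq0.
have tn0 := imag_neq0 t0; have t1 := imag_inv t0; have u0 := imag_fricke t0.
rewrite /gdual; have -> : - (2 * t)^-1 / 2 = - (4 * t)^-1 by field.
rewrite gdual_double_theta// thD1_fricke// thD1_fricke_half// -/N.
set a : CC R := i.*2.+1%:R; set sg : CC R := (-1) ^+ _.
have kE : thc (- (N / (4 * t))) = kap * thc (- t^-1).
  by rewrite -Hkap//; congr thc; rewrite ofRM ofRV !ofR_nat -/N; field.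
have c0 := thc_neq0 t1; have d1 := thD1_neq0 t0; have d2 := thD2_neq0 t0.
have := thC_fricke i r_gt0 t0; have := thC_fricke_half i r_gt0 t0.
rewrite -/N -/a kE -/sg.
set SA := \sum_(k < _) _ * thA _ _ _; set SB := \sum_(k < _) _ * thB _ _ _ => HB ->.
set C' := thC _ _ _ in HB *.
have HB' : sg * C' = kap * thc (- t^-1) * (ee (a ^+ 2 / (16 * N)) * SB) / w8 by rewrite -HB; field.
(* The root of unity of [gdual_double_theta] cancels against those of the two half-shifted
   inversions, so that the constant is the same for all [i]. *)
have eE : ee (1 / 16) = ee (- ((a ^+ 2 - N) / (16 * N))) * ee (a ^+ 2 / (16 * N)) :> CC R.
  by rewrite -eeD; congr ee; field.
rewrite eE; set e1 := ee (- _); set e2 := ee (a ^+ 2 / _) in HB' *.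
have e10 : e1 != 0 by exact: ee_neq0.
have e20 : e2 != 0 by exact: ee_neq0.
have -> : sg * e1 * (C' / (thc (- t^-1) * (e1 * e2 * thD2 t))) =
    sg * C' * (e1 / (thc (- t^-1) * (e1 * e2 * thD2 t))) by rewrite mulrACA mulrA.
rewrite HB'.
have -> : \sum_(k < 2 * r - 1) mc N a k.*2.+1%:R * g r k.+1 t = SA / thD1 t + SB / thD2 t.
  rewrite /SA /SB !mulr_suml -big_split; apply: eq_bigr => k _ /=.
  by rewrite g_theta// -/N; ring.
field; by rewrite d1 d2 c0 w0 e10 e20.
Qed.

(** A Dirichlet kernel: multiplication by [z], a multiple of [sin (pi s / N)], makes the sum
    telescope, and [0 < |s| < N] keeps [z] away from zero. *)
Lemma sum_odd_mc (s : int) : s != 0 -> (absz s < 4 * r - 1)%N ->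
  \sum_(k < 2 * r - 1) (ee (s%:~R / (2 * N) * k.*2.+1%:R) + ee (- (s%:~R / (2 * N) * k.*2.+1%:R))) =
  - ee (s%:~R / 2).
Proof.
move=> s0 sN; pose f (k : nat) : CC R := ee (s%:~R / (2 * N) * k.*2%:R) - ee (- (s%:~R / (2 * N) * k.*2%:R)).
pose z : CC R := ee (s%:~R / (2 * N)) - ee (- (s%:~R / (2 * N))).
have z0 : z != 0.
  have /ee_neq1 : 0 < `|s%:~R / (4 * r - 1)%:R : R| < 1.
    rewrite normrM normfV (ger0_norm (ler0n _ _)) -intr_norm -abszE.
    by rewrite -pmulrn divr_gt0 ?ltr0n ?absz_gt0//= ltr_pdivrMr ?ltr0n// mul1r ltr_nat.
  apply: contra => /eqP H.
  have {}H : ee (s%:~R / (2 * N)) = ee (- (s%:~R / (2 * N))).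
    by apply/eqP; rewrite -subr_eq0 -/z H.
  rewrite ofRM ofR_int ofRV ofR_nat -/N.
  have -> : s%:~R / N = s%:~R / (2 * N) + s%:~R / (2 * N) by field.
  by rewrite eeD {1}H -eeD addNr ee0.
apply: (mulfI z0); rewrite mulr_sumr.
rewrite (eq_bigr (fun k : 'I_(2 * r - 1) => f k.+1 - f k)); last first.
  move=> k _; rewrite /z sinh_coshM /f; congr (ee _ - ee (- _) - (ee _ - ee (- _))).
  - by rewrite doubleS -!natr1; ring.
  - by rewrite doubleS -!natr1; ring.
  - by rewrite -!natr1; ring.
  by rewrite -!natr1; ring.
rewrite -(big_mkord xpredT (fun k => f k.+1 - f k)) telescope_sumr// /f.
have rE : (2 * r - 1).*2%:R = N - 1 :> CC R.
  by rewrite -muln2 natrM natrB ?natrM ?NE; [ring | lia].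
rewrite double0 mulr0 oppr0 subrr subr0 mulrN /z mulrBl -!eeD opprB; congr (_ - _).
  by apply: (ee_period (n := 0)); rewrite rE; field.
by apply: (ee_period (n := - s)); rewrite rE; field.
Qed.

Definition mcmx : 'M[CC R]_(2 * r - 1) := \matrix_(i, j) mc N i.*2.+1%:R j.*2.+1%:R.

(** Products of cosines become sums for [s = i + j + 1] and [s = i - j]. These have opposite parity,
    so their values cancel off the diagonal; on it they are 1 and [2 (2 r - 1) = N - 1]. *)
Lemma mcmx_sqr : mcmx *m mcmx = N%:M.
Proof.
apply/matrixP => i j; rewrite !mxE.
rewrite (eq_bigr (fun k : 'I_(2 * r - 1) =>
   (ee ((i%:Z + j%:Z + 1)%:~R / (2 * N) * k.*2.+1%:R) + ee (- ((i%:Z + j%:Z + 1)%:~R / (2 * N) * k.*2.+1%:R))) +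
   (ee ((i%:Z - j%:Z)%:~R / (2 * N) * k.*2.+1%:R) + ee (- ((i%:Z - j%:Z)%:~R / (2 * N) * k.*2.+1%:R))))); last first.
  move=> k _; rewrite !mxE /mc cosh_coshM.
  have oE (m : nat) : (m.*2.+1%:R : CC R) = 2 * m%:R + 1 by rewrite -natr1 -muln2 natrM mulrC.
  rewrite !oE; congr (ee _ + ee (- _) + (ee _ + ee (- _))); by field.
have iN := ltn_ord i; have jN := ltn_ord j.
rewrite big_split /= sum_odd_mc; [|by lia|by lia].
have [ijE|ij] := eqVneq i j.
  rewrite (eq_bigr (fun=> 2)) => [|k _]; last by rewrite ijE subrr mul0r mul0r oppr0 ee0.
  rewrite sumr_const card_ord ijE mulr1n.
  have -> : ee ((j%:Z + j%:Z + 1)%:~R / 2) = -1 :> CC R.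
    by rewrite -[X in - X]ee0; apply: (ee_antiperiod (n := j)); field.
  by rewrite -[2 *+ _]mulr_natr natrB ?natrM ?NE; [ring | lia].
rewrite sum_odd_mc; [| |by lia].
  rewrite mulr0n; apply/eqP; rewrite -opprD oppr_eq0 addr_eq0; apply/eqP.
  by apply: (ee_antiperiod (n := j)); field.
by move: ij; rewrite -val_eqE /=; lia.
Qed.

Lemma diag_mulcol (m : nat) (e f : 'I_m -> CC R) :
  \col_i (e i * f i) = diag_mx (\row_i e i) *m \col_i f i.
Proof. by apply/matrixP => i j; rewrite mul_diag_mx !mxE. Qed.

Definition gfun t : 'cV[CC R]_(2 * r - 1) := \col_i g r i.+1 t.
Definition gdfun t : 'cV[CC R]_(2 * r - 1) := \col_i gdual r i.+1 t.

Lemma Gvec_col t : Gvec r t = col_mx (gfun t) (gdfun t).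
Proof. by []. Qed.

(** [t |-> - 1 / (2 t)] is an involution, so the transformation of the [g] part follows from that of
    the [gdual] part, inverted by [mcmx_sqr]. *)
Lemma Gvec_fricke : exists K, forall t, 0 < imag t ->
  Gvec r (- (2 * t)^-1) = K *m Gvec r t.
Proof.
have [c c0 Hc] := gdual_fricke.
have E t : 0 < imag t -> gdfun (- (2 * t)^-1) = (c *: mcmx) *m gfun t.
  move=> t0; apply/matrixP => i j; rewrite !mxE Hc// mulr_sumr; apply: eq_bigr => k _.
  by rewrite !mxE mulrA.
exists (block_mx 0 ((c * N)^-1 *: mcmx) (c *: mcmx) 0) => t t0.
rewrite !Gvec_col mul_block_col !mul0mx add0r addr0.
congr col_mx; last exact: E.
have t1 : 0 < imag (- (2 * t)^-1) by apply: imag_inv; exact: imag_natM_gt0.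
have -> : t = - (2 * - (2 * t)^-1)^-1.
  by field; exact: imag_neq0.
rewrite [in RHS]E//; set u := - (2 * t)^-1.
have -> : - (2 * - (2 * u)^-1)^-1 = u by field; exact: imag_neq0.
rewrite -!scalemxAl -scalemxAr mulmxA mcmx_sqr mul_scalar_mx !scalerA.
by rewrite mulVf ?scale1r// mulf_neq0.
Qed.

Lemma qpowD (x : rat) t z : qpow x (t + z) = qpow x t * qpow x z.
Proof. by rewrite !qpowE mulrDr eeD. Qed.

(** An integral translation fixes [q], so only the relative factor [q ^ ((2 j - r - 1) / 2)] of the
    two summands can spoil the eigenfunction property. It is harmless for even [k], and for all [k]
    when [r] is odd. *)
Lemma g_shift (j : nat) (k : int) t : qpow ((2 * j%:R - r%:R - 1) / 2) (k%:~R : CC R) = 1 ->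
  g r j (t + k%:~R) = qpow ((4 * r%:R - 4 * j%:R + 1) ^+ 2 / (32 * r%:R - 8)) k%:~R * g r j t.
Proof.
pose X (q : CC R) := qpochs [:: q ^+ (8 * r - 4 * j); q ^+ (8 * r + 4 * j - 4);
    q ^+ (16 * r - 4)] (q ^+ (16 * r - 4)) / qpochs [:: q; q ^+ 3; q ^+ 4] (q ^+ 4).
pose Y (q : CC R) := qpochs [:: - q ^+ (2 * j - 1); q ^+ (4 * r - 2 * j); - q ^+ (4 * r - 1)]
    (- q ^+ (4 * r - 1)) / qpochs [:: q ^+ 2; q ^+ 2; q ^+ 4] (q ^+ 4).
have E t' : g r j t' = qpow ((4 * r%:R - 4 * j%:R + 1) ^+ 2 / (32 * r%:R - 8)) t' *
   (qpow ((2 * j%:R - r%:R - 1) / 2) t' * X (qpow 1 t') + Y (qpow 1 t')) by [].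
move: X Y E; generalize ((4 * r%:R - 4 * j%:R + 1) ^+ 2 / (32 * r%:R - 8) : rat).
generalize ((2 * j%:R - r%:R - 1) / 2 : rat) => be al X Y E H.
rewrite !E !(qpowD _ t) H mulr1.
have -> : qpow 1 (k%:~R : CC R) = 1 by rewrite qpowE rmorph1 mul1r ee_int.
by rewrite mulr1 mulrAC mulrC.
Qed.

(** The translation sends [q = ee (t / 2)] to [- q] and thereby exchanges the two summands; as the
    sign between them squares to 1, only a scalar results. *)
Lemma gdual_shift1 (j : nat) : exists2 c : CC R, c != 0 & forall t, gdual r j (t + 1) = c * gdual r j t.
Proof.
pose X (q : CC R) :=
 qpochs [:: q ^+ (2 * r - j); q ^+ (2 * r + j - 1); q ^+ (4 * r - 1)]
     (q ^+ (4 * r - 1)) / qpochs [:: q; q ^+ 3; q ^+ 4] (q ^+ 4).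
pose E : rat := (2 * j%:R ^+ 2 - 2 * j%:R - 2 * r%:R + 1) / (16 * r%:R - 4).
pose s : CC R := (-1) ^+ ((j * (j - 1)) %/ 2).
have ss : s * s = 1 by rewrite -expr2 -exprM mulnC exprM sqrrN expr1n expr1n.
have H t' : gdual_double r j t' = 2^-1 * qpow E t' * (X (qpow 1 t') + s * X (- qpow 1 t')).
  rewrite /gdual_double /X; cbv zeta.
  have e4 : (- qpow 1 t') ^+ 4 = qpow 1 t' ^+ 4 by ring.
  have e3 : (- qpow 1 t') ^+ 3 = - qpow 1 t' ^+ 3 by ring.
  have eN : (- qpow 1 t') ^+ (4 * r - 1) = - qpow 1 t' ^+ (4 * r - 1).
    rewrite exprNn -signr_odd.
    have o : odd (4 * r - 1) by rewrite oddB ?oddM//; move: r_gt0; clear; lia.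
    by rewrite o expr1 mulN1r.
  by rewrite e4 e3 eN.
exists (s * qpow E (1 / 2)) => [|u].
  by rewrite mulf_neq0 ?qpowE ?ee_neq0// expf_neq0// oppr_eq0 oner_eq0.
clearbody X E s.
rewrite /gdual mulrDl !H !qpowD.
have -> : qpow 1 (1 / 2) = -1 :> CC R by rewrite qpowE rmorph1 mul1r ee_half.
rewrite mulrN1 opprK.
have -> : X (- qpow 1 (u / 2)) + s * X (qpow 1 (u / 2)) = s * (X (qpow 1 (u / 2)) + s * X (- qpow 1 (u / 2))).
  by rewrite mulrDr mulrA ss; ring.
by ring.
Qed.

Lemma gdual_shift (j : nat) (k : int) : exists c : CC R, forall t,
  gdual r j (t + k%:~R) = c * gdual r j t.
Proof.
have [c c0 Hc] := gdual_shift1 j.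
have H n t : gdual r j (t + n%:R) = c ^+ n * gdual r j t.
  elim: n => [|n IH]; first by rewrite addr0 mul1r.
  by rewrite -natr1 addrA Hc IH mulrA exprS.
case: k => n; first by exists (c ^+ n) => t; exact: H.
exists (c ^+ n.+1)^-1 => t; by rewrite -[t in RHS](subrK n.+1%:R) H mulKf ?expf_neq0.
Qed.

Lemma Gvec_T (k : int) : (forall j : nat, qpow ((2 * j%:R - r%:R - 1) / 2) (k%:~R : CC R) = 1) ->
  exists K, forall t, Gvec r (t + k%:~R) = K *m Gvec r t.
Proof.
move=> H.
have Hd (j : nat) := gdual_shift j k.
have [d Hd'] := choice Hd.
have He (j : nat) : exists c : CC R, forall t, g r j (t + k%:~R) = c * g r j t.
  by eexists => t; exact: g_shift.
have [e He'] := choice He.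
exists (block_mx (diag_mx (\row_i e i.+1)) 0 0 (diag_mx (\row_i d i.+1))) => t.
rewrite !Gvec_col mul_block_col !mul0mx add0r addr0; congr col_mx.
  transitivity (\col_i (e i.+1 * g r i.+1 t) : 'cV_(2 * r - 1)); last exact: diag_mulcol.
  by apply: eq_mx => i j; exact: He'.
transitivity (\col_i (d i.+1 * gdual r i.+1 t) : 'cV_(2 * r - 1)); last exact: diag_mulcol.
by apply: eq_mx => i j; exact: Hd'.
Qed.

Lemma Gvec_T_even (k : int) : exists K, forall t, Gvec r (t + (2 * k)%:~R) = K *m Gvec r t.
Proof.
apply: Gvec_T => j; rewrite qpowE.
have -> : ratr ((2 * j%:R - r%:R - 1) / 2) * (2 * k)%:~R = ((2 * j%:Z - r%:Z - 1) * k)%:~R :> CC R by field.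
exact: ee_int.
Qed.

Lemma Gvec_T_odd (k : int) : odd r -> exists K, forall t, Gvec r (t + k%:~R) = K *m Gvec r t.
Proof.
move=> ro; apply: Gvec_T => j; rewrite qpowE.
have [h rE] : exists h, r = (h * 2).+1.
  by exists r./2; rewrite muln2 -{1}(odd_double_half r) ro.
have -> : (r%:R : rat) = 2 * h%:R + 1 by rewrite rE -natr1 natrM mulrC.
have -> : ratr ((2 * j%:R - (2 * h%:R + 1) - 1) / 2) * k%:~R = ((j%:Z - h%:Z - 1) * k)%:~R :> CC R by field.
exact: ee_int.
Qed.

End Level.
End Fricke.

(** * Fractional linear transformations *)

Section Mobius.
Context {R : realType}.
Implicit Types (A B : 'M[R]_2) (t : CC R).

Lemma det2 (K : comNzRingType) (A : 'M[K]_2) : \det A = A 0 0 * A 1 1 - A 0 1 * A 1 0.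
Proof.
rewrite (expand_det_row _ 0) !big_ord_recl big_ord0 addr0 /cofactor !det_mx11 !mxE /= !mul1r.
have -> : lift 0 0 = 1 :> 'I_2 by apply: val_inj.
have -> : lift 1 0 = 0 :> 'I_2 by apply: val_inj.
have -> : ord0 = 0 :> 'I_2 by apply: val_inj.
by rewrite /= add0n expr1 mulN1r mulrN.
Qed.

Lemma mulmx2 (K : comNzRingType) (A B : 'M[K]_2) i j :
  (A *m B) i j = A i 0 * B 0 j + A i 1 * B 1 j.
Proof.
by rewrite mxE !big_ord_recl big_ord0 addr0; have -> : lift 0 0 = 1 :> 'I_2 by apply: val_inj.
Qed.

Definition mden A t : CC R := ofR (A 1 0) * t + ofR (A 1 1).

Lemma mden_neq0 A t : \det A = 1 -> 0 < imag t -> mden A t != 0.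
Proof.
rewrite det2 => dA t0; apply/eqP => H.
have : imag (mden A t) = A 1 0 * imag t by rewrite /imag /mden ImD -/(imag _) imag_scale /= addr0.
rewrite H /imag /= => /esym/eqP; rewrite mulf_eq0 (gt_eqF t0) orbF => /eqP c0.
move: H; rewrite /mden c0 mul0r add0r -[0]/(ofR 0) => /ofR_inj d0.
by move: dA; rewrite c0 d0 !mulr0 subrr => /eqP; rewrite eq_sym oner_eq0.
Qed.

Lemma imag_mobius A t : \det A = 1 -> 0 < imag t -> 0 < imag (mobius A t).
Proof.
move=> dA t0; have := mden_neq0 dA t0; rewrite det2 in dA.
rewrite /mobius -/(mden A t) /imag; case: t t0 => x y /= t0 wn0.
have : 0 < cmod (mden A (x +i* y)%C) ^+ 2 by rewrite exprn_gt0// cmod_gt0.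
rewrite cmod_sqr /mden /=.
rewrite !(mul0r, subr0, addr0) => w0.
suff -> : forall p : R, (A 0 0 * x + A 0 1) * - ((A 1 0 * y) / p) + (A 0 0 * y) * ((A 1 0 * x + A 1 1) / p) = y / p.
  by rewrite divr_gt0.
move=> p; rewrite -[y in RHS]mul1r -dA; ring.
Qed.

Lemma mobius1 t : mobius 1%:M t = t.
Proof. by rewrite /mobius !mxE /= mul1r mul0r addr0 add0r divr1. Qed.

Lemma mobiusN A t : mobius (- A) t = mobius A t.
Proof. by rewrite /mobius !mxE !ofRN !mulNr -!opprD invrN mulrNN. Qed.

Lemma mobiusM A B t : \det A = 1 -> \det B = 1 -> 0 < imag t ->
  mobius (A *m B) t = mobius A (mobius B t).
Proof.
move=> dA dB t0; have := mden_neq0 dA (imag_mobius dB t0).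
have := @mden_neq0 (A *m B) t; rewrite det_mulmx dA dB mul1r => /(_ erefl t0).
have := mden_neq0 dB t0.
rewrite /mobius -!/(mden _ _) /mden !mulmx2 !ofRD !ofRM => h1 h2 h3.
move: (ofR (A 0 0)) (ofR (A 0 1)) (ofR (A 1 0)) (ofR (A 1 1)) (ofR (B 0 0)) (ofR (B 0 1))
  (ofR (B 1 0)) (ofR (B 1 1)) h1 h2 h3 => a b c d a' b' c' d' h1 h2 h3.
field; rewrite h1 /=; move: h2; congr (_ != 0); ring.
Qed.

End Mobius.

(** * From one matrix per group element to a representation *)

Section Multiplier.
Context {R : realType} (n : nat).

(** Points are added as long as some value lies outside the span; each raises the rank, which is at
    most [n], and [d] bounds the raises still possible. *)
Lemma spanning_values (T : Type) (D : set T) (f : T -> 'rV[CC R]_n) :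
  exists (m : nat) (s : 'I_m -> T), (forall i, D (s i)) /\
    forall t, D t -> (f t <= (\matrix_(i < m) f (s i)))%MS.
Proof.
suff H d : forall (m : nat) (s : 'I_m -> T), (forall i, D (s i)) ->
    (n - \rank (\matrix_(i < m) f (s i)) <= d)%N ->
  exists (m : nat) (s : 'I_m -> T), (forall i, D (s i)) /\
    forall t, D t -> (f t <= (\matrix_(i < m) f (s i)))%MS.
  by apply: (H n 0%N (fun i : 'I_0 => False_rect _ (elimF idP (ltn0 i) (ltn_ord i)))) => [[]|]; rewrite ?leq_subr.
elim: d => [|d IH] m s Ds; set V := \matrix_(i < m) f (s i) => rV.
  exists m, s; split => // t _; apply: submx_full.
  by rewrite /row_full eqn_leq rank_leq_col -subn_eq0 -leqn0.
have [H|/existsNP[t /not_implyP[Dt /negP ft]]] := pselect (forall t, D t -> (f t <= V)%MS).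
  by exists m, s.
pose s' (i : 'I_(m + 1)) := match fintype.split i with inl j => s j | inr _ => t end.
apply: (IH (m + 1)%N s').
  by move=> i; rewrite /s'; case: fintype.split.
set V' := \matrix_(i < _) f (s' i).
have E : V' = col_mx V (f t).
  apply/matrixP => i j; rewrite !mxE /s'.
  by case: fintype.split => k /=; rewrite ?mxE// [k]ord1.
have : (V < V')%MS.
  rewrite E ltmxE; apply/andP; split.
    by rewrite -addsmxE addsmxSl.
  by rewrite -addsmxE addsmx_sub submx_refl.
move=> /rank_ltmx; move: rV; lia.
Qed.

(** A given [M] is determined only on the span of the values of [F], so arbitrary choices need not
    be multiplicative. The matrix [L A] depends on the values alone, through the sample points and
    their images under [A]. *)
Lemma multiplier_exists (H : set 'M[R]_2) (F : CC R -> 'cV[CC R]_n) :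
  PSL2_subgroup H ->
  (forall A, H A -> exists M : 'M[CC R]_n, forall t, 0 < imag t -> F (mobius A t) = M *m F t) ->
  exists rho, PSL2_representation H rho /\
    forall A t, H A -> 0 < imag t -> F (mobius A t) = rho A *m F t.
Proof.
move=> [H1 Hid HN HM HV] HF; pose f t := (F t)^T.
have [m [s [Ds sp]]] := spanning_values [set t | 0 < imag t] f.
set W := \matrix_(i < m) f (s i) in sp.
pose WA A := \matrix_(i < m) f (mobius A (s i)).
pose P := pinvmx W *m W.
(* [P] projects onto the span of the values; the first factor [P] in [L] ensures
   that [L] respects the decomposition into the images of [P] and [1 - P]. *)
pose L A := P *m pinvmx W *m WA A + (1%:M - P).
have fP t : 0 < imag t -> f t *m P = f t by move=> t0; rewrite mulmxA mulmxKpV// sp.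
have PP : P *m P = P by rewrite {2}/P mulmxA mulmxKpV// submxMl.
have WAE A M : (forall t, 0 < imag t -> F (mobius A t) = M *m F t) -> WA A = W *m M^T.
  by move=> HMt; apply/row_matrixP => i; rewrite row_mul !rowK /f HMt ?trmx_mul//; exact: Ds.
have LE A M : (forall t, 0 < imag t -> F (mobius A t) = M *m F t) -> L A = P *m M^T + (1%:M - P).
  by move=> HMt; rewrite /L (WAE _ _ HMt) mulmxA -[P *m pinvmx W *m W]mulmxA -/P PP.
have fL A t : H A -> 0 < imag t -> f t *m L A = f (mobius A t).
  move=> HA t0; have [M HMt] := HF A HA.
  by rewrite (LE _ _ HMt) mulmxDr mulmxBr mulmx1 mulmxA fP// subrr addr0 /f HMt// trmx_mul.
have QL A : H A -> (1%:M - P) *m L A = 1%:M - P.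
  move=> HA; have [M HMt] := HF A HA.
  rewrite (LE _ _ HMt) mulmxDr !mulmxBl !mul1mx mulmxA PP subrr add0r.
  by rewrite mulmxBr mulmx1 PP subrr subr0.
have LM A B : H A -> H B -> L (A *m B) = L B *m L A.
  move=> HA HB; rewrite {1}/L.
  have -> : WA (A *m B) = WA B *m L A.
    apply/row_matrixP => i; rewrite row_mul !rowK mobiusM ?fL//; try exact: Ds.
    - by apply: imag_mobius; [exact: H1|exact: Ds].
    - exact: H1.
    - exact: H1.
  by rewrite {2}/L mulmxDl QL// !mulmxA.
have L1 : L 1%:M = 1%:M.
  rewrite /L; have -> : WA 1%:M = W by apply/row_matrixP => i; rewrite !rowK mobius1.
  by rewrite -mulmxA -/P PP addrC subrK.
have LN A : L (- A) = L A.
  rewrite /L; have -> // : WA (- A) = WA A.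
  by apply/row_matrixP => i; rewrite !rowK mobiusN.
clearbody L => {WA WAE LE QL}.
(* [L] acts on rows and reverses products; transposition restores the order. *)
exists (fun A => (L A)^T); split.
  split.
  - move=> A HA; rewrite unitmx_tr.
    have uA : A \in unitmx by rewrite unitmxE H1// unitr1.
    have := LM _ _ (HV A HA) HA; rewrite mulVmx// L1 => /esym/mulmx1_unit.
    by case.
  - by move=> A HA; rewrite LN.
  - by move=> A B HA HB; rewrite LM// trmx_mul.
by move=> A t HA t0; rewrite -[LHS]trmxK -/(f _) -fL// trmx_mul trmxK.
Qed.

End Multiplier.

(** * Subgroups of the modular group: generators, discreteness, cosets *)

Section Groups.
Context {R : realType}.
Implicit Types (A B : 'M[R]_2) (H K S : set 'M[R]_2).

Definition transforms (n : nat) (F : CC R -> 'cV[CC R]_n) A :=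
  exists M : 'M[CC R]_n, forall t, 0 < imag t -> F (mobius A t) = M *m F t.

Lemma transformsM n (F : CC R -> 'cV[CC R]_n) A B : \det A = 1 -> \det B = 1 ->
  transforms F A -> transforms F B -> transforms F (A *m B).
Proof.
move=> dA dB [M HM] [M' HM']; exists (M *m M') => t t0.
by rewrite mobiusM// HM ?HM' ?mulmxA//; exact: imag_mobius.
Qed.

Lemma transformsN n (F : CC R -> 'cV[CC R]_n) A : transforms F A -> transforms F (- A).
Proof. by move=> [M HM]; exists M => t t0; rewrite mobiusN HM. Qed.

Lemma transforms1 n (F : CC R -> 'cV[CC R]_n) : transforms F 1%:M.
Proof. by exists 1%:M => t t0; rewrite mobius1 mul1mx. Qed.

Lemma detN2 A : \det (- A) = \det A.
Proof. by rewrite !det2 !mxE; ring. Qed.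

(** The inverse has its own condition because the matrix in [transforms] need not be invertible. *)
Definition transformers (n : nat) (F : CC R -> 'cV[CC R]_n) : set 'M[R]_2 :=
  [set A | [/\ \det A = 1, transforms F A & exists2 B, A *m B = 1%:M & transforms F B]].

Lemma transformers_subgroup n (F : CC R -> 'cV[CC R]_n) : PSL2_subgroup (transformers F).
Proof.
have dV A B : \det A = 1 -> A *m B = 1%:M -> \det B = 1.
  by move=> dA /(congr1 determinant); rewrite det_mulmx dA mul1r det1.
split.
- by move=> A [].
- split; [exact: det1|exact: transforms1|].
  by exists 1%:M; [rewrite mul1mx|exact: transforms1].
- move=> A [dA tA [B AB tB]]; split; [by rewrite detN2|exact: transformsN|].
  by exists (- B); [rewrite mulNmx mulmxN opprK|exact: transformsN].
- move=> A A' [dA tA [B AB tB]] [dA' tA' [B' AB' tB']].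
  have dB := dV _ _ dA AB; have dB' := dV _ _ dA' AB'.
  split; [by rewrite det_mulmx dA dA' mulr1|exact: transformsM|].
  exists (B' *m B); last exact: transformsM.
  by rewrite mulmxA -[A *m A' *m B']mulmxA AB' mulmx1.
- move=> A [dA tA [B AB tB]].
  have uA : A \in unitmx by rewrite unitmxE dA unitr1.
  have -> : invmx A = B by rewrite -[LHS]mulmx1 -AB mulKmx.
  split => //; first exact: dV AB.
  by exists A => //; exact: mulmx1C.
Qed.

Lemma PSL2_inv K A B : PSL2_subgroup K -> K A -> A *m B = 1%:M -> K B.
Proof.
move=> [K1 _ _ _ KV] KA AB; have uA : A \in unitmx by rewrite unitmxE K1// unitr1.
by have -> : B = invmx A; [rewrite -[RHS]mulmx1 -AB mulKmx|exact: KV].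
Qed.

(** The group [K] around [S] guarantees that the intersection defining the generated group is over a
    nonempty family, hence consists of matrices of determinant 1. *)
Lemma PSL2_generated_subgroup K S : PSL2_subgroup K -> S `<=` K ->
  PSL2_subgroup (PSL2_generated S).
Proof.
move=> HK SK; split.
- by move=> A /(_ K (conj HK SK)); case: HK => + _ _ _ _ => /[apply].
- by move=> L [[_ L1 _ _ _] _].
- by move=> A HA L HL; case: (HL) => [[_ _ LN _ _] _]; apply: LN; exact: HA.
- move=> A B HA HB L HL; case: (HL) => [[_ _ _ LM _] _].
  by apply: LM; [exact: HA|exact: HB].
- by move=> A HA L HL; case: (HL) => [[_ _ _ _ LV] _]; apply: LV; exact: HA.
Qed.

Lemma mx22E A : A = mx22 (A 0 0) (A 0 1) (A 1 0) (A 1 1).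
Proof.
apply/matrixP => i j; rewrite mxE.
by case: i j => [[|[|//]] Hi] [[|[|//]] Hj] /=; congr (A _ _); apply: val_inj.
Qed.

Lemma mx22M (a b c d a' b' c' d' : R) : mx22 a b c d *m mx22 a' b' c' d' =
  mx22 (a * a' + b * c') (a * b' + b * d') (c * a' + d * c') (c * b' + d * d').
Proof. by rewrite [LHS]mx22E !mulmx2 !mxE. Qed.

Lemma mx22_1 : mx22 1 0 0 1 = 1%:M :> 'M[R]_2.
Proof. by rewrite [RHS]mx22E !mxE. Qed.

Lemma mx22N (a b c d : R) : - mx22 a b c d = mx22 (- a) (- b) (- c) (- d).
Proof. by rewrite [LHS]mx22E !mxE. Qed.

Lemma det_mx22 (a b c d : R) : \det (mx22 a b c d) = a * d - b * c.
Proof. by rewrite det2 !mxE. Qed.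

Definition imx (a b c d : int) : 'M[R]_2 := mx22 a%:~R b%:~R c%:~R d%:~R.

Lemma imxM (a b c d a' b' c' d' : int) : imx a b c d *m imx a' b' c' d' =
  imx (a * a' + b * c') (a * b' + b * d') (c * a' + d * c') (c * b' + d * d').
Proof. by rewrite /imx mx22M !(intrD, intrM). Qed.

Lemma imx1 : imx 1 0 0 1 = 1%:M.
Proof. exact: mx22_1. Qed.

Lemma modular_imx A : modular_group A <->
  exists a b c d : int, a * d - b * c = 1 /\ A = imx a b c d.
Proof.
split=> [[B dB <-]|[a [b [c [d [H ->]]]]]].
  exists (B 0 0), (B 0 1), (B 1 0), (B 1 1); rewrite -det2; split => //.
  by rewrite [LHS]mx22E !mxE.
exists (\matrix_(i, j) if i == 0 then (if j == 0 then a else b) else (if j == 0 then c else d)).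
  by rewrite /= det2 !mxE.
by rewrite [LHS]mx22E !mxE.
Qed.

Lemma Gamma0_2_imx A : Gamma0_2 A <->
  exists a b c d : int, a * d - b * (2 * c) = 1 /\ A = imx a b (2 * c) d.
Proof.
split=> [[B [dB /dvdzP[c cE]] <-]|[a [b [c [d [H ->]]]]]].
  have {}cE : 2 * c = B 1 0 by rewrite mulrC cE.
  exists (B 0 0), (B 0 1), c, (B 1 1); rewrite cE -det2; split => //.
  by rewrite [LHS]mx22E !mxE.
exists (\matrix_(i, j) if i == 0 then (if j == 0 then a else b) else (if j == 0 then 2 * c else d)).
  by split; [rewrite det2 !mxE | rewrite mxE /=; apply: dvdz_mulr].
by rewrite [LHS]mx22E !mxE.
Qed.

Lemma modular_subgroup : PSL2_subgroup (@modular_group R).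
Proof.
split.
- move=> A /modular_imx[a [b [c [d [H ->]]]]].
  by rewrite det_mx22 -!intrM -intrB H.
- by apply/modular_imx; exists 1, 0, 0, 1; rewrite imx1.
- move=> A /modular_imx[a [b [c [d [H ->]]]]]; apply/modular_imx.
  exists (- a), (- b), (- c), (- d); split; first by rewrite !mulrNN.
  by rewrite mx22N /imx !intrN.
- move=> A B /modular_imx[a [b [c [d [H ->]]]]] /modular_imx[a' [b' [c' [d' [H' ->]]]]].
  apply/modular_imx; rewrite imxM; do 4 eexists; split; last by [].
  by transitivity ((a * d - b * c) * (a' * d' - b' * c')); [ring | rewrite H H'].
- move=> A /modular_imx[a [b [c [d [H AE]]]]].
  have AB : A *m imx d (- b) (- c) a = 1%:M.
    by rewrite AE imxM -imx1; congr imx; first [by ring | by rewrite -[RHS]H; ring].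
  have uA := (mulmx1_unit AB).1.
  have -> : invmx A = imx d (- b) (- c) a by rewrite -[LHS]mulmx1 -AB mulKmx.
  by apply/modular_imx; exists d, (- b), (- c), a; split => //; rewrite -[RHS]H; ring.
Qed.

Lemma Gamma0_2_subgroup : PSL2_subgroup (@Gamma0_2 R).
Proof.
split.
- move=> A /Gamma0_2_imx[a [b [c [d [H ->]]]]].
  by rewrite det_mx22 -!intrM -intrB H.
- by apply/Gamma0_2_imx; exists 1, 0, 0, 1; rewrite mulr0 imx1.
- move=> A /Gamma0_2_imx[a [b [c [d [H ->]]]]]; apply/Gamma0_2_imx.
  exists (- a), (- b), (- c), (- d); split; first by rewrite -[RHS]H; ring.
  by rewrite mx22N /imx mulrN !intrN.
- move=> A B /Gamma0_2_imx[a [b [c [d [H ->]]]]] /Gamma0_2_imx[a' [b' [c' [d' [H' ->]]]]].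
  apply/Gamma0_2_imx; rewrite imxM.
  exists (a * a' + b * (2 * c')), (a * b' + b * d'), (c * a' + d * c'), (2 * c * b' + d * d'); split.
    by transitivity ((a * d - b * (2 * c)) * (a' * d' - b' * (2 * c'))); [ring | rewrite H H'].
  by congr imx; ring.
- move=> A /Gamma0_2_imx[a [b [c [d [H AE]]]]].
  have AB : A *m imx d (- b) (2 * - c) a = 1%:M.
    by rewrite AE imxM -imx1; congr imx; first [by ring | by rewrite -[RHS]H; ring].
  have uA := (mulmx1_unit AB).1.
  have -> : invmx A = imx d (- b) (2 * - c) a by rewrite -[LHS]mulmx1 -AB mulKmx.
  by apply/Gamma0_2_imx; exists d, (- b), (- c), a; split => //; rewrite -[RHS]H; ring.
Qed.

(** Balls of matrices are entrywise, and integers at distance less than 1 coincide. *)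
Lemma discrete_of_modular H : PSL2_subgroup H -> H `<=` modular_group -> discrete_PSL2_subgroup H.
Proof.
move=> HH Hm; split=> // A HA; split; first exact/mem_set.
exists (ball A 1); first exact: nbhsx_ballx.
apply/seteqP; split=> [B [[_ AB] HB]|_ ->]; last by split=> //; exact: ballxx.
have int_close (x y : int) : ball (x%:~R : R) 1 (y%:~R : R) -> x = y.
  rewrite /ball /= -intrB -intr_norm -[1]/(1%:~R) ltr_int => xy.
  by apply/eqP; rewrite -subr_eq0 -normr_eq0; move: xy; lia.
have /modular_imx[a [b [c [d [_ AE]]]]] := Hm _ HA.
have /modular_imx[a' [b' [c' [d' [_ BE]]]]] := Hm _ HB.
have := AB 0 0; have := AB 0 1; have := AB 1 0; have := AB 1 1.
rewrite AE BE !mxE /= => /int_close -> /int_close -> /int_close -> /int_close ->.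
by [].
Qed.

(* Descent on [`|a| + `|c|], where [(a, c)] is the first column. *)
Lemma Gamma0_2_generated K : PSL2_subgroup K -> K (mx22 1 1 0 1) -> K (mx22 1 0 2 1) ->
  Gamma0_2 `<=` K.
Proof.
move=> HK; rewrite -[mx22 1 1 0 1]/(imx 1 1 0 1) -[mx22 1 0 2 1]/(imx 1 0 2 1) => KT KL.
have KT' : K (imx 1 (-1) 0 1).
  by apply: (PSL2_inv HK KT); rewrite imxM -imx1; congr imx.
have KL' : K (imx 1 0 (-2) 1).
  by apply: (PSL2_inv HK KL); rewrite imxM -imx1; congr imx.
have [K1 Kid KN KM KV] := HK.
have KTn (b : int) : K (imx 1 b 0 1).
  elim: b => [|n IH|n IH]; first by rewrite imx1.
    have := KM _ _ KT IH; rewrite imxM; congr (K (imx _ _ _ _)); ring.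
  have := KM _ _ KT' IH; rewrite imxM; congr (K (imx _ _ _ _)); ring.
have KTl a b c d : K (imx (a - c) (b - d) c d) -> K (imx a b c d).
  by move=> H; have := KM _ _ KT H; rewrite imxM; congr (K (imx _ _ _ _)); ring.
have KTl' a b c d : K (imx (a + c) (b + d) c d) -> K (imx a b c d).
  by move=> H; have := KM _ _ KT' H; rewrite imxM; congr (K (imx _ _ _ _)); ring.
have KLl a b c d : K (imx a b (c - 2 * a) (d - 2 * b)) -> K (imx a b c d).
  by move=> H; have := KM _ _ KL H; rewrite imxM; congr (K (imx _ _ _ _)); ring.
have KLl' a b c d : K (imx a b (c + 2 * a) (d + 2 * b)) -> K (imx a b c d).
  by move=> H; have := KM _ _ KL' H; rewrite imxM; congr (K (imx _ _ _ _)); ring.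
suff H n : forall a b c d : int, a * d - b * (2 * c) = 1 -> (absz a + absz (2 * c)%R <= n)%N -> K (imx a b (2 * c) d).
  by move=> A /Gamma0_2_imx[a [b [c [d [dA ->]]]]]; exact: H dA (leqnn _).
elim: n => [|n IH] a b c d dA an.
  have a0 : a = 0 by lia.
  have c0 : c = 0 by lia.
  by move: dA; rewrite a0 c0 mul0r !mulr0.
(* The determinant forces [a] to be odd, so [|a|] and [|2 c|] differ and the larger one can be
   strictly reduced by the other. *)
have aodd : exists k, a = 2 * k + 1.
  have : a = 2 * (a %/ 2)%Z \/ a = 2 * (a %/ 2)%Z + 1 by lia.
  set m := (a %/ 2)%Z; case=> aE; last by exists m.
  have : 2 * (m * d - b * c) = 1 by rewrite -[RHS]dA aE; ring.
  by move: (m * d - b * c) => x; lia.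
have [k aE] := aodd.
have [c0|cn0] := eqVneq c 0.
  have ad : a * d = 1 by rewrite -dA c0; ring.
  have : (a = 1 /\ d = 1) \/ (a = -1 /\ d = -1).
    have := congr1 absz ad; rewrite abszM => /eqP; rewrite muln_eq1 => /andP[/eqP a1 /eqP d1].
    have [aE'|aE'] : a = 1 \/ a = -1 by lia.
      by left; split => //; move: ad; rewrite aE' mul1r.
    by right; split => //; move: ad; rewrite aE' mulN1r; lia.
  rewrite c0 mulr0 => -[[-> ->]|[-> ->]]; first exact: KTn.
  have := KN _ (KTn (- b)); rewrite /imx mx22N -!intrN; congr (K (mx22 _%:~R _%:~R _%:~R _%:~R)); ring.
have sgn : (0 < a /\ 0 < c) \/ (a < 0 /\ c < 0) \/ (0 < a /\ c < 0) \/ (a < 0 /\ 0 < c).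
  by move/eqP: cn0; lia.
have [ac|ca] := leqP (absz a) (absz (2 * c)%R).
  have [s1|s1] : ((0 < a /\ 0 < c) \/ (a < 0 /\ c < 0)) \/ ((0 < a /\ c < 0) \/ (a < 0 /\ 0 < c)) by tauto.
    apply: KLl; have -> : 2 * c - 2 * a = 2 * (c - a) by ring.
    apply: IH; first by rewrite -[RHS]dA; ring.
    by clear - s1 ac an aE; lia.
  apply: KLl'; have -> : 2 * c + 2 * a = 2 * (c + a) by ring.
  apply: IH; first by rewrite -[RHS]dA; ring.
  by clear - s1 ac an aE; lia.
have [s1|s1] : ((0 < a /\ 0 < c) \/ (a < 0 /\ c < 0)) \/ ((0 < a /\ c < 0) \/ (a < 0 /\ 0 < c)) by tauto.
  apply: KTl; apply: IH; first by rewrite -[RHS]dA; ring.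
  by clear - s1 ca an; lia.
apply: KTl'; apply: IH; first by rewrite -[RHS]dA; ring.
by clear - s1 ca an; lia.
Qed.

Lemma coset_eq H (C B : 'M[R]_2) : PSL2_subgroup H -> H C ->
  [set A *m (C *m B) | A in H] = [set A *m B | A in H].
Proof.
move=> HH HC; have [H1 _ _ HM HV] := HH.
have uC : C \in unitmx by rewrite unitmxE H1// unitr1.
apply/seteqP; split=> _ [A HA <-].
  by exists (A *m C); [exact: HM|rewrite mulmxA].
exists (A *m invmx C); first by apply: HM => //; exact: HV.
by rewrite mulmxA mulmxKV.
Qed.

(** The coset is determined by the bottom row modulo 2: [(0, 1)], [(1, 0)] or [(1, 1)]. *)
Lemma modular_cosets B : modular_group B -> exists C k : 'M[R]_2,
  [/\ Gamma0_2 C, B = C *m k & [\/ k = 1%:M, k = imx 0 (-1) 1 0 | k = imx 0 (-1) 1 1]].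
Proof.
move=> /modular_imx[a [b [c [d [H ->]]]]].
have [cE|cE] : c = 2 * (c %/ 2)%Z \/ c = 2 * (c %/ 2)%Z + 1 by lia.
  exists (imx a b c d), 1%:M; split; [|by rewrite mulmx1|by constructor 1].
  by apply/Gamma0_2_imx; exists a, b, (c %/ 2)%Z, d; rewrite -cE.
have [dE|dE] : d = 2 * (d %/ 2)%Z \/ d = 2 * (d %/ 2)%Z + 1 by lia.
  exists (imx (- b) a (- d) c), (imx 0 (-1) 1 0); split; last by constructor 2.
    apply/Gamma0_2_imx; exists (- b), a, (- (d %/ 2)%Z), c; split; first by rewrite mulrN -dE -H; ring.
    by rewrite mulrN -dE.
  by rewrite imxM; congr imx; ring.
have [w wE] : exists w, d - c = 2 * w by exists ((d %/ 2)%Z - (c %/ 2)%Z); lia.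
exists (imx (a - b) a (c - d) c), (imx 0 (-1) 1 1); split; last by constructor 3.
  apply/Gamma0_2_imx; exists (a - b), a, (- w), c.
  have -> : 2 * - w = c - d by lia.
  by split => //; rewrite -[RHS]H; ring.
by rewrite imxM; congr imx; ring.
Qed.

Lemma Gamma0_2_sub_modular : @Gamma0_2 R `<=` modular_group.
Proof. by move=> _ [B [dB _] <-]; exists B. Qed.

Lemma Gamma0_2_finite_index : finite_index (@Gamma0_2 R) modular_group.
Proof.
split; first exact: Gamma0_2_sub_modular.
pose co (B : 'M[R]_2) := [set A *m B | A in @Gamma0_2 R].
apply: (@sub_finite_set _ _ ([set co 1%:M] `|` [set co (imx 0 (-1) 1 0)] `|` [set co (imx 0 (-1) 1 1)])).
  move=> _ [B /modular_cosets[C [k [HC -> hk]]] <-].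
  rewrite coset_eq//; last exact: Gamma0_2_subgroup.
  by case: hk => ->; [left; left|left; right|right].
by rewrite !finite_setU; do ?split; exact: finite_set1.
Qed.

End Groups.

(** * Laurent expansions in a root of [q] *)

Section QExpansions.
Context {R : realType}.
Implicit Types (f h Phi : CC R -> CC R) (t z w : CC R) (N m : nat).

Lemma PS_twist Phi w : cmod w = 1 -> PS Phi -> PS (fun q => Phi (w * q)).
Proof.
move=> w1 [a Ha Ea]; exists (fun k => a k * w ^+ k).
  move=> x /Ha[B HB]; exists B => n; rewrite (le_trans _ (HB n))//.
  by apply: ler_sum => k _; rewrite cmodM cmodX w1 expr1n mulr1.
move=> q q1; rewrite Ea; last by rewrite cmodM w1 mul1r.
congr (limn (series _)); apply/funext => k.
by rewrite /pterm exprMn mulrA.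
Qed.

Lemma imagD t z : imag (t + z) = imag t + imag z.
Proof. exact: ImD. Qed.

Lemma imag_pos_near t z : 0 < imag t -> cmod z < imag t -> 0 < imag (t + z).
Proof.
by move=> t0 ht; rewrite imagD; have := Im_le_cmod z; rewrite ler_norml => /andP[+ _]; rewrite -/(imag z); lra.
Qed.

Lemma qder_eq_upper f h t d : 0 < imag t -> (forall z, 0 < imag z -> f z = h z) ->
  qder h t d -> qder f t d.
Proof.
move=> t0 E [M [del [M0 d0 H]]]; exists M, (Num.min del (imag t)); split => //.
  by rewrite lt_min d0 t0.
move=> k; rewrite lt_min => /andP[kd kt]; rewrite !E//; first exact: H.
exact: imag_pos_near.
Qed.

Lemma imag_div_nat t N : imag (t / N%:R) = imag t / N%:R.
Proof. by rewrite mulrC -ofR_nat -ofRV imag_scale mulrC. Qed.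

Section Level.
Variable N : nat.
Hypothesis N_gt0 : (0 < N)%N.
Let N0 : (N%:R : CC R) != 0. Proof. exact: natr_neq0. Qed.
Let NR : 0 < (N%:R : R). Proof. by rewrite ltr0n. Qed.

Lemma cmod_ee_div t : 0 < imag t -> cmod (ee (t / N%:R)) < 1.
Proof. by move=> t0; rewrite cmod_ee_lt1// imag_div_nat divr_gt0. Qed.

Lemma PS_qder Phi t : PS Phi -> 0 < imag t -> exists d, qder (fun z => Phi (ee (z / N%:R))) t d.
Proof.
move=> [a Ha Ea] t0; pose la (k : nat) : R := k%:R / N%:R.
have la0 k : 0 <= la k by rewrite divr_ge0.
have ha (y : R) : 0 < y -> cvgn (series (fun k => cmod (a k) * expR (- (2 * pi * la k * y)))).
  move=> y0; set x := expR (- (2 * pi * y / N%:R)).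
  have x01 : 0 < x < 1.
    by rewrite expR_gt0 expR_lt1 oppr_lt0 divr_gt0// !mulr_gt0 ?pi_gt0.
  have [B HB] := Ha x x01.
  have -> : (fun k => cmod (a k) * expR (- (2 * pi * la k * y))) = (fun k => cmod (a k) * x ^+ k).
    apply/funext => k; rewrite /x -expRM_natl; congr (_ * expR _); rewrite /la; field.
    by rewrite gt_eqF.
  apply: nondecreasing_is_cvgn.
    apply: nondecreasing_series => k _ _; rewrite mulr_ge0 ?cmod_ge0 ?exprn_ge0//.
    by case/andP: x01 => /ltW.
  by exists B => _ [K _ <-]; exact: HB.
exists (desum a la t); apply: qder_eq_upper (esum_qder la0 ha t0) => // z z0.
rewrite Ea; last exact: cmod_ee_div.
congr (limn (series _)); apply/funext => k.
by rewrite /pterm /eterm eeX; congr (_ * ee _); rewrite /la ofRM ofRV !ofR_nat; field.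
Qed.

(** A Laurent series in [ee (t / N)] is a power series divided by its power [m], an upper bound for
    the order of the pole at infinity. *)
Definition qexp f := exists (m : nat) Phi, PS Phi /\
  forall t, 0 < imag t -> f t = ee (- (m%:R / N%:R * t)) * Phi (ee (t / N%:R)).

Lemma qexp_eq f h : (forall t, 0 < imag t -> f t = h t) -> qexp h -> qexp f.
Proof. by move=> E [m [Phi [P H]]]; exists m, Phi; split => // t t0; rewrite E// H. Qed.

Lemma qexp_mul f h : qexp f -> qexp h -> qexp (fun t => f t * h t).
Proof.
move=> [m [Phi [P H]]] [m' [Psi [P' H']]]; exists (m + m')%N, (fun q => Phi q * Psi q).
split=> [|t t0]; first exact: PS_mul.
have -> : - ((m + m')%:R / N%:R * t) = - (m%:R / N%:R * t) - m'%:R / N%:R * t by rewrite natrD; ring.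
by rewrite H// H'// eeD; ring.
Qed.

Lemma ee_pow (k : nat) t : ee (k%:R / N%:R * t) = ee (t / N%:R) ^+ k.
Proof. by rewrite eeX; congr ee; field. Qed.

Lemma qexp_add f h : qexp f -> qexp h -> qexp (fun t => f t + h t).
Proof.
move=> [m [Phi [P H]]] [m' [Psi [P' H']]].
exists (m + m')%N, (fun q => (1 * q ^+ m') * Phi q + (1 * q ^+ m) * Psi q).
split=> [|t t0]; first by apply: PS_add; apply: PS_mul => //; exact: PS_monomial.
rewrite H// H'// !mul1r -!ee_pow; set E := ee (- ((m + m')%:R / _ * t)).
have -> : ee (- (m%:R / N%:R * t)) = E * ee (m'%:R / N%:R * t).
  by rewrite -eeD natrD; congr ee; ring.
have -> : ee (- (m'%:R / N%:R * t)) = E * ee (m%:R / N%:R * t).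
  by rewrite -eeD natrD; congr ee; ring.
by ring.
Qed.

Lemma qexp_PS Phi : PS Phi -> qexp (fun t => Phi (ee (t / N%:R))).
Proof.
by move=> P; exists 0%N, Phi; split => // t t0; rewrite mul0r mul0r oppr0 ee0 mul1r.
Qed.

Lemma qexp_cst c : qexp (fun=> c).
Proof. exact: qexp_PS (PS_cst c). Qed.

Lemma qexp_sum (n : nat) (F : 'I_n -> CC R -> CC R) : (forall i, qexp (F i)) ->
  qexp (fun t => \sum_(i < n) F i t).
Proof.
elim: n F => [|n IH] F HF.
  by apply: qexp_eq (qexp_cst 0) => t _; rewrite big_ord0.
apply: (@qexp_eq _ (fun t => F ord0 t + \sum_(i < n) F (lift ord0 i) t)).
  by move=> t _; rewrite big_ord_recl.
by apply: qexp_add => //; exact: IH.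
Qed.

Lemma qexp_ee (p : int) : qexp (fun t => ee (p%:~R / N%:R * t)).
Proof.
case: p => p.
  apply: qexp_eq (qexp_PS (PS_monomial 1 p)) => t t0.
  by rewrite mul1r -ee_pow.
exists p.+1, (fun=> 1); split=> [|t t0]; first exact: PS_cst.
by rewrite mulr1 NegzE mulrNz !mulNr.
Qed.

Lemma qexp_qder f t : qexp f -> 0 < imag t -> exists d, qder f t d.
Proof.
move=> [m [Phi [P H]]] t0; have [d1 D1] := PS_qder P t0.
have [d2 D2] := PS_qder (PS_monomial 1 m) t0.
have nz : 1 * ee (t / N%:R) ^+ m != 0 by rewrite mul1r -ee_pow ee_neq0.
have D := qderM (@qderV _ (fun z => 1 * ee (z / N%:R) ^+ m) _ _ nz D2) D1.
eexists; apply: (qder_eq_upper t0 _ D) => z z0.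
by rewrite H// eeN ee_pow mul1r.
Qed.

End Level.

Lemma upper_near t : 0 < imag t -> \forall z \near t, 0 < imag z.
Proof.
move=> t0; have /cvgC_cmod/(_ _ t0) := (@cvg_id _ (nbhs t)).
apply: filterS => z H; rewrite -[z](subrK t) addrC; apply: imag_pos_near => //.
by rewrite -cmodN opprB.
Qed.

Lemma qexp_holomorphic N f t : (0 < N)%N -> qexp N f -> 0 < imag t -> holomorphic_at f t.
Proof.
move=> N0 Hf t0; apply: filterS (upper_near t0) => z z0.
by have [d D] := qexp_qder N0 Hf z0; exact: qder_derivable D.
Qed.

(** Near [t] the function is bounded, so at a pole [h z = f z * (z - t) ^ m] would tend to 0,
    against [h t != 0]. The radius [r] makes this quantitative: [|h z| < |h t| / 2]. *)
Lemma qder_no_pole f t d : qder f t d -> ~ pole f t.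
Proof.
move=> /qder_lip[K [del [K0 d0 L]]] [m [h [m0 Hh h0 E]]].
have /derivable1_diffP/differentiable_continuous hc : derivable h t 1 by exact: nbhs_singleton Hh.
have ht : 0 < cmod (h t) by rewrite cmod_gt0.
pose r := Num.min 1 (Num.min del (cmod (h t) / (2 * (cmod (f t) + K + 1)))).
have D0 : 0 < 2 * (cmod (f t) + K + 1) by have := cmod_ge0 (f t); lra.
have r0 : 0 < r by rewrite !lt_min ltr01 d0 divr_gt0.
have h2 : 0 < cmod (h t) / 2 by rewrite divr_gt0.
have /cvgC_cmod/(_ _ h2) c1 : h z @[z --> t] --> h t by exact: hc.
have /cvgC_cmod/(_ _ r0) c2 := (@cvg_id _ (nbhs t)).
have [z [[[z1 z2] z3] z4]] : exists z, (((cmod (h t - h z) < cmod (h t) / 2 /\ cmod (t - z) < r) /\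
    f z = h z / (z - t) ^+ m) /\ z != t).
  apply: (@filter_ex _ (t^')).
  apply: filterI; last exact: (filterS _ (nbhs_dnbhs_neq t)).
  by apply: filterI => //; apply: filterI; exact: nbhs_dnbhs.
have zt : z - t != 0 by rewrite subr_eq0.
have hz : h z = f z * (z - t) ^+ m by rewrite z3 divfK// expf_neq0.
have zr : cmod (z - t) < r by rewrite -cmodN opprB.
move: zr; rewrite !lt_min => /and3P[zr1 zr2 zr3].
have fz : cmod (f z) <= cmod (f t) + K.
  have := L _ zr2; rewrite addrCA subrr addr0 => Lz.
  rewrite -[f z](subrK (f t)) addrC (le_trans (cmodD _ _))// lerD2l (le_trans Lz)//.
  by rewrite ler_piMr// ltW.
have : cmod (h z) <= (cmod (f t) + K + 1) * cmod (z - t).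
  rewrite hz cmodM cmodX; apply: ler_pM; rewrite ?cmod_ge0 ?exprn_ge0 ?cmod_ge0//; first lra.
  by case: m m0 {E z3 hz} => // m _; rewrite exprS ler_piMr ?cmod_ge0// exprn_ile1 ?cmod_ge0// ltW.
have : cmod (h t) <= cmod (h z) + cmod (h t - h z).
  by rewrite -{1}[h t](subrK (h z)) addrC cmodD.
move: zr3; rewrite ltr_pdivlMr//; nra.
Qed.

Lemma qexp_no_pole N f t : (0 < N)%N -> qexp N f -> 0 < imag t -> ~ pole f t.
Proof. by move=> N0 Hf t0; have [d D] := qexp_qder N0 Hf t0; exact: qder_no_pole D. Qed.

Lemma qexp_Laurent N f : (0 < N)%N -> qexp N f -> has_Laurent_qexpansion f.
Proof.
move=> N0 Hf; split; first by exists 0 => t t0 _; exact: qexp_no_pole Hf t0.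
have [m [Phi [[a Ha Ea] H]]] := Hf.
(* Summation starts at [- m], so term [k] has exponent [k - m] and coefficient [a k]. *)
exists N, (fun n : int => if n < - m%:Z then 0 else a (absz (n + m%:Z))), (- m%:Z).
split=> // [n ->//|t t0 _].
rewrite H// Ea ?cmod_ee_div//.
suff -> : series (fun k : nat => (if - m%:Z + k%:Z < - m%:Z then 0 else a (absz (- m%:Z + k%:Z + m%:Z))) *
    qpow ((- m%:Z + k%:Z)%:~R / N%:R) t) = (fun n => ee (- (m%:R / N%:R * t)) * series (pterm a (ee (t / N%:R))) n).
  exact: (cvgCM (@cvgC_cst R nat \oo _ (ee (- (m%:R / N%:R * t)))) (pbounded_cvg Ha (cmod_ee_div N0 t0))).
apply/funext => n.
rewrite /series /= mulr_sumr; apply: eq_bigr => k _.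
have -> : (- m%:Z + k%:Z < - m%:Z) = false by lia.
have -> : absz (- m%:Z + k%:Z + m%:Z) = k by lia.
rewrite /pterm [RHS]mulrCA -ee_pow// -eeD qpowE; congr (_ * ee _).
rewrite rmorphM fmorphV /= ratr_int ratr_nat; field.
exact: natr_neq0.
Qed.

Lemma qexp_half N f : (0 < N)%N -> qexp N f -> qexp (2 * N) (fun t => f (t / 2)).
Proof.
move=> N0 [m [Phi [P H]]]; exists m, Phi; split=> // t t0.
rewrite H ?imag_half ?divr_gt0//; congr (ee _ * Phi (ee _)); rewrite natrM; field; exact: natr_neq0.
Qed.

Lemma qexp_shift N f (x : R) : (0 < N)%N -> qexp N f -> qexp N (fun t => f (t + ofR x)).
Proof.
move=> N0 [m [Phi [P H]]].
exists m, (fun q => ee (- (m%:R / N%:R * ofR x)) * Phi (ee (ofR (x / N%:R)) * q)); split=> [|t t0].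
  by apply: PS_mul; [exact: PS_cst|apply: PS_twist => //; exact: cmod_ee_ofR].
rewrite H; last by rewrite imagD /imag /= addr0.
rewrite mulrA -!eeD; congr (ee _ * Phi (ee _)); first by ring.
by rewrite ofRM ofRV ofR_nat; ring.
Qed.

End QExpansions.

(** * Expansions of the entries of the vector *)

Section ThetaExpansions.
Context {R : realType}.
Implicit Types (t z w : CC R).

(** The variable is a root [z] of [q], with [q = z ^ e], so that fractional powers of [q] fit into
    the same power series. *)
Lemma PS_qpochs3 (e a a' b : nat) (al al' be : CC R) :
  cmod al <= 1 -> cmod al' <= 1 -> cmod be <= 1 ->
  (0 < e)%N -> (0 < a)%N -> (0 < a')%N -> (0 < b)%N ->
  PS (fun z => qpochs [:: al * (z ^+ e) ^+ a; al' * (z ^+ e) ^+ a'; be * (z ^+ e) ^+ b] (be * (z ^+ e) ^+ b)) /\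
  PS (fun z => (qpochs [:: al * (z ^+ e) ^+ a; al' * (z ^+ e) ^+ a'; be * (z ^+ e) ^+ b] (be * (z ^+ e) ^+ b))^-1).
Proof.
move=> al1 al1' be1 e0 a0 a0' b0.
have ea : (0 < e * a)%N by rewrite muln_gt0 e0.
have ea' : (0 < e * a')%N by rewrite muln_gt0 e0.
have eb : (0 < e * b)%N by rewrite muln_gt0 e0.
have [p1 v1 _] := qpoch_series al1 be1 ea eb.
have [p2 v2 _] := qpoch_series al1' be1 ea' eb.
have [p3 v3 _] := qpoch_series be1 be1 eb eb.
split.
  apply: PS_eq (PS_mul p1 (PS_mul p2 p3)) => z _.
  by rewrite /qpochs !big_cons big_nil mulr1 -!exprM.
apply: PS_eq (PS_mul v1 (PS_mul v2 v3)) => z _.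
by rewrite /qpochs !big_cons big_nil mulr1 -!exprM !invfM.
Qed.

Lemma qpow_half (x : rat) t : qpow x (t / 2) = qpow (x / 2) t.
Proof. by rewrite !qpowE; congr ee; field. Qed.

Lemma qpow1_root (N e : nat) t (x : CC R) : (0 < N)%N -> N%:R * x = e%:R ->
  qpow 1 (t * x) = ee (t / N%:R) ^+ e.
Proof.
move=> N0 H; rewrite eeX qpowE rmorph1 -H; congr ee; field.
exact: natr_neq0.
Qed.

Lemma qexp_qpow (N : nat) (x : rat) (p : int) : (0 < N)%N -> x = p%:~R / N%:R ->
  qexp N (fun t : CC R => qpow x t).
Proof.
move=> N0 xE; apply: qexp_eq (qexp_ee N0 p) => t _.
have E : ratr (p%:~R / N%:R) = p%:~R / N%:R :> CC R by field; rewrite pnatr_eq0 -lt0n.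
by rewrite qpowE xE E.
Qed.

Section Level.
Variables r i : nat.
Hypothesis i_lt : (i < 2 * r - 1)%N.
(** A common multiple of the denominators 2 and [8 (4 r - 1)] of the exponents, including those of
    [gdual] after its argument is halved. *)
Let N0 := (16 * (4 * r - 1))%N.
Let N0_gt0 : (0 < N0)%N. Proof. rewrite /N0; lia. Qed.

Let h1 : cmod (1 : CC R) <= 1. Proof. by rewrite cmod1. Qed.
Let h1' : cmod (-1 : CC R) <= 1. Proof. by rewrite cmodN cmod1. Qed.
Let hX (k : nat) : cmod ((-1) ^+ k : CC R) <= 1. Proof. by rewrite cmodX cmodN cmod1 expr1n. Qed.
Let N0E : (N0%:R : rat) = 64 * r%:R - 16.
Proof. by rewrite /N0 natrM natrB ?natrM; [ring | lia]. Qed.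
Let N8 : 32 * r%:R - 8 != 0 :> rat.
Proof.
have -> : 32 * r%:R - 8 = (8 * (4 * r - 1))%:R :> rat by rewrite natrM natrB ?natrM; [ring | lia].
by rewrite pnatr_eq0; lia.
Qed.
Let N16 : 16 * r%:R - 4 != 0 :> rat.
Proof.
have -> : 16 * r%:R - 4 = (4 * (4 * r - 1))%:R :> rat by rewrite natrM natrB ?natrM; [ring | lia].
by rewrite pnatr_eq0; lia.
Qed.
Let N64 : 64 * r%:R - 16 != 0 :> rat.
Proof. by rewrite -N0E pnatr_eq0 -lt0n. Qed.

Lemma g_qexp : qexp N0 (fun t : CC R => g r i.+1 t).
Proof.
have qE t : qpow 1 t = ee (t / N0%:R) ^+ N0.
  by rewrite -(@qpow1_root N0 N0 _ 1) ?mulr1.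
have [P1 _] : _ /\ _ := PS_qpochs3 (a := 8 * r - 4 * i.+1) (a' := 8 * r + 4 * i.+1 - 4) (b := 16 * r - 4)
  h1 h1 h1 N0_gt0 ltac:(lia) ltac:(lia) ltac:(lia).
have [_ V1] := PS_qpochs3 (a := 1) (a' := 3) (b := 4) h1 h1 h1 N0_gt0 ltac:(lia) ltac:(lia) ltac:(lia).
have [P2 _] := PS_qpochs3 (a := 2 * i.+1 - 1) (a' := 4 * r - 2 * i.+1) (b := 4 * r - 1)
  h1' h1 h1' N0_gt0 ltac:(lia) ltac:(lia) ltac:(lia).
have [_ V2] := PS_qpochs3 (a := 2) (a' := 2) (b := 4) h1 h1 h1 N0_gt0 ltac:(lia) ltac:(lia) ltac:(lia).
have al : qexp N0 (fun t : CC R => qpow ((4 * r%:R - 4 * i.+1%:R + 1) ^+ 2 / (32 * r%:R - 8)) t).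
  apply: (@qexp_qpow _ _ (2 * (4 * r%:Z - 4 * i.+1%:Z + 1) ^+ 2) N0_gt0); rewrite N0E.
  by field; rewrite N8 N64.
have be : qexp N0 (fun t : CC R => qpow ((2 * i.+1%:R - r%:R - 1) / 2) t).
  apply: (@qexp_qpow _ _ ((32 * r%:Z - 8) * (2 * i.+1%:Z - r%:Z - 1)) N0_gt0); rewrite N0E.
  by field; rewrite N64.
have Q := qexp_mul al (qexp_add N0_gt0 (qexp_mul be (qexp_PS N0 (PS_mul P1 V1)))
  (qexp_PS N0 (PS_mul P2 V2))).
apply: (qexp_eq _ Q) => t t0.
by rewrite /g; cbv zeta; rewrite qE !mul1r !mulN1r.
Qed.

Lemma gdual_qexp : qexp N0 (fun t : CC R => gdual r i.+1 t).
Proof.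
pose e := (8 * (4 * r - 1))%N; have e0 : (0 < e)%N by rewrite /e; lia.
have qE t : qpow 1 (t / 2) = ee (t / N0%:R) ^+ e.
  apply: (qpow1_root _ N0_gt0).
  have -> : N0 = (e * 2)%N by rewrite /N0 /e; lia.
  by rewrite natrM mulfK ?natr_neq0.
have [P1 _] := PS_qpochs3 (a := 2 * r - i.+1) (a' := 2 * r + i.+1 - 1) (b := 4 * r - 1)
  h1 h1 h1 e0 ltac:(lia) ltac:(lia) ltac:(lia).
have [_ V1] := PS_qpochs3 (a := 1) (a' := 3) (b := 4) h1 h1 h1 e0 ltac:(lia) ltac:(lia) ltac:(lia).
have [P2 _] := PS_qpochs3 (a := 2 * r - i.+1) (a' := 2 * r + i.+1 - 1) (b := 4 * r - 1)
  (hX (2 * r - i.+1)) (hX (2 * r + i.+1 - 1)) h1' e0 ltac:(lia) ltac:(lia) ltac:(lia).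
have [_ V2] := PS_qpochs3 (a := 1) (a' := 3) (b := 4) h1' h1' h1 e0 ltac:(lia) ltac:(lia) ltac:(lia).
have E : qexp N0 (fun t : CC R => qpow ((2 * i.+1%:R ^+ 2 - 2 * i.+1%:R - 2 * r%:R + 1) / (16 * r%:R - 4)) (t / 2)).
  apply: (@qexp_eq _ _ _ (fun t => qpow ((2 * i.+1%:R ^+ 2 - 2 * i.+1%:R - 2 * r%:R + 1) / (16 * r%:R - 4) / 2) t)).
    by move=> t _; exact: qpow_half.
  apply: (@qexp_qpow _ _ (2 * (2 * i.+1%:Z ^+ 2 - 2 * i.+1%:Z - 2 * r%:Z + 1)) N0_gt0); rewrite N0E.
  by field; rewrite N16 N64.
have Q := (qexp_mul (qexp_mul (qexp_cst N0 2^-1) E) (qexp_add N0_gt0 (qexp_PS N0 (PS_mul P1 V1))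
  (qexp_mul (qexp_cst N0 ((-1) ^+ ((i.+1 * (i.+1 - 1)) %/ 2))) (qexp_PS N0 (PS_mul P2 V2))))).
apply: (qexp_eq _ Q) => t t0.
rewrite /gdual /gdual_double; cbv zeta; rewrite qE.
by rewrite !(exprNn (ee _ ^+ e)) !mul1r !mulN1r.
Qed.

End Level.

Lemma Gvec_qexp r k : (0 < r)%N -> qexp (16 * (4 * r - 1)) (fun t : CC R => Gvec r t k 0).
Proof.
move=> r0; rewrite -[k]splitK; case: fintype.split => i /=.
  by apply: qexp_eq (g_qexp (ltn_ord i)) => t _; rewrite /Gvec col_mxEu mxE.
by apply: qexp_eq (gdual_qexp (ltn_ord i)) => t _; rewrite /Gvec col_mxEd mxE.
Qed.

Lemma qexp_mulmx N n (M : 'M[CC R]_n) (F : CC R -> 'cV[CC R]_n) : (0 < N)%N ->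
  (forall k, qexp N (fun t => F t k 0)) -> forall k, qexp N (fun t => (M *m F t) k 0).
Proof.
move=> N0 HF k; apply: (@qexp_eq _ _ _ (fun t => \sum_j M k j * F t j 0)).
  by move=> t _; rewrite mxE.
apply: qexp_sum => // j; apply: qexp_mul => //; exact: qexp_cst.
Qed.

End ThetaExpansions.

(** * Transformation under the groups and behaviour at the cusps *)

Section Assembly.
Context {R : realType}.
Implicit Types (t : CC R) (A B : 'M[R]_2).

Lemma mobius_imx (a b c d : int) t :
  mobius (imx a b c d) t = (a%:~R * t + b%:~R) / (c%:~R * t + d%:~R).
Proof. by rewrite /mobius !mxE /= !ofR_int. Qed.

Section Level.
Variable r : nat.
Hypothesis r_gt0 : (0 < r)%N.
Let n := (2 * r - 1 + (2 * r - 1))%N.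
Notation G := (@Gvec R r).

Lemma transforms_upper (k : int) : (exists K, forall t, G (t + k%:~R) = K *m G t) ->
  transforms G (imx 1 k 0 1).
Proof.
move=> [K HK]; exists K => t _; rewrite -HK mobius_imx; congr G.
by rewrite mul1r mul0r add0r divr1.
Qed.

Lemma transforms_lower (k : int) : (exists K, forall t, G (t + k%:~R) = K *m G t) ->
  transforms G (imx 1 0 (- (2 * k)) 1).
Proof.
move=> [K HK]; have [W HW] := @Gvec_fricke R r r_gt0.
exists (W *m (K *m W)) => t t0; have tn0 := imag_neq0 t0.
have W0 (s : CC R) : 0 < imag s -> 0 < imag (- (2 * s)^-1).
  by move=> s0; apply: imag_inv; exact: imag_natM_gt0.
have v0 : 0 < imag (- (2 * t)^-1 + k%:~R).
  by rewrite imagD -[k%:~R]ofR_int [imag (ofR _)]/= addr0; exact: W0.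
have e1 := HW _ t0; have e2 := HK (- (2 * t)^-1); have e3 := HW _ v0.
rewrite -mulmxA -[K *m W *m _]mulmxA -e1 -e2 -e3 mobius_imx; congr G.
have vn0 := imag_neq0 v0.
have d0 : 1 - 2 * k%:~R * t != 0.
  apply: contraNneq vn0 => H; apply/eqP; apply: (mulfI (_ : 2 * t != 0)); first by rewrite mulf_neq0 ?natr_neq0.
  by rewrite mulr0 -[RHS]oppr0 -H; field.
rewrite mul1r addr0 intrN intrM; field; rewrite tn0 /=.
have -> : -1 + k%:~R * (2 * t) = - (1 - 2 * k%:~R * t) by ring.
have -> : - (2 * k%:~R) * t + 1 = 1 - 2 * k%:~R * t by ring.
by rewrite oppr_eq0 d0.
Qed.

(** Both signs of [k] are required because membership in [transformers] includes the inverse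
    matrix. *)
Lemma upper_transformers (k : int) : (forall k' : int, (k' = k \/ k' = - k) ->
    exists K, forall t, G (t + k'%:~R) = K *m G t) ->
  transformers G (imx 1 k 0 1) /\ transformers G (imx 1 0 (2 * k) 1).
Proof.
move=> H; have Hp := H k (or_introl erefl); have Hm := H (- k) (or_intror erefl).
split; split.
- by rewrite det_mx22; ring.
- exact: transforms_upper.
- exists (imx 1 (- k) 0 1); last exact: transforms_upper.
  by rewrite imxM -imx1; congr imx; ring.
- by rewrite det_mx22; ring.
- by have := transforms_lower Hm; rewrite mulrN opprK.
- exists (imx 1 0 (- (2 * k)) 1); last exact: transforms_lower.
  by rewrite imxM -imx1; congr imx; ring.
Qed.

Lemma Gvec_automorphic (H : set 'M[R]_2) : PSL2_subgroup H -> H `<=` modular_group ->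
  H `<=` transformers G ->
  exists rho, vv_automorphic_form H rho G /\
    forall A t, H A -> 0 < imag t -> G (mobius A t) = rho A *m G t.
Proof.
move=> HH Hm HG.
have [|rho [Hrho HF]] := @multiplier_exists R n H G HH; first by move=> A /HG[].
have N0 : (0 < 16 * (4 * r - 1))%N by lia.
exists rho; split=> //; split=> //.
- exact: discrete_of_modular.
- by move=> i t t0; left; exact: qexp_holomorphic N0 (Gvec_qexp i r_gt0) t0.
- by move=> A t HA t0 _; exact: HF.
Qed.

(** In [A = C k] the factor [C] acts by the constant matrix [rho C]. The nontrivial representatives
    are [- 1 / t] and [- 1 / (t + 1)], the images of [t / 2] and [(t + 1) / 2] under
    [s |-> - 1 / (2 s)], so [Gvec_fricke] gives expansions in [ee (t / (2 N))]. *)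
Lemma Gvec_cusps (rho : 'M[R]_2 -> 'M[CC R]_n) :
  (forall A t, Gamma0_2 A -> 0 < imag t -> G (mobius A t) = rho A *m G t) ->
  forall A, modular_group A -> forall i, has_Laurent_qexpansion (fun t => G (mobius A t) i 0).
Proof.
move=> HF A /modular_cosets[C [k [HC -> hk]]] i.
set N := (16 * (4 * r - 1))%N; have N0 : (0 < N)%N by rewrite /N; lia.
have N20 : (0 < 2 * N)%N by rewrite muln_gt0.
have Gq j : qexp N (fun t => G t j 0) := @Gvec_qexp R r j r_gt0.
clearbody N.
have [W HW] := @Gvec_fricke R r r_gt0.
have dC : \det C = 1 by have [d1 _ _ _ _] := @Gamma0_2_subgroup R; exact: d1.
have red (N' : nat) (F : CC R -> 'cV[CC R]_n) : (0 < N')%N -> \det k = 1 ->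
  (forall t, 0 < imag t -> G (mobius k t) = F t) -> (forall j, qexp N' (fun t => F t j 0)) ->
  has_Laurent_qexpansion (fun t => G (mobius (C *m k) t) i 0).
  move=> N'0 dk kF qF; apply: (qexp_Laurent N'0).
  apply: (@qexp_eq _ _ _ (fun t => (rho C *m F t) i 0)) => [t t0|].
    by rewrite mobiusM// HF ?kF//; exact: imag_mobius.
  exact: qexp_mulmx.
case: hk => kE.
- apply: (red N G N0 _ _ Gq); first by rewrite kE det1.
  by move=> t _; rewrite kE mobius1.
- apply: (red (2 * N)%N (fun t => W *m G (t / 2)) N20).
  + by rewrite kE det_mx22; ring.
  + move=> t t0; have t20 : 0 < imag (t / 2) by rewrite imag_half divr_gt0.
    have e := HW _ t20; rewrite -e kE mobius_imx; congr G.
    have tn0 := imag_neq0 t0; by field.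
  + apply: (qexp_mulmx (F := fun t => G (t / 2)) _ N20) => j.
    exact: (qexp_half N0 (Gq j)).
- apply: (red (2 * N)%N (fun t => W *m G ((t + ofR 1) / 2)) N20).
  + by rewrite kE det_mx22; ring.
  + move=> t t0; have s0 : 0 < imag (t + ofR 1) by rewrite imagD /imag /= addr0.
    have t20 : 0 < imag ((t + ofR 1) / 2) by rewrite imag_half divr_gt0.
    have e := HW _ t20; rewrite -e kE mobius_imx; congr G.
    have sn0 := imag_neq0 s0; rewrite ofR1 in sn0 *; by field.
  + apply: (qexp_mulmx (F := fun t => G ((t + ofR 1) / 2)) _ N20) => j.
    exact: (qexp_shift (f := fun t => G (t / 2) j 0) 1 N20 (qexp_half N0 (Gq j))).
Qed.

End Level.
End Assembly.

Theorem theorem1p6 (R : realType) (r : nat) (hr : (2 <= r)%N) :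
  (exists rho : 'M[R]_2 -> 'M[CC R]_((2 * r - 1) + (2 * r - 1)),
     vv_automorphic_form
       (PSL2_generated [set mx22 1 2 0 1; mx22 1 0 4 1]) rho (@Gvec R r)) /\
  (odd r -> (3 <= r)%N ->
   exists rho : 'M[R]_2 -> 'M[CC R]_((2 * r - 1) + (2 * r - 1)),
     vv_modular_function Gamma0_2 rho (@Gvec R r)).
Proof.
have r_gt0 : (0 < r)%N by exact: ltnW.
split=> [|ro _].
  have [U L] : transformers (@Gvec R r) (imx 1 2 0 1) /\ transformers (@Gvec R r) (imx 1 0 4 1).
    (* Translation by 2 is conjugated to lower-left entry [2 * 2 = 4], the second generator. *)
    apply: (@upper_transformers R r r_gt0 2) => k' [->|->].
      exact: (Gvec_T_even r_gt0 1).
    exact: (Gvec_T_even r_gt0 (-1)).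
  pose S : set 'M[R]_2 := [set mx22 1 2 0 1; mx22 1 0 4 1].
  have Sm : S `<=` modular_group.
    by move=> _ [->|->]; apply/modular_imx; [exists 1, 2, 0, 1|exists 1, 0, 4, 1].
  have ST : S `<=` transformers (@Gvec R r) by move=> _ [->|->].
  have [|||rho [Hrho _]] := @Gvec_automorphic R r r_gt0 (PSL2_generated S).
  - exact: PSL2_generated_subgroup (@modular_subgroup R) Sm.
  - exact: smallest_sub (@modular_subgroup R) Sm.
  - exact: smallest_sub (@transformers_subgroup R _ (@Gvec R r)) ST.
  by exists rho.
have [U L] : transformers (@Gvec R r) (imx 1 1 0 1) /\ transformers (@Gvec R r) (imx 1 0 2 1).
  (* For odd [r] translation by 1 is available, and its conjugate has lower-left entry 2; together
     they generate [Gamma0_2] up to sign. *)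
  by apply: (@upper_transformers R r r_gt0 1) => k' _; exact: Gvec_T_odd.
have sub : Gamma0_2 `<=` transformers (@Gvec R r).
  exact: Gamma0_2_generated (@transformers_subgroup R _ (@Gvec R r)) U L.
have [rho [Hrho HF]] := @Gvec_automorphic R r r_gt0 Gamma0_2 (@Gamma0_2_subgroup R) (@Gamma0_2_sub_modular R) sub.
exists rho; split=> //; first exact: Gamma0_2_finite_index.
exact: (Gvec_cusps r_gt0 HF).
Qed.
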